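(* Let $\psi\in\mathcal S(\mathbb R^2)$ be a nonzero function whose Fourier transform $\hat\psi$ is compactly supported in $[1/2,2]^2$. Let $f\in L^2(\mathbb R^2)$, $(x_0,\xi^0)\in\mathbb R^2\times(\mathbb R_{>0})^2$ with $\xi^0=(\xi^0_1,\xi^0_2)$, and $s\ge 0$. Put $$\Gamma_\psi(\xi^0)=\left\{\tau=(\tau_1,\tau_2)\in(\mathbb R_{>0})^2 \;:\; \tfrac15\,\frac{\xi^0_1}{\xi^0_2}<\frac{\tau_1}{\tau_2}<5\,\frac{\xi^0_1}{\xi^0_2}\right\}.$$ (a) If there is a cutoff function $\phi\in C_0^\infty(\mathbb R^2)$ identically equal to $1$ in a neighborhood of $x_0$ such that $$\int_{\Gamma_\psi(\xi^0)}|(\phi f)^{\wedge}(\xi)|^2(1+|\xi|^2)^s\,d\xi<\infty,$$ then $f$ belongs to the Sobolev space $H^s$ microlocally at $(x_0,\xi^0)$ in the sense of PU (with respect to $\psi$). (b) Conversely, if there is a neighborhood $U(x_0)$ of $x_0$ such that $$\iint_{U(x_0)\times\Gamma_\psi(\xi^0)}|W_\psi f(x,\xi)|^2(1+|\xi|^2)^s\,\frac{dx\,d\xi}{|\xi_1\xi_2|}<\infty,$$ then $f$ belongs to the Sobolev space $H^s$ microlocally at $(x_0,\xi^0)$ in the sense of H\''ormander.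
   Context: Fourier transform convention: $\hat g(\tau)=\int_{\mathbb R^2}g(x)e^{-ix\cdot\tau}\,dx$, also written $(g)^{\wedge}(\tau)$. Pandey-Upadhyay's wavelet transform: for $f\in L^2(\mathbb R^2)$, $x=(x_1,x_2)\in\mathbb R^2$ and $\xi=(\xi_1,\xi_2)\in(\mathbb R-\{0\})^2$, $$W_\psi f(x,\xi)=\int_{\mathbb R^2}f(t)\,|\xi_1\xi_2|\,\overline{\psi}\bigl(\xi_1(t_1-x_1),\,\xi_2(t_2-x_2)\bigr)\,dt,$$ where $\overline{\psi}$ is the complex conjugate of $\psi$. A conical neighborhood of a nonzero vector $\xi^0$ is a neighborhood of $\xi^0$ that is invariant under multiplication by positive scalars. Microlocal $H^s$ in the sense of H\''ormander: for $f\in L^2(\mathbb R^2)$, $(x_0,\xi^0)\in\mathbb R^2\times(\mathbb R^2-\{0\})$ and $s\ge0$, $f$ is said to belong to the Sobolev space $H^s$ microlocally at $(x_0,\xi^0)$ in the sense of H\''ormander if there exist a cutoff function $\phi\in C_0^\infty(\mathbb R^2)$ identically equal to $1$ in a neighborhood of $x_0$ and a conical neighborhood $\Gamma(\xi^0)$ of $\xi^0$ such that $$\int_{\Gamma(\xi^0)}|(\phi f)^{\wedge}(\xi)|^2(1+|\xi|^2)^s\,d\xi<\infty.$$ Microlocal $H^s$ in the sense of PU (with respect to the fixed wavelet $\psi$): for $f\in L^2(\mathbb R^2)$, $(x_0,\xi^0)\in\mathbb R^2\times(\mathbb R-\{0\})^2$ and $s\ge0$, $f$ is said to belong to the Sobolev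 space $H^s$ microlocally at $(x_0,\xi^0)$ in the sense of PU if there exist a neighborhood $U(x_0)$ of $x_0$ and a conical neighborhood $\Gamma(\xi^0)$ of $\xi^0$ such that $$\iint_{U(x_0)\times\Gamma(\xi^0)}|W_\psi f(x,\xi)|^2(1+|\xi|^2)^s\,\frac{dx\,d\xi}{|\xi_1\xi_2|}<\infty.$$ *)

(* Defs.v *)
From HB Require Import structures.
From mathcomp Require Import all_boot all_order all_algebra.
From mathcomp Require Import complex.
From mathcomp Require Import all_classical all_reals all_analysis.

Set Implicit Arguments.
Unset Strict Implicit.
Unset Printing Implicit Defensive.

Import Order.TTheory GRing.Theory Num.Theory.
Import numFieldNormedType.Exports.

Local Open Scope classical_set_scope.
Local Open Scope ring_scope.
Local Open Scope complex_scope.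

Section Defs.
Context {R : realType}.

Local Notation mR2 := (measurableTypeR R * measurableTypeR R)%type.

Definition leb2 : set mR2 -> \bar R :=
  (@lebesgue_measure R \x @lebesgue_measure R)%E.

HB.instance Definition _ := Measure.on leb2.

(* The library's sigma-finite instance on products is shadowed by the one for
   subprobabilities. *)
Fact leb2_sigma_finite : sigma_finite setT leb2.
Proof.
have /sigma_finiteP[F [TF ndF Foo]] :=
  @sigma_finiteT _ _ _ (@lebesgue_measure R).
exists (fun n => F n `*` F n).
  rewrite -setXTT TF predeqE => -[x y]; split.
    move=> [/= [n _ Fnx] [k _ Fky]]; exists (maxn n k) => //; split.
    - by move: x Fnx; exact/subsetPset/ndF/leq_maxl.
    - by move: y Fky; exact/subsetPset/ndF/leq_maxr.
  by move=> [n _ []/= ? ?]; split; exists n.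
move=> k; have [? ?] := Foo k; split; first exact: measurableX.
by rewrite /leb2 product_measure1E// lte_mul_pinfty// ge0_fin_numE.
Qed.

HB.instance Definition _ :=
  Measure_isSigmaFinite.Build _ _ _ leb2 leb2_sigma_finite.

Definition leb4 : {measure set (mR2 * mR2) -> \bar R} := (leb2 \x leb2)%E.

(* Real and imaginary parts are integrated separately; as [Rintegral] is total,
   this is the Lebesgue integral only for integrable g. *)
Definition cintegral (g : R * R -> R[i]) : R[i] :=
  Rintegral leb2 setT (fun x => complex.Re (g x)) +i*
  Rintegral leb2 setT (fun x => complex.Im (g x)).

(* Elements of L^2(R^2) are represented by Borel functions; every a.e. class
   of Lebesgue measurable functions has such a representative. *)
Definition in_L2 (f : R * R -> R[i]) : Prop :=
  [/\ @measurable_fun _ _ mR2 (measurableTypeR R) setT (@complex.Re R \o f),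
      @measurable_fun _ _ mR2 (measurableTypeR R) setT (@complex.Im R \o f) &
      finite_norm leb2 2%:E (@Normc.normc R \o f)].

Definition basis2 (b : bool) : R * R := if b then (0, 1) else (1, 0).

(* The iterated partial derivative along a word of coordinate directions. *)
Definition iter_partial (w : seq bool) (g : R * R -> R) : R * R -> R :=
  foldr (fun b h => 'D_(basis2 b) h) g w.

Definition smooth (g : R * R -> R) : Prop :=
  forall w : seq bool,
    continuous (iter_partial w g) /\
    forall (b : bool) (x : R * R), derivable (iter_partial w g) x (basis2 b).

Definition csmooth (g : R * R -> R[i]) : Prop :=
  smooth (@complex.Re R \o g) /\ smooth (@complex.Im R \o g).

Definition rapidly_decreasing (g : R * R -> R) : Prop :=
  forall (w : seq bool) (a b : nat), exists M : R, forall x : R * R,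
    `|x.1 ^+ a * x.2 ^+ b * iter_partial w g x| <= M.

Definition schwartz (g : R * R -> R[i]) : Prop :=
  [/\ csmooth g, rapidly_decreasing (@complex.Re R \o g) &
      rapidly_decreasing (@complex.Im R \o g)].

Definition supp (g : R * R -> R[i]) : set (R * R) :=
  closure [set x | g x != 0].

Definition Cc_infty (g : R * R -> R[i]) : Prop :=
  csmooth g /\ compact (supp g).

Definition cutoff_at (x0 : R * R) (phi : R * R -> R[i]) : Prop :=
  Cc_infty phi /\ \forall x \near x0, phi x = 1.

(* The value of e^{-i theta} is [cos theta -i* sin theta]. *)
Definition fourier (g : R * R -> R[i]) (tau : R * R) : R[i] :=
  cintegral (fun x => let theta := x.1 * tau.1 + x.2 * tau.2 in
                      g x * (cos theta -i* sin theta)).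

Definition wavelet (psi f : R * R -> R[i]) (x xi : R * R) : R[i] :=
  cintegral (fun t => f t * `|xi.1 * xi.2|%:C *
    conjc (psi (xi.1 * (t.1 - x.1), xi.2 * (t.2 - x.2)))).

(* The norm of the product type R * R is the max norm, hence the explicit
   Euclidean norm. *)
Definition sobolev_weight (s : R) (xi : R * R) : R :=
  (1 + (xi.1 ^+ 2 + xi.2 ^+ 2)) `^ s.

Definition fourier_energy (s : R) (g : R * R -> R[i]) (Gamma : set (R * R))
    : \bar R :=
  (\int[leb2]_(xi in Gamma)
     (Normc.normc (fourier g xi) ^+ 2 * sobolev_weight s xi)%:E)%E.

(* Here z = (x, xi). The division by 0 on the null set xi_1 xi_2 = 0, where
   the transform is not defined, returns 0. *)
Definition wavelet_energy (s : R) (psi f : R * R -> R[i])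
    (U Gamma : set (R * R)) : \bar R :=
  (\int[leb4]_(z in U `*` Gamma)
     (Normc.normc (wavelet psi f z.1 z.2) ^+ 2 * sobolev_weight s z.2 /
      `|z.2.1 * z.2.2|)%:E)%E.

(* Neighborhoods serving as domains of integration are taken measurable. *)
Definition meas_nbhs (x0 : R * R) (U : set (R * R)) : Prop :=
  nbhs x0 U /\ @measurable _ mR2 U.

Definition conical_nbhs (xi0 : R * R) (Gamma : set (R * R)) : Prop :=
  meas_nbhs xi0 Gamma /\
  forall (c : R) (xi : R * R),
    0 < c -> Gamma xi -> Gamma (c * xi.1, c * xi.2).

Definition microlocal_Hormander (s : R) (f : R * R -> R[i])
    (x0 xi0 : R * R) : Prop :=
  exists (phi : R * R -> R[i]) (Gamma : set (R * R)),
    [/\ cutoff_at x0 phi, conical_nbhs xi0 Gamma &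
        (fourier_energy s (fun x => phi x * f x)%R Gamma < +oo)%E].

Definition microlocal_PU (psi : R * R -> R[i]) (s : R) (f : R * R -> R[i])
    (x0 xi0 : R * R) : Prop :=
  exists U Gamma : set (R * R),
    [/\ meas_nbhs x0 U, conical_nbhs xi0 Gamma &
        (wavelet_energy s psi f U Gamma < +oo)%E].

Definition Gamma_psi (xi0 : R * R) : set (R * R) :=
  [set tau | [/\ 0 < tau.1, 0 < tau.2,
     1 / 5 * (xi0.1 / xi0.2) < tau.1 / tau.2 &
     tau.1 / tau.2 < 5 * (xi0.1 / xi0.2)]].

End Defs.

(* Main.v *)
Require Import Defs.
From HB Require Import structures.
From mathcomp Require Import all_boot all_order all_algebra.
From mathcomp Require Import complex ring lra.
From mathcomp Require Import all_classical all_reals all_analysis measurable_realfun.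

(** On the Fourier side the transform at frequency [xi] is the multiplier
    [conj (psihat (sigma / xi))], up to a constant. As [psihat] lives on
    [[1/2, 2]^2], a Plancherel inequality in [x] bounds the wavelet energy of
    an integrable [h] over a cone by the Fourier energy of [h] over a cone whose
    aperture is larger by the factor [4]. If [q] vanishes near [x0], the decay
    of [psi] makes the wavelet energy of [q] finite near [x0]. Part (a) follows
    from [f = phi f + (1 - phi) f].

    For (b), let [g] be [f] truncated to a box around [x0], so that the wavelet
    energy of [g] is still finite near [x0], and let [phi] be a bump supported in
    a smaller box. Translating [x] by [v / xi] replaces the multiplier by
    [Psi v (sigma / xi)], where [Psi v = conj psihat * e^{i v . _}], and
    [c = \int_{xi > 0} Psi v (sigma / xi) dxi / (xi_1 xi_2)] does not depend on
    [sigma > 0]. It is nonzero for some [v]: otherwise pairing it with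
    [psi (- v)] gives [\int |psihat (sigma / xi)|^2 dxi / (xi_1 xi_2) = 0].
    For [sigma] close to [tau] the integral may be restricted to
    [xi / tau \in ]10/21, 21/10[^2]. Inserting it in
    [(phi g)^(tau) = kap^-1 \int ghat(sigma) phihat(tau - sigma) dsigma] writes
    [c (phi g)^(tau)] as the integral over those [xi] of the Fourier transform at
    [tau] of [phi * W g (_ + v / xi, xi)], up to an error which decays rapidly
    because [phihat] does. The Cauchy-Schwarz and Plancherel inequalities bound
    the energy of the main term by the wavelet energy of [g]. *)
Set Implicit Arguments.
Unset Strict Implicit.
Unset Printing Implicit Defensive.

Import Order.TTheory GRing.Theory Num.Theory.
Import numFieldNormedType.Exports.

Local Open Scope classical_set_scope.
Local Open Scope ring_scope.
Local Open Scope complex_scope.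

(** * Integrals of complex-valued functions *)


Notation nc := (@Normc.normc _).
Notation Re := (@complex.Re _).
Notation Im := (@complex.Im _).

Section ComplexNorm.
Context {R : realType}.
Implicit Types x y z : R[i].

Lemma nc_ge0 z : 0 <= nc z.
Proof. by case: z => a b /=; rewrite sqrtr_ge0. Qed.

Lemma ncE z : nc z ^+ 2 = Re z ^+ 2 + Im z ^+ 2.
Proof. by case: z => a b /=; rewrite sqr_sqrtr// addr_ge0// sqr_ge0. Qed.

Lemma nc_def z : nc z = Num.sqrt (Re z ^+ 2 + Im z ^+ 2).
Proof. by case: z. Qed.

Lemma ncM x y : nc (x * y) = nc x * nc y.
Proof. exact: Normc.normcM. Qed.

Lemma ncD x y : nc (x + y) <= nc x + nc y.
Proof. exact: le_normcD. Qed.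

Lemma ncN x : nc (- x) = nc x.
Proof. exact: normcN. Qed.

Lemma nc0 : nc (0 : R[i]) = 0.
Proof. exact: Normc.normc0. Qed.

Lemma ncC (a : R) : nc a%:C = `|a|.
Proof. by rewrite /= expr0n/= addr0 sqrtr_sqr. Qed.

Lemma ncJ z : nc (conjc z) = nc z.
Proof. by case: z => a b /=; rewrite sqrrN. Qed.

Lemma nc_Re z : `|Re z| <= nc z.
Proof.
rewrite -(ger0_norm (nc_ge0 z)) -ler_sqr ?nnegrE// !real_normK ?num_real//.
by rewrite ncE lerDl sqr_ge0.
Qed.

Lemma nc_Im z : `|Im z| <= nc z.
Proof.
rewrite -(ger0_norm (nc_ge0 z)) -ler_sqr ?nnegrE// !real_normK ?num_real//.
by rewrite ncE lerDr sqr_ge0.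
Qed.

Lemma nc_le z : nc z <= `|Re z| + `|Im z|.
Proof.
rewrite -(ger0_norm (nc_ge0 z)) -[leRHS]ger0_norm ?addr_ge0//.
rewrite -ler_sqr ?nnegrE// !real_normK ?num_real// ncE sqrrD !real_normK ?num_real//.
by rewrite [leRHS]addrAC lerDl mulrn_wge0// mulr_ge0.
Qed.

Lemma ncD_sqr x y : nc (x + y) ^+ 2 <= 2 * (nc x ^+ 2 + nc y ^+ 2).
Proof.
have := ncD x y; have := nc_ge0 (x + y); have := nc_ge0 x; have := nc_ge0 y.
set a := nc x; set b := nc y; set c := nc _ => b0 a0 c0 cab.
have : c ^+ 2 <= (a + b) ^+ 2 by rewrite ler_sqr ?nnegrE// addr_ge0.
have := sqr_ge0 (a - b); nra.
Qed.

Lemma nc_eq0 z : nc z = 0 -> z = 0.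
Proof. exact: Normc.eq0_normc. Qed.

Lemma ReM x y : Re (x * y) = Re x * Re y - Im x * Im y.
Proof. by case: x y => [a b] [c d]. Qed.

Lemma ImM x y : Im (x * y) = Re x * Im y + Im x * Re y.
Proof. by case: x y => [a b] [c d] /=. Qed.

Lemma ReD x y : Re (x + y) = Re x + Re y.
Proof. by case: x y => [a b] [c d]. Qed.

Lemma ImD x y : Im (x + y) = Im x + Im y.
Proof. by case: x y => [a b] [c d]. Qed.

Lemma ReJ x : Re (conjc x) = Re x.
Proof. by case: x. Qed.

Lemma ImJ x : Im (conjc x) = - Im x.
Proof. by case: x. Qed.

Lemma mul_conjc z : z * conjc z = (nc z ^+ 2)%:C.
Proof.
apply/eqP; rewrite eq_complex ncE ReM ImM ReJ ImJ /=.
by apply/andP; split; apply/eqP; ring.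
Qed.

Lemma complexP x y : Re x = Re y -> Im x = Im y -> x = y.
Proof. by case: x y => [a b] [c d] /= -> ->. Qed.

Definition cexp (t : R) : R[i] := cos t -i* sin t.

Lemma cexpD a b : cexp (a + b) = cexp a * cexp b.
Proof. by apply: complexP; rewrite /= ?cosD ?sinD; ring. Qed.

Lemma cexpN a : cexp (- a) = conjc (cexp a).
Proof. by apply: complexP; rewrite /= ?cosN ?sinN. Qed.

Lemma nc_cexp a : nc (cexp a) = 1.
Proof. by rewrite nc_def /= sqrrN cos2Dsin2 sqrtr1. Qed.

End ComplexNorm.

Section CIntegral.
Context {R : realType} d {T : measurableType d}.
Implicit Types (f g h : T -> R[i]) (k : T -> R).

Definition cmeas g := measurable_fun setT (Re \o g) /\ measurable_fun setT (Im \o g).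

Lemma cmeas_re k : measurable_fun setT k -> cmeas (fun x => (k x)%:C).
Proof. by move=> mk; split => //=; exact: measurable_cst. Qed.

Lemma cmeas_cst c : cmeas (fun=> c).
Proof. by split; exact: measurable_cst. Qed.

Lemma cmeasD f g : cmeas f -> cmeas g -> cmeas (fun x => f x + g x).
Proof.
move=> [f1 f2] [g1 g2]; split.
- rewrite (_ : _ \o _ = (Re \o f) \+ (Re \o g)); first exact: measurable_funD.
  by apply/funext => x /=; rewrite ReD.
- rewrite (_ : _ \o _ = (Im \o f) \+ (Im \o g)); first exact: measurable_funD.
  by apply/funext => x /=; rewrite ImD.
Qed.

Lemma cmeasM f g : cmeas f -> cmeas g -> cmeas (fun x => f x * g x).
Proof.
move=> [f1 f2] [g1 g2]; split.
- rewrite (_ : _ \o _ =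
    ((Re \o f) \* (Re \o g)) \- ((Im \o f) \* (Im \o g))).
    by apply: measurable_funB; apply: measurable_funM.
  by apply/funext => x /=; rewrite ReM.
- rewrite (_ : _ \o _ =
    ((Re \o f) \* (Im \o g)) \+ ((Im \o f) \* (Re \o g))).
    by apply: measurable_funD; apply: measurable_funM.
  by apply/funext => x /=; rewrite ImM.
Qed.

Lemma cmeasN f : cmeas f -> cmeas (fun x => - f x).
Proof.
move=> mf; rewrite (_ : (fun x => _) = (fun x => (-1) * f x)).
  exact/cmeasM/mf/cmeas_cst.
by apply/funext => x; rewrite mulN1r.
Qed.

Lemma cmeasB f g : cmeas f -> cmeas g -> cmeas (fun x => f x - g x).
Proof. by move=> mf mg; apply: cmeasD => //; exact: cmeasN. Qed.

Lemma cmeasJ f : cmeas f -> cmeas (fun x => conjc (f x)).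
Proof.
move=> [f1 f2]; split.
- by rewrite (_ : _ \o _ = Re \o f)//; apply/funext => x /=; rewrite ReJ.
- rewrite (_ : _ \o _ = \- (Im \o f)); first exact: measurable_funN.
  by apply/funext => x /=; rewrite ImJ.
Qed.

Lemma cmeas_cexp k : measurable_fun setT k -> cmeas (fun x => cexp (k x)).
Proof.
move=> mk; split => /=.
- apply: (measurableT_comp (f := cos)) => //.
  by apply: continuous_measurable_fun; exact: continuous_cos.
- apply: (@measurable_funN _ _ _ _ (fun x => sin (k x))).
  apply: (measurableT_comp (f := sin)) => //.
  by apply: continuous_measurable_fun; exact: continuous_sin.
Qed.

Lemma cmeas_nc f : cmeas f -> measurable_fun setT (fun x => nc (f x)).
Proof.
move=> [f1 f2]; rewrite (_ : (fun x => _) =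
  Num.sqrt \o ((fun x => (Re \o f) x ^+ 2) \+ (fun x => (Im \o f) x ^+ 2))).
  apply: measurableT_comp.
    by apply: continuous_measurable_fun; exact: sqrt_continuous.
  by apply: measurable_funD; apply: measurable_funX.
by apply/funext => x /=; rewrite nc_def.
Qed.

Lemma cmeas_nc2 f : cmeas f -> measurable_fun setT (fun x => nc (f x) ^+ 2).
Proof. by move=> /cmeas_nc mf; exact: measurable_funX. Qed.

Variable mu : {measure set T -> \bar R}.

Definition cint g : R[i] :=
  Rintegral mu setT (Re \o g) +i* Rintegral mu setT (Im \o g).

Definition cintegrable g := cmeas g /\ (\int[mu]_x (nc (g x))%:E < +oo)%E.

Lemma le_intE (k1 k2 : T -> R) : measurable_fun setT k1 -> measurable_fun setT k2 ->
  (forall x, 0 <= k1 x) -> (forall x, k1 x <= k2 x) ->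
  (\int[mu]_x (k1 x)%:E <= \int[mu]_x (k2 x)%:E)%E.
Proof.
move=> m1 m2 k0 k12; apply: ge0_le_integral => //.
- by move=> x _; rewrite lee_fin.
- exact/measurable_EFinP.
- exact/measurable_EFinP.
- by move=> x _; rewrite lee_fin.
Qed.

Lemma intEZ c k : 0 <= c -> measurable_fun setT k -> (forall x, 0 <= k x) ->
  (\int[mu]_x (c * k x)%:E = c%:E * \int[mu]_x (k x)%:E)%E.
Proof.
move=> c0 mk k0; under eq_integral do rewrite EFinM.
rewrite ge0_integralZl//; first exact/measurable_EFinP.
by move=> x _; rewrite lee_fin.
Qed.

Lemma intED (k1 k2 : T -> R) : measurable_fun setT k1 -> measurable_fun setT k2 ->
  (forall x, 0 <= k1 x) -> (forall x, 0 <= k2 x) ->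
  (\int[mu]_x (k1 x + k2 x)%:E = \int[mu]_x (k1 x)%:E + \int[mu]_x (k2 x)%:E)%E.
Proof.
move=> m1 m2 k10 k20; under eq_integral do rewrite EFinD.
rewrite ge0_integralD//.
- by move=> x _; rewrite lee_fin.
- exact/measurable_EFinP.
- by move=> x _; rewrite lee_fin.
- exact/measurable_EFinP.
Qed.

Lemma intE_ge0 k : (forall x, 0 <= k x) -> (0 <= \int[mu]_x (k x)%:E)%E.
Proof. by move=> k0; apply: integral_ge0 => x _; rewrite lee_fin. Qed.

Lemma le_integrableR k1 k2 : measurable_fun setT k1 -> measurable_fun setT k2 ->
  (forall x, `|k1 x| <= k2 x) -> (\int[mu]_x (k2 x)%:E < +oo)%E ->
  mu.-integrable setT (EFin \o k1).
Proof.
move=> m1 m2 k12 i2; apply/integrableP; split; first exact/measurable_EFinP.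
apply: le_lt_trans i2; apply: ge0_le_integral => //.
- by apply: measurableT_comp => //; exact/measurable_EFinP.
- exact/measurable_EFinP.
- by move=> x _; rewrite lee_fin.
Qed.

Lemma cintegrable_le g k : cmeas g -> measurable_fun setT k ->
  (forall x, nc (g x) <= k x) -> (\int[mu]_x (k x)%:E < +oo)%E -> cintegrable g.
Proof.
move=> mg mk gk ik; split => //; apply: le_lt_trans ik.
by apply: le_intE => //; [exact: cmeas_nc | move=> x; exact: nc_ge0].
Qed.

Lemma cintegrable_Re g : cintegrable g -> mu.-integrable setT (EFin \o (Re \o g)).
Proof.
move=> [mg ig]; apply: (le_integrableR mg.1 (cmeas_nc mg)) => //.
by move=> x; exact: nc_Re.
Qed.

Lemma cintegrable_Im g : cintegrable g -> mu.-integrable setT (EFin \o (Im \o g)).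
Proof.
move=> [mg ig]; apply: (le_integrableR mg.2 (cmeas_nc mg)) => //.
by move=> x; exact: nc_Im.
Qed.

Lemma cintegrableD f g : cintegrable f -> cintegrable g ->
  cintegrable (fun x => f x + g x).
Proof.
move=> [mf jf] [mg jg].
apply: (@cintegrable_le _ (fun x => nc (f x) + nc (g x))).
- exact: cmeasD.
- by apply: measurable_funD; exact: cmeas_nc.
- by move=> x; exact: ncD.
- rewrite intED; [|exact: cmeas_nc|exact: cmeas_nc|move=> x; exact: nc_ge0..].
  exact: lte_add_pinfty.
Qed.

Lemma cintegrableZ c g : cintegrable g -> cintegrable (fun x => c * g x).
Proof.
move=> [mg ig]; split; first exact/cmeasM/mg/cmeas_cst.
under eq_integral do rewrite ncM.
rewrite intEZ ?nc_ge0//; [|exact: cmeas_nc|by move=> x; exact: nc_ge0].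
by apply: lte_mul_pinfty => //; rewrite lee_fin nc_ge0.
Qed.

Lemma cintegrableN g : cintegrable g -> cintegrable (fun x => - g x).
Proof.
move=> [mg ig]; split; first exact: cmeasN.
by under eq_integral do rewrite ncN.
Qed.

Lemma cintegrableJ g : cintegrable g -> cintegrable (fun x => conjc (g x)).
Proof.
move=> [mg ig]; split; first exact: cmeasJ.
by under eq_integral do rewrite ncJ.
Qed.

Lemma eq_cint f g : f =1 g -> cint f = cint g.
Proof. by move=> /funext ->. Qed.

Lemma cint0 : cint (fun=> 0) = 0.
Proof.
have h : Rintegral mu setT (fun=> 0) = 0 by rewrite /Rintegral integral0.
by apply: complexP; exact: h.
Qed.

Lemma cintD f g : cintegrable f -> cintegrable g ->
  cint (fun x => f x + g x) = cint f + cint g.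
Proof.
move=> jf jg; apply: complexP; rewrite ?ReD ?ImD /=.
- rewrite -RintegralD//; [|exact: cintegrable_Re..].
  by congr Rintegral; apply/funext => x /=; rewrite ReD.
- rewrite -RintegralD//; [|exact: cintegrable_Im..].
  by congr Rintegral; apply/funext => x /=; rewrite ImD.
Qed.

Lemma cintZ c g : cintegrable g -> cint (fun x => c * g x) = c * cint g.
Proof.
move=> ig.
have iR := cintegrable_Re ig; have iI := cintegrable_Im ig.
have iR' r : mu.-integrable setT (EFin \o (fun x => r * (Re \o g) x)).
  by under [EFin \o _]eq_fun do rewrite /= EFinM; exact: integrableZl.
have iI' r : mu.-integrable setT (EFin \o (fun x => r * (Im \o g) x)).
  by under [EFin \o _]eq_fun do rewrite /= EFinM; exact: integrableZl.
apply: complexP; rewrite ?ReM ?ImM /=.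
- rewrite -!RintegralZl// -RintegralB//.
  by congr Rintegral; apply/funext => x /=; rewrite ReM.
- rewrite -!RintegralZl// -RintegralD//.
  by congr Rintegral; apply/funext => x /=; rewrite ImM.
Qed.

Lemma cintB f g : cintegrable f -> cintegrable g ->
  cint (fun x => f x - g x) = cint f - cint g.
Proof.
move=> jf jg; rewrite cintD//; last exact: cintegrableN.
congr (_ + _); rewrite -mulN1r -cintZ//.
by apply: eq_cint => x; rewrite mulN1r.
Qed.

Lemma cintJ g : cintegrable g -> cint (fun x => conjc (g x)) = conjc (cint g).
Proof.
move=> ig; apply: complexP; rewrite ?ReJ ?ImJ /=.
- by congr Rintegral; apply/funext => x /=; rewrite ReJ.
- rewrite -mulN1r -RintegralZl//; last exact: cintegrable_Im.
  by congr Rintegral; apply/funext => x /=; rewrite ImJ mulN1r.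
Qed.

(* The sharp constant is 1; 2 follows at once from real and imaginary parts. *)
Lemma nc_cint g : cmeas g ->
  ((nc (cint g))%:E <= 2%:E * \int[mu]_x (nc (g x))%:E)%E.
Proof.
move=> mg; have [ioo|] := ltP (\int[mu]_x (nc (g x))%:E)%E +oo%E; last first.
  by rewrite leye_eq => /eqP ->; rewrite gt0_muley ?lte_fin// leey.
have ig : cintegrable g by split.
have aux k : measurable_fun setT k -> (forall x, `|k x| <= nc (g x)) ->
    mu.-integrable setT (EFin \o k) ->
    ((`|Rintegral mu setT k|)%:E <= \int[mu]_x (nc (g x))%:E)%E.
  move=> mk kg ik.
  apply: (@le_trans _ _ (Rintegral mu setT (fun x => `|k x|))%:E).
    by rewrite lee_fin; exact: le_normr_Rintegral.
  rewrite /Rintegral fineK; last first.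
    by apply: integrable_fin_num => //; have := integrable_norm ik.
  apply: le_intE => //; [exact: measurableT_comp|exact: cmeas_nc].
have hR := aux _ mg.1 (fun x => nc_Re (g x)) (cintegrable_Re ig).
have hI := aux _ mg.2 (fun x => nc_Im (g x)) (cintegrable_Im ig).
apply: (@le_trans _ _ (`|Re (cint g)| + `|Im (cint g)|)%:E).
  by rewrite lee_fin nc_le.
rewrite EFinD (_ : 2%:E = 1 + 1)%E; last by rewrite -EFinD.
by rewrite ge0_muleDl// mul1e leeD.
Qed.

End CIntegral.

Lemma measurable_fun_fine d (T : measurableType d) (R : realType) (F : T -> \bar R) :
  measurable_fun setT F -> measurable_fun setT (fun x => fine (F x)).
Proof. by move=> mF; exact: measurableT_comp (fine_measurable measurableT) mF. Qed.

Section CIntegralProduct.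
Context {R : realType} d1 d2 {T1 : measurableType d1} {T2 : measurableType d2}.
Variable m1 : {sigma_finite_measure set T1 -> \bar R}.
Variable m2 : {sigma_finite_measure set T2 -> \bar R}.

Lemma measurable_Rintegral2 (G : T1 * T2 -> R) : measurable_fun setT G ->
  measurable_fun setT (fun x => Rintegral m2 setT (fun y => G (x, y))).
Proof.
move=> mG.
apply: (@measurable_fun_fine _ _ _ (fun x => \int[m2]_y (G (x, y))%:E)%E).
have mE : measurable_fun setT (EFin \o G) by exact/measurable_EFinP.
rewrite (_ : (fun x => _) = fun x =>
  (fubini_F m2 ((EFin \o G)^\+)%E x - fubini_F m2 ((EFin \o G)^\-)%E x)%E).
  apply: emeasurable_funB.
  - by apply: measurable_fun_fubini_tonelli_F => //; exact: measurable_funepos.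
  - by apply: measurable_fun_fubini_tonelli_F => //; exact: measurable_funeneg.
by apply/funext => x; rewrite [LHS]integralE; congr (_ - _)%E; apply: eq_integral => y _; rewrite ?funeposE ?funenegE.
Qed.

Lemma cmeas_cint2 (G : T1 * T2 -> R[i]) : cmeas G ->
  cmeas (fun x => cint m2 (fun y => G (x, y))).
Proof.
move=> [mR mI]; split.
- exact: (@measurable_Rintegral2 (Re \o G)).
- exact: (@measurable_Rintegral2 (Im \o G)).
Qed.

Lemma cmeas_cint1 (G : T1 -> T2 -> R[i]) : cmeas (fun z : T1 * T2 => G z.1 z.2) ->
  cmeas (fun x => cint m2 (G x)).
Proof. by move=> /cmeas_cint2. Qed.

Lemma Rintegral_Fubini (G : T1 -> T2 -> R) :
  (m1 \x m2)%E.-integrable setT (fun z => (G z.1 z.2)%:E) ->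
  Rintegral m1 setT (fun x => Rintegral m2 setT (G x)) =
  Rintegral m2 setT (fun y => Rintegral m1 setT (G^~ y)).
Proof.
move=> iG; have mG := measurable_int _ iG.
have mG' : measurable_fun setT (fun z => G z.1 z.2) by exact/measurable_EFinP.
have F := Fubini iG; rewrite /= in F.
rewrite /Rintegral; congr fine.
transitivity (\int[m1]_x \int[m2]_y (G x y)%:E)%E.
  apply: ae_eq_integral => //.
  - by have /measurable_EFinP := measurable_Rintegral2 mG'.
  - exact: measurable_int _ (integrable_fubini_F iG).
  - have := integrable_ae measurableT (integrable_fubini_F iG).
    by apply: filterS => x /(_ I) fx _; rewrite fineK.
have iH : (m2 \x m1)%E.-integrable setT (fun z => (G z.2 z.1)%:E).
  apply/integrable12ltyP.
    by apply/measurable_EFinP; apply: (measurableT_comp mG' (@measurable_swap _ _ _ _)).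
  by have [/(_ iG)] := @integrable21ltyP _ _ _ _ _ m1 m2 _ mG.
rewrite F; symmetry; apply: ae_eq_integral => //.
- apply/measurable_EFinP/measurable_fun_fine.
  exact: measurable_int _ (integrable_fubini_F iH).
- exact: measurable_int _ (integrable_fubini_F iH).
- have := integrable_ae measurableT (integrable_fubini_F iH).
  by apply: filterS => x /(_ I) fx _; rewrite fineK.
Qed.

Lemma Rintegral_prod (G : T1 -> T2 -> R) :
  (m1 \x m2)%E.-integrable setT (fun z => (G z.1 z.2)%:E) ->
  Rintegral (m1 \x m2)%E setT (fun z => G z.1 z.2) =
  Rintegral m1 setT (fun x => Rintegral m2 setT (G x)).
Proof.
move=> iG; have mG := measurable_int _ iG.
have mG' : measurable_fun setT (fun z => G z.1 z.2) by exact/measurable_EFinP.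
rewrite /Rintegral -integral12_prod_meas1//; congr fine.
apply: ae_eq_integral => //.
- exact: measurable_int _ (integrable_fubini_F iG).
- by have /measurable_EFinP := measurable_Rintegral2 mG'.
- have := integrable_ae measurableT (integrable_fubini_F iG).
  by apply: filterS => x /(_ I) fx _; rewrite fineK.
Qed.

Lemma tonelliR (G : T1 -> T2 -> R) : measurable_fun setT (fun z : T1 * T2 => G z.1 z.2) ->
  (forall x y, 0 <= G x y) ->
  (\int[m1]_x \int[m2]_y (G x y)%:E = \int[m2]_y \int[m1]_x (G x y)%:E)%E.
Proof.
move=> mG G0; apply: (fubini_tonelli (fun z => (G z.1 z.2)%:E)).
- exact/measurable_EFinP.
- by move=> z; rewrite lee_fin.
Qed.

Lemma cint_Fubini (G : T1 -> T2 -> R[i]) : cmeas (fun z : T1 * T2 => G z.1 z.2) ->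
  (\int[m1]_x \int[m2]_y (nc (G x y))%:E < +oo)%E ->
  cint m1 (fun x => cint m2 (G x)) = cint m2 (fun y => cint m1 (G^~ y)).
Proof.
move=> mG iG.
have j : (\int[(m1 \x m2)%E]_z (nc (G z.1 z.2))%:E < +oo)%E.
  rewrite (fubini_tonelli1 (fun z => (nc (G z.1 z.2))%:E))//.
  - by apply/measurable_EFinP; exact: cmeas_nc.
  - by move=> z; rewrite lee_fin nc_ge0.
have aux (K : T1 -> T2 -> R) : measurable_fun setT (fun z => K z.1 z.2) ->
    (forall x y, `|K x y| <= nc (G x y)) ->
    (m1 \x m2)%E.-integrable setT (fun z => (K z.1 z.2)%:E).
  by move=> mK KG; apply: (le_integrableR mK (cmeas_nc mG)) => // z; exact: KG.
apply: complexP => /=.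
- apply: (@Rintegral_Fubini (fun x y => Re (G x y))).
  exact: (aux (fun x y => Re (G x y)) mG.1 (fun x y => nc_Re (G x y))).
- apply: (@Rintegral_Fubini (fun x y => Im (G x y))).
  exact: (aux (fun x y => Im (G x y)) mG.2 (fun x y => nc_Im (G x y))).
Qed.

Lemma cint_prod (G : T1 -> T2 -> R[i]) :
  cintegrable (m1 \x m2)%E (fun z => G z.1 z.2) ->
  cint (m1 \x m2)%E (fun z => G z.1 z.2) = cint m1 (fun x => cint m2 (G x)).
Proof.
move=> iG; apply: complexP => /=.
- exact: (@Rintegral_prod (fun x y => Re (G x y))) (cintegrable_Re iG).
- exact: (@Rintegral_prod (fun x y => Im (G x y))) (cintegrable_Im iG).
Qed.

End CIntegralProduct.

(** * Affine changes of variables *)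


Section Affine.
Context {R : realType}.
Local Notation mu := (@lebesgue_measure R).
Local Notation mR := (measurableTypeR R).

Lemma measurable_affine (a b : R) : measurable_fun setT (fun x : mR => a + b * x : mR).
Proof.
apply: (@continuous_measurable_fun R) => x.
by apply: cvgD; [exact: cvg_cst | apply: cvgM; [exact: cvg_cst | exact: cvg_id]].
Qed.

Lemma lebesgue_affine (a b : R) : b != 0 -> forall A : set mR, measurable A ->
  mu A = (`|b|%:E * mu ((fun x : mR => (a + b * x)%R) @^-1` A))%E.
Proof.
move=> b0 A mA.
pose nu := measure_function_pushforward__canonical__measure_function_Measure
  mu (measurable_affine a b).
pose nu' := mscale (NngNum (normr_ge0 b)) nu.
rewrite (@lebesgue_measure_unique R nu')//.
move=> X [[u v] _ <-] /=.
rewrite /nu' /nu /mscale /= /pushforward /=.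
have bp : 0 < `|b| by rewrite normr_gt0.
have [b_gt0|b_lt0|be] := ltgtP 0 b; last by move: b0; rewrite -be eqxx.
- rewrite (_ : _ @^-1` _ = `](u - a) / b, (v - a) / b]%classic); last first.
    apply/seteqP; split => x /=; rewrite !in_itv/= ltr_pdivrMr// ler_pdivlMr//;
    by move=> /andP[h1 h2]; apply/andP; split; lra.
  rewrite !lebesgue_measure_itv/= !lte_fin ltr_pM2r ?invr_gt0// ltrD2r.
  rewrite gtr0_norm//; case: ifPn => _; last by rewrite mule0.
  by rewrite -!EFinB -EFinM; congr EFin; field.
- rewrite (_ : _ @^-1` _ = `[(v - a) / b, (u - a) / b[%classic); last first.
    apply/seteqP; split => x /=; rewrite !in_itv/= ltr_ndivlMr// ler_ndivrMr//;
    by move=> /andP[h1 h2]; apply/andP; split; lra.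
  rewrite !lebesgue_measure_itv/= !lte_fin ltr_nM2r ?invr_lt0// ltrD2r.
  rewrite ltr0_norm//; case: ifPn => _; last by rewrite mule0.
  by rewrite -!EFinB -EFinM; congr EFin; field.
Qed.

Lemma integral_affine (a b : R) (f : mR -> \bar R) : b != 0 ->
  measurable_fun setT f -> (forall x, 0 <= f x)%E ->
  (\int[mu]_x f x = `|b|%:E * \int[mu]_x f (a + b * x)%R)%E.
Proof.
move=> b0 mf f0.
pose nu := measure_function_pushforward__canonical__measure_function_Measure
  mu (measurable_affine a b).
pose nu' := mscale (NngNum (normr_ge0 b)) nu.
rewrite (@eq_measure_integral _ _ _ setT nu'); last first.
  by move=> A mA _; exact: lebesgue_affine.
rewrite ge0_integral_mscale//; congr (_ * _)%E.
have := @ge0_integral_pushforward _ _ _ _ _ _ (measurable_affine a b) mu setT f measurableT mf.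
by apply=> y _; exact: f0.
Qed.

End Affine.

Section CauchySchwarz.
Context {R : realType} d {T : measurableType d} (mu : {measure set T -> \bar R}).

Lemma discr_le (r A B : R) : 0 <= r -> 0 <= A -> 0 <= B ->
  (forall t, 0 < t -> 2 * r * t <= t ^+ 2 * A + B) -> r ^+ 2 <= A * B.
Proof.
move=> r0 A0 B0 h.
have [->|rn0] := eqVneq r 0; first by rewrite expr0n/= mulr_ge0.
have rp : 0 < r by rewrite lt_neqAle eq_sym rn0.
have [Ae0|An0] := eqVneq A 0.
  have := h ((B + 1) / r) (divr_gt0 (ltr_wpDl B0 ltr01) rp).
  rewrite Ae0 mulr0 add0r -mulrA [r * _]mulrC divfK//; lra.
have Ap : 0 < A by rewrite lt_neqAle eq_sym An0.
have := h (r / A) (divr_gt0 rp Ap).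
rewrite (_ : (r / A) ^+ 2 * A = r ^+ 2 / A); last by field.
rewrite (_ : 2 * r * (r / A) = 2 * (r ^+ 2 / A)); last by field.
move=> h1; have : r ^+ 2 / A <= B by lra.
by rewrite ler_pdivrMr// mulrC.
Qed.

Lemma CauchySchwarz (f g : T -> R) (A B : R) :
  measurable_fun setT f -> measurable_fun setT g ->
  (forall x, 0 <= f x) -> (forall x, 0 <= g x) -> 0 <= A -> 0 <= B ->
  (\int[mu]_x (f x ^+ 2)%:E <= A%:E)%E -> (\int[mu]_x (g x ^+ 2)%:E <= B%:E)%E ->
  exists2 r, (\int[mu]_x (f x * g x)%:E = r%:E)%E & 0 <= r /\ r ^+ 2 <= A * B.
Proof.
move=> mf mg f0 g0 A0 B0 hA hB.
have mfg : measurable_fun setT (fun x => f x * g x) by exact: measurable_funM.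
have key t : 0 < t ->
    ((2 * t)%:E * \int[mu]_x (f x * g x)%:E <= (t ^+ 2 * A + B)%:E)%E.
  move=> t0; have t20 : 0 <= 2 * t by rewrite mulr_ge0// ltW.
  rewrite -intEZ//; last by move=> x; rewrite mulr_ge0.
  apply: (@le_trans _ _ (\int[mu]_x (t ^+ 2 * f x ^+ 2 + g x ^+ 2)%:E)%E).
    apply: le_intE.
    - exact: measurable_funM.
    - apply: measurable_funD; last exact: measurable_funX.
      by apply: measurable_funM => //; exact: measurable_funX.
    - by move=> x; rewrite !mulr_ge0// ltW.
    - by move=> x; have := sqr_ge0 (t * f x - g x); nra.
  rewrite intED; last 4 first.
  - by apply: measurable_funM => //; exact: measurable_funX.
  - exact: measurable_funX.
  - by move=> x; rewrite mulr_ge0// sqr_ge0.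
  - by move=> x; rewrite sqr_ge0.
  rewrite intEZ ?sqr_ge0//; last 2 first.
  - exact: measurable_funX.
  - by move=> x; rewrite sqr_ge0.
  rewrite [leRHS]EFinD [(t ^+ 2 * A)%:E]EFinM; apply: leeD => //.
  by rewrite lee_wpmul2l// lee_fin sqr_ge0.
have i0 : (0 <= \int[mu]_x (f x * g x)%:E)%E by apply: intE_ge0 => x; exact: mulr_ge0.
have ifin : (\int[mu]_x (f x * g x)%:E < +oo)%E.
  have := key 1 ltr01.
  case: (\int[mu]_x _)%E i0 => [r _ _|_|//]; first by rewrite ltry.
  by rewrite gt0_muley ?lte_fin// ?mulr1// leye_eq.
exists (fine (\int[mu]_x (f x * g x)%:E)); first by rewrite fineK// ge0_fin_numE.
have r0 : 0 <= fine (\int[mu]_x (f x * g x)%:E) by exact: fine_ge0.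
split => //; apply: discr_le => // t /key.
by rewrite -{1}(@fineK _ (\int[mu]_x (f x * g x)%:E)%E) ?ge0_fin_numE// -EFinM lee_fin mulrAC.
Qed.

Lemma nc_cint_CauchySchwarz (G : T -> R[i]) (f k : T -> R) (K : R) : cmeas G ->
  measurable_fun setT f -> measurable_fun setT k ->
  (forall x, 0 <= f x) -> (forall x, 0 <= k x) -> 0 < K ->
  (\int[mu]_x (k x)%:E <= K%:E)%E -> (forall x, nc (G x) <= f x * k x) ->
  ((nc (cint mu G) ^+ 2)%:E <= (4 * K)%:E * \int[mu]_x (f x ^+ 2 * k x)%:E)%E.
Proof.
move=> mG mf mk f0 k0 K0 hK hG.
have mfk : measurable_fun setT (fun x => f x ^+ 2 * k x).
  by apply: measurable_funM => //; exact: measurable_funX.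
have i0 : (0 <= \int[mu]_x (f x ^+ 2 * k x)%:E)%E.
  by apply: intE_ge0 => x; rewrite mulr_ge0// sqr_ge0.
have [ifin|] := ltP (\int[mu]_x (f x ^+ 2 * k x)%:E)%E +oo%E; last first.
  by rewrite leye_eq => /eqP ->; rewrite gt0_muley ?leey// lte_fin mulr_gt0.
set A := (\int[mu]_x (f x ^+ 2 * k x)%:E)%E in i0 ifin *.
have Afin : A \is a fin_num by rewrite ge0_fin_numE.
have msk : measurable_fun setT (fun x => Num.sqrt (k x)).
  exact: measurableT_comp (continuous_measurable_fun (@sqrt_continuous R)) mk.
have [||||||//|//|r rE [r0 rAB]] := @CauchySchwarz (fun x => f x * Num.sqrt (k x))
  (fun x => Num.sqrt (k x)) (fine A) K.
- exact: measurable_funM.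
- exact: msk.
- by move=> x; rewrite mulr_ge0// sqrtr_ge0.
- by move=> x; exact: sqrtr_ge0.
- exact: fine_ge0.
- exact: ltW.
- rewrite fineK// /A le_eqVlt; apply/orP; left; apply/eqP.
  by apply: eq_integral => x _; rewrite exprMn sqr_sqrtr.
- by under eq_integral do rewrite sqr_sqrtr//.
have hle : ((nc (cint mu G))%:E <= (2 * r)%:E)%E.
  apply: le_trans (nc_cint mu mG) _; rewrite EFinM -rE.
  rewrite lee_wpmul2l//; apply: le_intE => //.
  - exact: cmeas_nc.
  - by apply: measurable_funM => //; exact: measurable_funM.
  - by move=> x; exact: nc_ge0.
  - by move=> x; rewrite -mulrA -expr2 sqr_sqrtr.
rewrite -(fineK Afin) -EFinM lee_fin.
rewrite lee_fin in hle.
have h4 : nc (cint mu G) ^+ 2 <= (2 * r) ^+ 2.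
  by rewrite ler_sqr ?nnegrE// ?nc_ge0// mulr_ge0.
by apply: le_trans h4 _; move: rAB; lra.
Qed.

End CauchySchwarz.

Section Plane.
Context {R : realType}.
Local Notation mu := (@lebesgue_measure R).
Local Notation mR := (measurableTypeR R).
Local Notation R2 := (measurableTypeR R * measurableTypeR R)%type.

Lemma integral_leb2 (f : R2 -> \bar R) : measurable_fun setT f ->
  (forall z, 0 <= f z)%E ->
  (\int[leb2]_z f z = \int[mu]_x \int[mu]_y f (x, y))%E.
Proof. by move=> mf f0; exact: (@fubini_tonelli1 _ _ _ _ _ mu mu f mf f0). Qed.

Definition affine2 (a b : R * R) (z : R * R) : R * R := (a.1 + b.1 * z.1, a.2 + b.2 * z.2).

Lemma measurable_affine2 (a b : R * R) : measurable_fun setT (affine2 a b : R2 -> R2).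
Proof.
apply/measurable_fun_pairP; split.
- exact: (measurableT_comp (measurable_affine a.1 b.1) measurable_fst).
- exact: (measurableT_comp (measurable_affine a.2 b.2) measurable_snd).
Qed.

Lemma integral_affine2 (a b : R * R) (f : R2 -> \bar R) : b.1 != 0 -> b.2 != 0 ->
  measurable_fun setT f -> (forall z, 0 <= f z)%E ->
  (\int[leb2]_z f z = `|b.1 * b.2|%:E * \int[leb2]_z f (affine2 a b z))%E.
Proof.
move=> b10 b20 mf f0.
have mfa : measurable_fun setT (f \o affine2 a b).
  exact: measurableT_comp mf (measurable_affine2 a b).
rewrite integral_leb2// (@integral_leb2 (f \o affine2 a b))//; last by move=> z; exact: f0.
have mx x : measurable_fun setT (fun y => f (x, y)).
  by apply: (measurableT_comp mf); exact: measurable_pair1.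
have e x := integral_affine a.2 b20 (mx x) (fun y => f0 (x, y)).
rewrite (eq_integral _ _ (fun x _ => e x)).
have mF : measurable_fun setT (fun x : mR => \int[mu]_y f (x, (a.2 + b.2 * y)%R))%E.
  have mg : measurable_fun setT (f \o affine2 (0, a.2) (1, b.2)).
    exact: measurableT_comp mf (measurable_affine2 _ _).
  rewrite (_ : (fun x : mR => _) = fubini_F mu (f \o affine2 (0, a.2) (1, b.2))).
    exact: (@measurable_fun_fubini_tonelli_F _ _ _ _ _ mu _ mg (fun z => f0 _)).
  apply/funext => x; apply: eq_integral => y _.
  by rewrite /= /affine2/= add0r mul1r.
rewrite (ge0_integralZl mu measurableT mF); last 2 first.
- by move=> x _; exact: integral_ge0.
- by rewrite lee_fin.
rewrite (integral_affine a.1 b10 mF)//; last by move=> x; exact: integral_ge0.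
by rewrite muleA -EFinM -normrM mulrC.
Qed.

Lemma integralR_affine2 (a b : R * R) (k : R2 -> R) : b.1 != 0 -> b.2 != 0 ->
  measurable_fun setT k -> (forall z, 0 <= k z) ->
  (\int[leb2]_z (k z)%:E = `|b.1 * b.2|%:E * \int[leb2]_z (k (affine2 a b z))%:E)%E.
Proof.
by move=> b1 b2 mk k0; rewrite (integral_affine2 a b1 b2)//; exact/measurable_EFinP.
Qed.

Lemma cmeas_affine2 (a b : R * R) (g : R2 -> R[i]) :
  cmeas g -> cmeas (fun z : R2 => g (affine2 a b z)).
Proof.
move=> [hR hI]; split.
- exact: measurableT_comp hR (measurable_affine2 a b).
- exact: measurableT_comp hI (measurable_affine2 a b).
Qed.

Lemma cintegrable_affine2 (a b : R * R) (g : R2 -> R[i]) : b.1 != 0 -> b.2 != 0 ->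
  cintegrable leb2 g -> cintegrable leb2 (fun z : R2 => g (affine2 a b z)).
Proof.
move=> b10 b20 [mg ig]; split; first exact: cmeas_affine2.
move: ig; rewrite (integralR_affine2 a b10 b20); last 2 first.
- exact: cmeas_nc.
- by move=> z; exact: nc_ge0.
have bp : 0 < `|b.1 * b.2| by rewrite normr_gt0 mulf_neq0.
rewrite !ltey; apply: contra => /eqP ->.
by rewrite gt0_muley ?lte_fin.
Qed.

Lemma cint_affine2 (a b : R * R) (g : R2 -> R[i]) : b.1 != 0 -> b.2 != 0 ->
  cintegrable leb2 g ->
  cint leb2 g = `|b.1 * b.2|%:C * cint leb2 (fun z => g (affine2 a b z)).
Proof.
move=> b10 b20 ig.
have iga := cintegrable_affine2 a b10 b20 ig.
have aux (k : R2 -> R) : leb2.-integrable setT (EFin \o k) ->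
    leb2.-integrable setT (EFin \o (k \o affine2 a b)) ->
    Rintegral leb2 setT k = `|b.1 * b.2| * Rintegral leb2 setT (k \o affine2 a b).
  move=> ik ika.
  have mEk := measurable_int _ ik.
  have hp := integral_affine2 a b10 b20 (measurable_funepos mEk) (funepos_ge0 _).
  have hn := integral_affine2 a b10 b20 (measurable_funeneg mEk) (funeneg_ge0 _).
  have fp := integrable_pos_fin_num measurableT ika.
  have fn := integrable_neg_fin_num measurableT ika.
  have ep (z : R2) : ((EFin \o k)^\+ (affine2 a b z) = (EFin \o (k \o affine2 a b))^\+ z)%E.
    by rewrite !funeposE.
  have en (z : R2) : ((EFin \o k)^\- (affine2 a b z) = (EFin \o (k \o affine2 a b))^\- z)%E.
    by rewrite !funenegE.
  rewrite (eq_integral _ _ (fun z _ => ep z)) in hp.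
  rewrite (eq_integral _ _ (fun z _ => en z)) in hn.
  rewrite /Rintegral integralE [in RHS]integralE hp hn -muleBr//; last first.
    exact: fin_num_adde_defr.
  by rewrite fineM// fin_numB fp fn.
apply: complexP; rewrite ?ReM ?ImM /= mul0r ?addr0 ?subr0.
- by apply: aux; [exact: cintegrable_Re ig | exact: cintegrable_Re iga].
- by rewrite ?add0r; apply: aux; [exact: cintegrable_Im ig | exact: cintegrable_Im iga].
Qed.

End Plane.

(** * Fourier inversion and the Plancherel inequality *)


Section Poisson1.
Context {R : realType}.
Local Notation mu := (@lebesgue_measure R).
Local Notation mR := (measurableTypeR R).

Lemma continuous_expNnorm : continuous (fun t : R => expR (- `|t|)).
Proof.
move=> t; apply: (@continuous_comp _ _ _ (fun t : R => - `|t|) (@expR R)).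
  by apply: continuousN; exact: norm_continuous.
exact: continuous_expR.
Qed.

Lemma integral_exp_cos_aux (x : R) :
  (\int[mu]_t (expR (- `|t|) * (1 + cos (x * t)))%:E =
    (2 * (1 + (1 + x ^+ 2)^-1))%:E)%E.
Proof.
have cosx : continuous (fun t : R => cos (x * t)).
  move=> t; apply: (@continuous_comp _ _ _ (fun t : R => x * t) (@cos R)).
    by apply: mulrl_continuous.
  exact: continuous_cos.
rewrite ge0_symfun_integralT; last 3 first.
- by move=> t; rewrite mulr_ge0 ?expR_ge0// -lerBlDl sub0r cos_geN1.
- move=> t; apply: cvgM; first exact: continuous_expNnorm.
  by apply: cvgD; [exact: cvg_cst | exact: cosx].
- by move=> t /=; rewrite normrN mulrN cosN.
rewrite -set_itvcy.
pose F (t : R) := expR (- t) * ((x * sin (x * t) - cos (x * t)) / (1 + x ^+ 2) - 1).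
have x2 : 0 < 1 + x ^+ 2 by rewrite ltr_pwDl// sqr_ge0.
have dF (t : R) : is_derive t 1 F (expR (- t) * (1 + cos (x * t))).
  apply: is_derive_eq; rewrite /GRing.scale/= !mulr1; field; exact/lt0r_neq0.
rewrite [X in (_ * X)%E](_ : _ = \int[mu]_(t in `[0%R, +oo[) (expR (- t) * (1 + cos (x * t)))%:E)%E; last first.
  by apply: eq_integral => t; rewrite inE/= in_itv/= andbT => t0; rewrite ger0_norm.
have Fy : F t @[t --> +oo] --> 0.
  pose M := (`|x| + 1) / (1 + x ^+ 2) + 1.
  have FM (t : R) : `|F t| <= expR (- t) * M.
    rewrite /F normrM ger0_norm ?expR_ge0// ler_wpM2l ?expR_ge0//.
    apply: (le_trans (ler_normB _ _)); rewrite normr1 lerD2r normrM.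
    rewrite (@ger0_norm _ (1 + x ^+ 2)^-1) ?invr_ge0 ?(ltW x2)//.
    rewrite ler_wpM2r ?invr_ge0 ?(ltW x2)//.
    apply: (le_trans (ler_normB _ _)); apply: lerD.
      by rewrite normrM ler_piMr// ler_norml sin_geN1 sin_le1.
    by rewrite ler_norml cos_geN1 cos_le1.
  have B0 : expR (- t) * M @[t --> +oo] --> 0.
    by rewrite -[X in _ --> X](mul0r M); apply: cvgM; [exact: cvgr_expR|exact: cvg_cst].
  apply: (@squeeze_cvgr _ _ _ _ (fun t => - (expR (- t) * M)) (fun t => expR (- t) * M)) => //.
    by near=> t; rewrite -ler_norml.
  by rewrite -oppr0; apply: cvgN.
rewrite (@ge0_continuous_FTC2y _ _ F 0 0)//.
- rewrite /F oppr0 mulr0 sin0 cos0 expR0 sub0e -EFinN -EFinM; congr EFin; field.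
  by rewrite gt_eqF.
- apply: continuous_subspaceT => t; apply: cvgM.
    by apply: (@continuous_comp _ _ _ (fun t : R => - t) (@expR R)); [exact: opp_continuous|exact: continuous_expR].
  by apply: cvgD; [exact: cvg_cst | exact: cosx].
- by apply: cvg_at_right_filter; apply/differentiable_continuous/derivable1_diffP; exact: ex_derive.
- by move=> t _; rewrite derive1E derive_val.
Unshelve. all: by end_near. Qed.

Lemma measurable_expNnorm : measurable_fun setT (fun t : mR => expR (- `|t|) : mR).
Proof. exact: (@continuous_measurable_fun R) continuous_expNnorm. Qed.

Lemma integral_expNnorm : (\int[mu]_t (expR (- `|t|))%:E = 2%:E)%E.
Proof.
have := integral_exp_cos_aux 0; rewrite expr0n/= addr0 invr1.
under eq_integral do rewrite mul0r cos0 mulrC.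
rewrite intEZ//; last exact: measurable_expNnorm.
case: (integral _ _ _) => [r [] h| |]; first by congr EFin; move: h; lra.
- by rewrite gt0_muley// lte_fin.
- by rewrite gt0_muleNy// lte_fin.
Qed.

Lemma cintegrable_expNnorm (x : R) :
  cintegrable mu (fun t : mR => (expR (- `|t|))%:C * cexp (x * t)).
Proof.
apply: (@cintegrable_le R _ mR mu _ (fun t : mR => expR (- `|t|))) => //.
- apply: cmeasM; first exact: cmeas_re measurable_expNnorm.
  by apply: cmeas_cexp; exact: mulrl_measurable.
- exact: measurable_expNnorm.
- by move=> t; rewrite ncM ncC nc_cexp mulr1 ger0_norm ?expR_ge0.
- by rewrite integral_expNnorm ltry.
Qed.

Lemma cint_expNnorm (x : R) :
  cint mu (fun t : mR => (expR (- `|t|))%:C * cexp (x * t)) =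
  (2 / (1 + x ^+ 2))%:C.
Proof.
have i1 := cintegrable_expNnorm x.
have i0 : mu.-integrable setT (EFin \o (fun t : mR => expR (- `|t|))).
  apply: (le_integrableR measurable_expNnorm measurable_expNnorm).
    by move=> t; rewrite ger0_norm ?expR_ge0.
  by rewrite integral_expNnorm ltry.
have iC := cintegrable_Re i1; have iS := cintegrable_Im i1.
apply: complexP => /=.
- transitivity (Rintegral mu setT (fun t : mR => expR (- `|t|) * (1 + cos (x * t)))
    - Rintegral mu setT (fun t : mR => expR (- `|t|))).
    rewrite -RintegralB//.
      by congr Rintegral; apply/funext => t /=; ring.
    have := integrableD measurableT iC i0.
    apply: eq_integrable => // t _ /=; rewrite -EFinD; congr EFin; ring.
  rewrite /Rintegral integral_exp_cos_aux integral_expNnorm/=; field.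
  by rewrite gt_eqF// ltr_pwDl// sqr_ge0.
- pose k (t : mR) := (expR (- `|t|))%:C * cexp (x * t).
  have iS' : mu.-integrable setT (EFin \o (Im \o k)) := iS.
  have mS' : measurable_fun setT (EFin \o (Im \o k)) := measurable_int _ iS'.
  rewrite /Rintegral integralE.
  have sE (f g : mR -> \bar R) : measurable_fun setT f -> (forall t, 0 <= f t)%E ->
      (forall t, f (- t)%R = g t) -> (\int[mu]_t f t = \int[mu]_t g t)%E.
    move=> mf f0 fg; rewrite (integral_affine 0 (_ : -1 != 0))//; last first.
    rewrite normrN1 mul1e; apply: eq_integral => t _.
    by rewrite add0r mulN1r fg.
  rewrite (sE _ (EFin \o (Im \o k))^\-)%E//.
  + by rewrite subee//; exact: (integrable_neg_fin_num measurableT iS').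
  + exact: (measurable_funepos mS').
  + move=> t; rewrite funeposE funenegE; congr (maxe _ 0)%E.
    rewrite -EFinN; congr EFin.
    rewrite [LHS](_ : _ = Im (k (- t)))// [RHS](_ : _ = - Im (k t))//.
    rewrite /k normrN mulrN cexpN; case: (cexp (x * t)) => a b /=; ring.
Qed.

Lemma integral_oneDsqrV : (\int[mu]_x ((1 + x ^+ 2)^-1)%:E = pi%:E :> \bar R)%E.
Proof.
rewrite ge0_symfun_integralT.
- by rewrite -set_itvcy integral0y_oneDsqr -EFinM; congr EFin; field.
- by move=> x; rewrite invr_ge0 addr_ge0// sqr_ge0.
- exact: continuous_oneDsqrV.
- by move=> x /=; rewrite sqrrN.
Qed.

End Poisson1.

Section CintLimits.
Context {R : realType} d {T : measurableType d} (mu : {measure set T -> \bar R}).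

Lemma cint_dominated (f_ : nat -> T -> R[i]) (f : T -> R[i]) (k : T -> R) :
  (forall n, cmeas (f_ n)) -> cmeas f -> measurable_fun setT k ->
  (forall x, Re (f_ n x) @[n --> \oo] --> Re (f x)) ->
  (forall x, Im (f_ n x) @[n --> \oo] --> Im (f x)) ->
  (forall n x, nc (f_ n x) <= k x) -> (\int[mu]_x (k x)%:E < +oo)%E ->
  (Re (cint mu (f_ n)) @[n --> \oo] --> Re (cint mu f)) /\
  (Im (cint mu (f_ n)) @[n --> \oo] --> Im (cint mu f)).
Proof.
move=> mf_ mf mk hR hI hk ik.
have k0 x : 0 <= k x by apply: le_trans (hk O x); exact: nc_ge0.
have ikE : mu.-integrable setT (EFin \o k).
  by apply: (le_integrableR mk mk) => // x; rewrite ger0_norm.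
have aux (g_ : nat -> T -> R) (g : T -> R) : (forall n, measurable_fun setT (g_ n)) ->
    measurable_fun setT g -> (forall x, g_ n x @[n --> \oo] --> g x) ->
    (forall n x, `|g_ n x| <= k x) ->
    Rintegral mu setT (g_ n) @[n --> \oo] --> Rintegral mu setT g.
  move=> mg_ mg hg gk.
  have [|||||ig _ cv] := @dominated_convergence _ _ _ mu setT measurableT
    (fun n => EFin \o g_ n) (EFin \o g) (EFin \o k).
  - by move=> n; exact/measurable_EFinP.
  - exact/measurable_EFinP.
  - by apply: aeW => x _; apply: cvg_EFin; [exact: nearW|exact: hg].
  - exact: ikE.
  - by apply: aeW => x n _ /=; rewrite lee_fin.
  - apply: fine_cvg; rewrite fineK//; exact: integrable_fin_num ig.
split.
- exact: (aux (fun n => Re \o f_ n) (Re \o f) (fun n => (mf_ n).1) mf.1 hR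
    (fun n x => le_trans (nc_Re _) (hk n x))).
- exact: (aux (fun n => Im \o f_ n) (Im \o f) (fun n => (mf_ n).2) mf.2 hI
    (fun n x => le_trans (nc_Im _) (hk n x))).
Qed.

Lemma nc_cint_real (k : T -> R) : measurable_fun setT k -> (forall x, 0 <= k x) ->
  (\int[mu]_x (k x)%:E < +oo)%E ->
  (nc (cint mu (fun x => (k x)%:C)))%:E = (\int[mu]_x (k x)%:E)%E.
Proof.
move=> mk k0 ik.
rewrite (_ : cint _ _ = (fine (\int[mu]_x (k x)%:E)%E)%:C); last first.
  apply: complexP => //=; rewrite (_ : _ \o _ = fun=> 0)//.
  by rewrite /Rintegral integral0.
have i0 := intE_ge0 mu k0.
by rewrite ncC ger0_norm ?fine_ge0// fineK// ge0_fin_numE.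
Qed.

End CintLimits.

Section PoissonPlane.
Context {R : realType}.
Local Notation mu := (@lebesgue_measure R).
Local Notation mR := (measurableTypeR R).
Local Notation R2 := (measurableTypeR R * measurableTypeR R)%type.

Definition dot (x y : R * R) := x.1 * y.1 + x.2 * y.2.

Lemma dotC x y : dot x y = dot y x.
Proof. by rewrite /dot; ring. Qed.

Lemma measurable_dot2 : measurable_fun setT (fun z : R2 * R2 => dot z.1 z.2 : mR).
Proof.
apply: measurable_funD; apply: measurable_funM.
- exact: measurableT_comp measurable_fst measurable_fst.
- exact: measurableT_comp measurable_fst measurable_snd.
- exact: measurableT_comp measurable_snd measurable_fst.
- exact: measurableT_comp measurable_snd measurable_snd.
Qed.

Lemma measurable_fun_dot d (T : measurableType d) (u v : T -> R2) :
  measurable_fun setT u -> measurable_fun setT v ->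
  measurable_fun setT (fun x => dot (u x) (v x) : mR).
Proof.
move=> mu' mv; apply: (measurableT_comp measurable_dot2 (g := fun x => (u x, v x))).
exact: measurable_fun_pair.
Qed.

Lemma fourierE (g : R * R -> R[i]) (t : R * R) :
  fourier g t = cint leb2 (fun x : R2 => g x * cexp (dot x t)).
Proof. by []. Qed.

Definition Gk (t : R * R) : R := expR (- `|t.1|) * expR (- `|t.2|).
Definition pk (x : R * R) : R := (2 / (1 + x.1 ^+ 2)) * (2 / (1 + x.2 ^+ 2)).

Lemma Gk_gt0 t : 0 < Gk t.
Proof. by rewrite mulr_gt0 ?expR_gt0. Qed.

Lemma Gk_le1 t : Gk t <= 1.
Proof. by rewrite mulr_ile1 ?expR_ge0// -expR0 ler_expR oppr_le0. Qed.

Lemma pk_gt0 x : 0 < pk x.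
Proof. by rewrite mulr_gt0// divr_gt0// ltr_pwDl// sqr_ge0. Qed.

Lemma measurable_Gk : measurable_fun setT (Gk : R2 -> mR).
Proof.
apply: measurable_funM.
- exact: measurableT_comp measurable_expNnorm measurable_fst.
- exact: measurableT_comp measurable_expNnorm measurable_snd.
Qed.

Lemma measurable_p1 : measurable_fun setT (fun x : mR => 2 / (1 + x ^+ 2) : mR).
Proof.
apply: (@continuous_measurable_fun R) => x; apply: cvgM; first exact: cvg_cst.
exact: continuous_oneDsqrV.
Qed.

Lemma measurable_pk : measurable_fun setT (pk : R2 -> mR).
Proof.
apply: measurable_funM.
- exact: measurableT_comp measurable_p1 measurable_fst.
- exact: measurableT_comp measurable_p1 measurable_snd.
Qed.

Lemma integral_prod2 (u v : mR -> R) (a b : R) : measurable_fun setT u ->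
  measurable_fun setT v -> (forall x, 0 <= u x) -> (forall x, 0 <= v x) ->
  0 <= b -> (\int[mu]_x (u x)%:E = a%:E)%E -> (\int[mu]_x (v x)%:E = b%:E)%E ->
  (\int[leb2]_(z in setT) ((u z.1 * v z.2)%R%:E) = (a * b)%:E)%E.
Proof.
move=> mu' mv u0 v0 b0 ia ib.
have muv : measurable_fun setT (fun z : R2 => u z.1 * v z.2 : mR).
  apply: measurable_funM.
  - exact: measurableT_comp mu' measurable_fst.
  - exact: measurableT_comp mv measurable_snd.
rewrite (@integral_leb2 _ (fun z : R2 => (u z.1 * v z.2)%:E)); last 2 first.
- exact/measurable_EFinP.
- by move=> z; rewrite lee_fin mulr_ge0.
have e x : (\int[mu]_y (u x * v y)%:E = (b * u x)%:E)%E.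
  by rewrite intEZ// ib -EFinM mulrC.
under eq_integral do rewrite /= e.
by rewrite intEZ// ia -EFinM mulrC.
Qed.

Lemma integral_Gk : (\int[leb2]_t (Gk t)%:E = 4%:E)%E.
Proof.
rewrite (_ : 4 = 2 * 2 :> R); last by ring.
apply: (@integral_prod2 (fun t => expR (- `|t|)) (fun t => expR (- `|t|))) => //.
- exact: measurable_expNnorm.
- exact: measurable_expNnorm.
- exact: integral_expNnorm.
- exact: integral_expNnorm.
Qed.

Definition kap : R := (2 * pi) * (2 * pi).

Lemma kap_gt0 : 0 < kap.
Proof. by rewrite !mulr_gt0// pi_gt0. Qed.

Lemma integral_pk : (\int[leb2]_t (pk t)%:E = kap%:E)%E.
Proof.
have p0 (x : mR) : 0 <= 2 / (1 + x ^+ 2) :> R.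
  by rewrite divr_ge0// addr_ge0// sqr_ge0.
have ip : (\int[mu]_x (2 / (1 + x ^+ 2))%:E = (2 * pi)%:E)%E.
  rewrite intEZ//.
  - by rewrite integral_oneDsqrV -EFinM.
  - by apply: (@continuous_measurable_fun R); exact: continuous_oneDsqrV.
  - by move=> x; rewrite invr_ge0 addr_ge0// sqr_ge0.
apply: (@integral_prod2 (fun x => 2 / (1 + x ^+ 2)) (fun x => 2 / (1 + x ^+ 2))) => //.
- exact: measurable_p1.
- exact: measurable_p1.
- by rewrite mulr_ge0// pi_ge0.
Qed.

Lemma cint_Gk (x : R * R) :
  cint leb2 (fun t : R2 => (Gk t)%:C * cexp (dot x t)) = (pk x)%:C.
Proof.
pose u (x t : mR) : R[i] := (expR (- `|t|))%:C * cexp (x * t).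
have uE (t : R2) : (Gk t)%:C * cexp (dot x t) = u x.1 t.1 * u x.2 t.2.
  rewrite /Gk /dot cexpD /u rmorphM/=; ring.
rewrite (eq_cint _ uE).
have iu : cintegrable leb2 (fun t : R2 => u x.1 t.1 * u x.2 t.2).
  split.
    have mm y : cmeas (u y) by have [] := cintegrable_expNnorm y.
    apply: cmeasM; split.
    - exact: measurableT_comp (mm x.1).1 measurable_fst.
    - exact: measurableT_comp (mm x.1).2 measurable_fst.
    - exact: measurableT_comp (mm x.2).1 measurable_snd.
    - exact: measurableT_comp (mm x.2).2 measurable_snd.
  under eq_integral => t _.
    rewrite -uE ncM nc_cexp mulr1 ncC ger0_norm ?(ltW (Gk_gt0 _))//.
  over.
  by rewrite integral_Gk ltry.
have -> := @cint_prod R _ _ _ _ mu mu (fun s t => u x.1 s * u x.2 t) iu.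
have e s : cint mu (fun t => u x.1 s * u x.2 t) = (2 / (1 + x.2 ^+ 2))%:C * u x.1 s.
  rewrite cintZ ?cint_expNnorm 1?mulrC//; exact: cintegrable_expNnorm.
rewrite (eq_cint _ e) cintZ; last exact: cintegrable_expNnorm.
by rewrite cint_expNnorm -rmorphM mulrC.
Qed.

End PoissonPlane.

Section Tonelli.
Context {R : realType} d1 d2 {T1 : measurableType d1} {T2 : measurableType d2}.
Variable m2 : {sigma_finite_measure set T2 -> \bar R}.

Lemma measurable_int2 (G : T1 -> T2 -> R) :
  measurable_fun setT (fun z : T1 * T2 => G z.1 z.2) -> (forall x y, 0 <= G x y) ->
  measurable_fun setT (fun x => \int[m2]_y (G x y)%:E)%E.
Proof.
move=> mG G0.
apply: (@measurable_fun_fubini_tonelli_F _ _ _ _ _ m2 (fun z => (G z.1 z.2)%:E)).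
- exact/measurable_EFinP.
- by move=> z; rewrite lee_fin.
Qed.

Lemma measurable_section2 (G : T1 -> T2 -> R) (x : T1) :
  measurable_fun setT (fun z : T1 * T2 => G z.1 z.2) -> measurable_fun setT (G x).
Proof. by move=> mG; exact: measurableT_comp mG (measurable_pair1 x). Qed.

Lemma measurable_section1 (G : T1 -> T2 -> R) (y : T2) :
  measurable_fun setT (fun z : T1 * T2 => G z.1 z.2) -> measurable_fun setT (G^~ y).
Proof. by move=> mG; exact: measurableT_comp mG (measurable_pair2 y). Qed.

Lemma cmeas_comp (g : T2 -> R[i]) (u : T1 -> T2) : cmeas g -> measurable_fun setT u ->
  cmeas (fun x => g (u x)).
Proof.
move=> [gR gI] mu'; split; [exact: measurableT_comp gR mu'|exact: measurableT_comp gI mu'].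
Qed.

Lemma cmeas_section2 (G : T1 -> T2 -> R[i]) (x : T1) :
  cmeas (fun z : T1 * T2 => G z.1 z.2) -> cmeas (G x).
Proof.
by move=> [mR mI]; split; [exact: measurableT_comp mR (measurable_pair1 x)
                          |exact: measurableT_comp mI (measurable_pair1 x)].
Qed.

Lemma cmeas_section1 (G : T1 -> T2 -> R[i]) (y : T2) :
  cmeas (fun z : T1 * T2 => G z.1 z.2) -> cmeas (G^~ y).
Proof.
by move=> [mR mI]; split; [exact: measurableT_comp mR (measurable_pair2 y)
                          |exact: measurableT_comp mI (measurable_pair2 y)].
Qed.

Variable m1 : {sigma_finite_measure set T1 -> \bar R}.

Lemma le_intE2 (G K : T1 -> T2 -> R) :
  measurable_fun setT (fun z : T1 * T2 => G z.1 z.2) ->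
  measurable_fun setT (fun z : T1 * T2 => K z.1 z.2) ->
  (forall x y, 0 <= G x y) -> (forall x y, G x y <= K x y) ->
  (\int[m1]_x \int[m2]_y (G x y)%:E <= \int[m1]_x \int[m2]_y (K x y)%:E)%E.
Proof.
move=> mG mK G0 GK; have K0 x y : 0 <= K x y by apply: le_trans (GK x y).
apply: ge0_le_integral => //.
- by move=> x _; exact: intE_ge0.
- exact: measurable_int2.
- exact: measurable_int2.
- move=> x _; apply: le_intE => //; exact: measurable_section2.
Qed.

Lemma cint_Fubini_le (G : T1 -> T2 -> R[i]) (u : T1 -> R) (v : T2 -> R) :
  cmeas (fun z : T1 * T2 => G z.1 z.2) ->
  measurable_fun setT u -> measurable_fun setT v ->
  (forall x, 0 <= u x) -> (forall y, 0 <= v y) ->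
  (\int[m1]_x (u x)%:E < +oo)%E -> (\int[m2]_y (v y)%:E < +oo)%E ->
  (forall x y, nc (G x y) <= u x * v y) ->
  cint m1 (fun x => cint m2 (G x)) = cint m2 (fun y => cint m1 (G^~ y)).
Proof.
move=> mG mu' mv u0 v0 iu iv hG; apply: cint_Fubini => //.
have muv : measurable_fun setT (fun z : T1 * T2 => u z.1 * v z.2).
  apply: measurable_funM.
  - exact: measurableT_comp mu' measurable_fst.
  - exact: measurableT_comp mv measurable_snd.
apply: (@le_lt_trans _ _ (\int[m1]_x \int[m2]_y (u x * v y)%:E)%E).
  apply: (le_intE2 (G := fun x y => nc (G x y)) (K := fun x y => u x * v y)) => //.
  - exact: cmeas_nc mG.
  - by move=> x y; exact: nc_ge0.
have v0' : (0 <= \int[m2]_y (v y)%:E)%E by exact: intE_ge0.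
have e x : (\int[m2]_y (u x * v y)%:E = (fine (\int[m2]_y (v y)%:E)%E * u x)%:E)%E.
  by rewrite intEZ// -[X in (_ * X)%E]fineK ?ge0_fin_numE// -EFinM mulrC.
under eq_integral do rewrite e.
by rewrite intEZ ?fine_ge0// lte_mul_pinfty// lee_fin fine_ge0.
Qed.

End Tonelli.

Section Fourier.
Context {R : realType}.
Local Notation R2 := (measurableTypeR R * measurableTypeR R)%type.
Local Notation mR := (measurableTypeR R).
Implicit Types h g : R2 -> R[i].

Definition scal (c : R) (x : R * R) : R * R := (c * x.1, c * x.2).
Definition sub2 (x y : R * R) : R * R := (x.1 - y.1, x.2 - y.2).

Lemma scal_affine c x : scal c x = affine2 (0, 0) (c, c) x.
Proof. by rewrite /affine2 /= !add0r. Qed.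

Lemma measurable_scal c : measurable_fun setT (scal c : R2 -> R2).
Proof.
rewrite (_ : scal c = affine2 (0, 0) (c, c)); first exact: measurable_affine2.
by apply/funext => x; exact: scal_affine.
Qed.

Lemma measurable_sub2 d (T : measurableType d) (u v : T -> R2) :
  measurable_fun setT u -> measurable_fun setT v ->
  measurable_fun setT (fun x => sub2 (u x) (v x) : R2).
Proof.
move=> mu' mv; apply: measurable_fun_pair; apply: measurable_funB.
- exact: measurableT_comp measurable_fst mu'.
- exact: measurableT_comp measurable_fst mv.
- exact: measurableT_comp measurable_snd mu'.
- exact: measurableT_comp measurable_snd mv.
Qed.

Lemma conjcM (a b : R[i]) : conjc (a * b) = conjc a * conjc b.
Proof. exact: rmorphM. Qed.

Lemma cexpB (a b : R) : cexp (a - b) = cexp a * conjc (cexp b).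
Proof. by rewrite cexpD cexpN. Qed.

Lemma dot_sub2 x y t : dot (sub2 x y) t = dot x t - dot y t.
Proof. by rewrite /dot /=; ring. Qed.

Definition Pc (c : R) (x : R * R) : R := c ^- 2 * pk (scal c^-1 x).

Lemma Pc_ge0 c x : 0 <= Pc c x.
Proof. by rewrite mulr_ge0 ?invr_ge0 ?sqr_ge0// ltW// pk_gt0. Qed.

Lemma measurable_Pc c : measurable_fun setT (Pc c : R2 -> mR).
Proof.
apply: measurable_funM; first exact: measurable_cst.
exact: measurableT_comp measurable_pk (measurable_scal _).
Qed.

Lemma cintegrable_Gk (c : R) (x : R * R) : 0 < c ->
  cintegrable leb2 (fun t : R2 => (Gk (scal c t))%:C * cexp (dot x t)).
Proof.
move=> c0.
have mG : measurable_fun setT (fun t : R2 => Gk (scal c t) : mR).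
  exact: measurableT_comp measurable_Gk (measurable_scal c).
apply: (@cintegrable_le _ _ R2 leb2 _ (fun t : R2 => Gk (scal c t))) => //.
- apply: cmeasM; first exact: cmeas_re.
  apply: cmeas_cexp; apply: (@measurable_fun_dot R _ R2 (fun=> x) id) => //.
- by move=> t; rewrite ncM ncC nc_cexp mulr1 ger0_norm// ltW// Gk_gt0.
- have := integral_Gk (R := R).
  rewrite (@integralR_affine2 R (0, 0) (c, c))/= ?gt_eqF//; last 2 first.
  + exact: measurable_Gk.
  + by move=> t; rewrite ltW// Gk_gt0.
  under eq_integral do rewrite -scal_affine.
  case: (integral _ _ _) => [r _|h|//]; first by rewrite ltry.
  by move: h; rewrite gt0_muley// lte_fin normr_gt0 mulf_neq0 ?gt_eqF.
Qed.

Lemma cint_Gkc (c : R) (x : R * R) : 0 < c ->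
  cint leb2 (fun t : R2 => (Gk (scal c t))%:C * cexp (dot x t)) = (Pc c x)%:C.
Proof.
move=> c0; have c0' : c != 0 by rewrite gt_eqF.
have i1 : cintegrable leb2 (fun t : R2 => (Gk t)%:C * cexp (dot (scal c^-1 x) t)).
  have := cintegrable_Gk (scal c^-1 x) ltr01.
  by congr cintegrable; apply/funext => t; rewrite /scal !mul1r -surjective_pairing.
have h := cint_Gk (scal c^-1 x).
rewrite (@cint_affine2 R (0, 0) (c, c))// in h.
have -> : (Pc c x)%:C = (c ^- 2)%:C * (pk (scal c^-1 x))%:C by rewrite -rmorphM.
rewrite -h mulrA -rmorphM [`|_|]ger0_norm ?mulr_ge0 ?(ltW c0)//.
rewrite -expr2 mulVf ?expf_neq0// rmorph1 mul1r; apply: eq_cint => t.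
rewrite -scal_affine; congr (_ * cexp _).
rewrite /dot /=; by field.
Qed.

Lemma integral_Pc_sub (c : R) (x : R * R) : 0 < c ->
  (\int[leb2]_y (Pc c (sub2 x y))%:E = (kap : R)%:E)%E.
Proof.
move=> c0; have c0' : c != 0 by rewrite gt_eqF.
rewrite -integral_pk [RHS](@integralR_affine2 R (scal c^-1 x) (- c^-1, - c^-1))/= ?oppr_eq0 ?invr_eq0//; last 2 first.
- exact: measurable_pk.
- by move=> t; rewrite ltW// pk_gt0.
have mm : measurable_fun setT (fun y : R2 => pk (affine2 (scal c^-1 x) (- c^-1, - c^-1) y)).
  exact: measurableT_comp measurable_pk (measurable_affine2 _ _).
rewrite -intEZ//; last by move=> y; rewrite ltW// pk_gt0.
apply: eq_integral => y _; congr EFin; rewrite /Pc.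
rewrite mulrNN ger0_norm ?mulr_ge0 ?invr_ge0 ?ltW// -invfM -expr2; congr (_ * pk _).
by rewrite /scal /affine2/=; congr pair; ring.
Qed.

Lemma integral_Pc_sub1 (c : R) (y : R * R) : 0 < c ->
  (\int[leb2]_x (Pc c (sub2 x y))%:E = (kap : R)%:E)%E.
Proof.
move=> c0; rewrite -(integral_Pc_sub y c0); apply: eq_integral => x _; congr EFin.
have e (a b : R) : (c^-1 * (a - b)) ^+ 2 = (c^-1 * (b - a)) ^+ 2 by ring.
by rewrite /Pc /pk /= (e x.1) (e x.2).
Qed.

Lemma cmeas_fourier_kernel h : cmeas h ->
  cmeas (fun z : R2 * R2 => h z.2 * cexp (dot z.2 z.1)).
Proof.
move=> mh; apply: cmeasM.
- exact: cmeas_comp mh measurable_snd.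
- by apply: cmeas_cexp; apply: measurable_fun_dot; [exact: measurable_snd|exact: measurable_fst].
Qed.

Lemma cmeas_fourier h : cmeas h -> cmeas (fourier h : R2 -> R[i]).
Proof.
move=> mh; apply: (@cmeas_cint1 _ _ _ R2 R2 leb2 (fun t x => h x * cexp (dot x t))).
exact: cmeas_fourier_kernel.
Qed.

Lemma cintegrable_fourier h t : cintegrable leb2 h ->
  cintegrable leb2 (fun x : R2 => h x * cexp (dot x t)).
Proof.
move=> [mh ih]; split.
- apply: cmeasM => //; apply: cmeas_cexp.
  exact: (@measurable_fun_dot R _ R2 id (fun=> t)).
- by under eq_integral do rewrite ncM nc_cexp mulr1.
Qed.

Lemma fourier_bound h : cintegrable leb2 h -> exists2 M, 0 <= M &
  forall t, nc (fourier h t) <= M.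
Proof.
move=> ih; exists (2 * fine (\int[leb2]_x (nc (h x))%:E)%E).
  by rewrite mulr_ge0// fine_ge0// intE_ge0// => x; exact: nc_ge0.
move=> t; rewrite -lee_fin EFinM fineK.
  apply: le_trans (nc_cint _ (cintegrable_fourier t ih).1) _.
  by under eq_integral do rewrite ncM nc_cexp mulr1.
by rewrite ge0_fin_numE ?ih.2// intE_ge0// => x; exact: nc_ge0.
Qed.

End Fourier.

Section Plancherel.
Context {R : realType}.
Local Notation R2 := (measurableTypeR R * measurableTypeR R)%type.
Local Notation mR := (measurableTypeR R).
Implicit Types h g : R2 -> R[i].

Lemma measurable_Pc_sub (c : R) :
  measurable_fun setT (fun z : R2 * R2 => Pc c (sub2 z.1 z.2) : mR).
Proof.
apply: (measurableT_comp (measurable_Pc c)).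
by apply: measurable_sub2; [exact: measurable_fst|exact: measurable_snd].
Qed.

Lemma Schur_le h (c : R) : 0 < c -> cmeas h ->
  (\int[leb2]_x \int[leb2]_y (nc (h x) * nc (h y) * Pc c (sub2 x y))%:E
   <= (kap : R)%:E * \int[leb2]_x (nc (h x) ^+ 2)%:E)%E.
Proof.
move=> c0 mh.
have mP := measurable_Pc_sub c.
have mh1 : measurable_fun setT (fun z : R2 * R2 => nc (h z.1) : mR).
  exact: measurableT_comp (cmeas_nc mh) measurable_fst.
have mh2 : measurable_fun setT (fun z : R2 * R2 => nc (h z.2) : mR).
  exact: measurableT_comp (cmeas_nc mh) measurable_snd.
pose G1 (x y : R2) := nc (h x) ^+ 2 * Pc c (sub2 x y).
pose G2 (x y : R2) := nc (h y) ^+ 2 * Pc c (sub2 x y).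
have mG1 : measurable_fun setT (fun z : R2 * R2 => G1 z.1 z.2 : mR).
  by apply: measurable_funM => //; exact: measurable_funX.
have mG2 : measurable_fun setT (fun z : R2 * R2 => G2 z.1 z.2 : mR).
  by apply: measurable_funM => //; exact: measurable_funX.
have G10 x y : 0 <= G1 x y by rewrite mulr_ge0 ?sqr_ge0// Pc_ge0.
have G20 x y : 0 <= G2 x y by rewrite mulr_ge0 ?sqr_ge0// Pc_ge0.
have I1 : (\int[leb2]_x \int[leb2]_y (G1 x y)%:E =
    (kap : R)%:E * \int[leb2]_x (nc (h x) ^+ 2)%:E)%E.
  have e x : (\int[leb2]_y (G1 x y)%:E = (kap * nc (h x) ^+ 2)%:E)%E.
    rewrite intEZ ?sqr_ge0//.
    - by rewrite integral_Pc_sub// -EFinM mulrC.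
    - exact: (measurable_section2 (G := fun x y : R2 => Pc c (sub2 x y)) x mP).
    - by move=> y; exact: Pc_ge0.
  under eq_integral do rewrite e.
  rewrite intEZ ?(ltW kap_gt0)//; first exact: cmeas_nc2.
  by move=> x; rewrite sqr_ge0.
have I2 : (\int[leb2]_x \int[leb2]_y (G2 x y)%:E =
    (kap : R)%:E * \int[leb2]_x (nc (h x) ^+ 2)%:E)%E.
  rewrite (@tonelliR _ _ _ _ _ leb2 leb2 G2 mG2 G20).
  have e y : (\int[leb2]_x (G2 x y)%:E = (kap * nc (h y) ^+ 2)%:E)%E.
    rewrite intEZ ?sqr_ge0//.
    - by rewrite integral_Pc_sub1// -EFinM mulrC.
    - exact: (measurable_section1 (G := fun x y : R2 => Pc c (sub2 x y)) y mP).
    - by move=> x; exact: Pc_ge0.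
  under eq_integral do rewrite e.
  rewrite intEZ ?(ltW kap_gt0)//; first exact: cmeas_nc2.
  by move=> x; rewrite sqr_ge0.
have mG : measurable_fun setT (fun z : R2 * R2 => 2^-1 * G1 z.1 z.2 + 2^-1 * G2 z.1 z.2 : mR).
  by apply: measurable_funD; apply: measurable_funM.
have G0 x y : 0 <= 2^-1 * G1 x y + 2^-1 * G2 x y by rewrite addr_ge0// mulr_ge0.
have mL : measurable_fun setT
    (fun z : R2 * R2 => nc (h z.1) * nc (h z.2) * Pc c (sub2 z.1 z.2) : mR).
  by apply: measurable_funM => //; exact: measurable_funM.
have L0 (x y : R2) : 0 <= nc (h x) * nc (h y) * Pc c (sub2 x y).
  by apply: mulr_ge0; [apply: mulr_ge0; exact: nc_ge0 | exact: Pc_ge0].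
apply: (@le_trans _ _ (\int[leb2]_x \int[leb2]_y (2^-1 * G1 x y + 2^-1 * G2 x y)%:E)%E).
  apply: ge0_le_integral => //.
  - by move=> x _; exact: intE_ge0.
  - exact: (@measurable_int2 _ _ _ _ _ leb2 (fun x y : R2 => nc (h x) * nc (h y) * Pc c (sub2 x y)) mL L0).
  - exact: (@measurable_int2 _ _ _ _ _ leb2 (fun x y : R2 => 2^-1 * G1 x y + 2^-1 * G2 x y) mG G0).
  - move=> x _; apply: le_intE => //.
    + exact: (measurable_section2 (G := fun x y : R2 => nc (h x) * nc (h y) * Pc c (sub2 x y)) x mL).
    + exact: (measurable_section2 (G := fun x y : R2 => 2^-1 * G1 x y + 2^-1 * G2 x y) x mG).
    + move=> y; rewrite /G1 /G2; move: (Pc c (sub2 x y)) (Pc_ge0 c (sub2 x y)) (nc (h x)) (nc (h y)) => P P0 a b.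
      by have := mulr_ge0 P0 (sqr_ge0 (a - b)); nra.
have e x : (\int[leb2]_y (2^-1 * G1 x y + 2^-1 * G2 x y)%:E =
    (2^-1)%:E * \int[leb2]_y (G1 x y)%:E + (2^-1)%:E * \int[leb2]_y (G2 x y)%:E)%E.
  have m1 := measurable_section2 (G := G1) x mG1.
  have m2 := measurable_section2 (G := G2) x mG2.
  have m1' : measurable_fun setT (fun y : R2 => 2^-1 * G1 x y : mR).
    exact: measurable_funM (measurable_cst _) m1.
  have m2' : measurable_fun setT (fun y : R2 => 2^-1 * G2 x y : mR).
    exact: measurable_funM (measurable_cst _) m2.
  rewrite (intED leb2 m1' m2'); last 2 first.
  - by move=> y; exact: mulr_ge0.
  - by move=> y; exact: mulr_ge0.
  by rewrite (intEZ leb2 _ m1)// (intEZ leb2 _ m2).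
under eq_integral do rewrite e.
have mI1 := measurable_int2 leb2 mG1 G10.
have mI2 := measurable_int2 leb2 mG2 G20.
have I1_ge0 x : (0 <= \int[leb2]_y (G1 x y)%:E)%E by exact: intE_ge0.
have I2_ge0 x : (0 <= \int[leb2]_y (G2 x y)%:E)%E by exact: intE_ge0.
rewrite (ge0_integralD leb2 measurableT); last 4 first.
- by move=> x _; apply: mule_ge0; rewrite ?lee_fin// I1_ge0.
- exact: measurable_funeM.
- by move=> x _; apply: mule_ge0; rewrite ?lee_fin// I2_ge0.
- exact: measurable_funeM.
rewrite (ge0_integralZl leb2 measurableT mI1); last 2 first.
- by move=> x _; exact: I1_ge0.
- by rewrite lee_fin.
rewrite (ge0_integralZl leb2 measurableT mI2); last 2 first.
- by move=> x _; exact: I2_ge0.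
- by rewrite lee_fin.
rewrite I1 I2 -ge0_muleDl ?lee_fin// -EFinD (_ : 2^-1 + 2^-1 = 1 :> R) ?mul1e//.
by field.
Qed.

(* The weight [Gk] makes Fubini applicable; its transform [Pc] is a nonnegative
   kernel of integral [kap], to which Schur's test applies. *)
Lemma plancherel_Gk h (c : R) : 0 < c -> cintegrable leb2 h ->
  (\int[leb2]_t (nc (fourier h t) ^+ 2 * Gk (scal c t))%:E
   <= (4 * kap)%:E * \int[leb2]_x (nc (h x) ^+ 2)%:E)%E.
Proof.
move=> c0 ih; have mh := ih.1.
have [M M0 hM] := fourier_bound ih.
have mF := cmeas_fourier mh.
have mG : measurable_fun setT (fun t : R2 => Gk (scal c t) : mR).
  exact: measurableT_comp measurable_Gk (measurable_scal c).
have G0 t : 0 <= Gk (scal c t) by rewrite ltW// Gk_gt0.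
have iG : (\int[leb2]_t (Gk (scal c t))%:E < +oo)%E.
  have [_] := cintegrable_Gk (0, 0) c0.
  by under eq_integral do rewrite ncM nc_cexp mulr1 ncC ger0_norm//.
pose k (t : R2) := nc (fourier h t) ^+ 2 * Gk (scal c t).
have mk : measurable_fun setT (k : R2 -> mR).
  by apply: measurable_funM => //; exact: cmeas_nc2.
have k0 t : 0 <= k t by rewrite mulr_ge0// sqr_ge0.
have ik : (\int[leb2]_t (k t)%:E < +oo)%E.
  apply: (@le_lt_trans _ _ (\int[leb2]_t (M ^+ 2 * Gk (scal c t))%:E)%E).
    apply: le_intE => //; first exact: measurable_funM.
    by move=> t; rewrite ler_wpM2r// ler_sqr ?nnegrE// nc_ge0.
  by rewrite intEZ ?sqr_ge0// lte_mul_pinfty ?lee_fin ?sqr_ge0.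
rewrite -/k -(nc_cint_real mk k0 ik).
pose W (t x : R2) : R[i] := conjc (fourier h t) * ((Gk (scal c t))%:C * cexp (dot x t)).
have mW : cmeas (fun z : R2 * R2 => W z.1 z.2).
  apply: cmeasM; first exact: cmeasJ (cmeas_comp mF measurable_fst).
  apply: cmeasM; first exact: cmeas_re (measurableT_comp mG measurable_fst).
  by apply: cmeas_cexp; apply: measurable_fun_dot; [exact: measurable_snd|exact: measurable_fst].
have ncW t x : nc (W t x) <= M * Gk (scal c t).
  by rewrite !ncM ncJ nc_cexp mulr1 ncC (ger0_norm (G0 t)) ler_wpM2r.
have E1 t : (k t)%:C = cint leb2 (fun x => h x * W t x).
  rewrite (_ : (fun x => _) = fun x => (conjc (fourier h t) * (Gk (scal c t))%:C) * (h x * cexp (dot x t))).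
    rewrite cintZ; last exact: cintegrable_fourier.
    by rewrite -fourierE mulrAC [_^*%C * _]mulrC mul_conjc -rmorphM.
  by apply/funext => x; rewrite /W; ring.
have mhW : cmeas (fun z : R2 * R2 => h z.2 * W z.1 z.2).
  by apply: cmeasM => //; exact: cmeas_comp mh measurable_snd.
have mMG : measurable_fun setT (fun t : R2 => M * Gk (scal c t) : mR).
  exact: measurable_funM (measurable_cst _) mG.
have MG0 t : 0 <= M * Gk (scal c t) by rewrite mulr_ge0.
have iMG : (\int[leb2]_t (M * Gk (scal c t))%:E < +oo)%E.
  by rewrite (intEZ leb2 M0 mG)// lte_mul_pinfty.
have mnh : measurable_fun setT (fun t : R2 => nc (h t) : mR) by exact: cmeas_nc.
rewrite (eq_cint leb2 E1).
rewrite (@cint_Fubini_le _ _ _ _ _ leb2 leb2 _ _ _ mhW mMG mnh MG0 _ iMG ih.2); last 2 first.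
- by move=> x; exact: nc_ge0.
- by move=> t x; rewrite ncM mulrC ler_wpM2r ?nc_ge0.
pose Q (x : R2) := cint leb2 (fun t => W t x).
have iW x : cintegrable leb2 (fun t => W t x).
  apply: (cintegrable_le (cmeas_section1 x mW) mMG) => //.
have E2 x : cint leb2 (fun t => h x * W t x) = h x * Q x by rewrite cintZ.
rewrite (eq_cint leb2 E2).
have QE x : Q x = cint leb2 (fun y => conjc (h y) * (Pc c (sub2 x y))%:C).
  pose V (t y : R2) : R[i] := conjc (h y) * ((Gk (scal c t))%:C * cexp (dot (sub2 x y) t)).
  have mV : cmeas (fun z : R2 * R2 => V z.1 z.2).
    apply: cmeasM; first exact: cmeasJ (cmeas_comp mh measurable_snd).
    apply: cmeasM; first exact: cmeas_re (measurableT_comp mG measurable_fst).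
    apply: cmeas_cexp; apply: measurable_fun_dot; last exact: measurable_fst.
    by apply: measurable_sub2; [exact: measurable_cst|exact: measurable_snd].
  have WE t : W t x = cint leb2 (V t).
    rewrite /W fourierE -cintJ; last exact: cintegrable_fourier.
    rewrite mulrC -cintZ; last exact: cintegrableJ (cintegrable_fourier _ ih).
    apply: eq_cint => y; rewrite /V dot_sub2 cexpB conjcM; ring.
  rewrite /Q (eq_cint leb2 WE).
  rewrite (@cint_Fubini_le _ _ _ _ _ leb2 leb2 _ _ _ mV mG mnh G0 _ iG ih.2); last 2 first.
  - by move=> y; exact: nc_ge0.
  - by move=> t y; rewrite !ncM ncJ nc_cexp mulr1 ncC (ger0_norm (G0 t)) mulrC.
  apply: eq_cint => y; rewrite cintZ ?cint_Gkc//; exact: cintegrable_Gk.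
have mQ : cmeas Q.
  apply: (@cmeas_cint1 _ _ _ R2 R2 leb2 (fun x t => W t x)).
  exact: cmeas_comp mW (@measurable_swap _ _ _ _).
have mhP : measurable_fun setT
    (fun z : R2 * R2 => nc (h z.1) * nc (h z.2) * Pc c (sub2 z.1 z.2) : mR).
  apply: measurable_funM; last exact: measurable_Pc_sub.
  apply: measurable_funM.
  - exact: measurableT_comp mnh measurable_fst.
  - exact: measurableT_comp mnh measurable_snd.
have hP0 (x y : R2) : 0 <= nc (h x) * nc (h y) * Pc c (sub2 x y).
  by apply: mulr_ge0; [apply: mulr_ge0; exact: nc_ge0 | exact: Pc_ge0].
have mI := @measurable_int2 _ _ _ _ _ leb2
  (fun x y : R2 => nc (h x) * nc (h y) * Pc c (sub2 x y)) mhP hP0.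
apply: (le_trans (nc_cint leb2 (cmeasM mh mQ))).
rewrite (_ : 4 * kap = 2 * (2 * kap) :> R); last by ring.
rewrite EFinM -muleA lee_wpmul2l//.
apply: (@le_trans _ _ (2%:E * (\int[leb2]_x \int[leb2]_y (nc (h x) * nc (h y) * Pc c (sub2 x y))%:E))%E); last first.
  by rewrite EFinM -muleA lee_wpmul2l//; exact: Schur_le.
have I0 x : (0 <= \int[leb2]_y (nc (h x) * nc (h y) * Pc c (sub2 x y))%:E)%E by exact: intE_ge0.
rewrite -(ge0_integralZl leb2 measurableT mI) ?lee_fin//.
apply: ge0_le_integral => //.
- by move=> x _; rewrite lee_fin nc_ge0.
- by apply/measurable_EFinP; apply: cmeas_nc; exact: cmeasM.
- exact: measurable_funeM.
move=> x _; rewrite ncM EFinM.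
have mVx : measurable_fun setT (fun y : R2 => nc (h y) * Pc c (sub2 x y) : mR).
  apply: measurable_funM => //.
  exact: (measurable_section2 (G := fun x y : R2 => Pc c (sub2 x y)) x (measurable_Pc_sub c)).
have Vx0 (y : R2) : 0 <= nc (h y) * Pc c (sub2 x y).
  by apply: mulr_ge0; [exact: nc_ge0 | exact: Pc_ge0].
have -> : (\int[leb2]_y (nc (h x) * nc (h y) * Pc c (sub2 x y))%:E =
    (nc (h x))%:E * \int[leb2]_y (nc (h y) * Pc c (sub2 x y))%:E)%E.
  rewrite -(intEZ leb2 (nc_ge0 _) mVx)//.
  by apply: eq_integral => y _; congr EFin; ring.
rewrite muleCA lee_wpmul2l ?lee_fin ?nc_ge0// QE.
have mC : cmeas (fun y : R2 => (conjc (h y) * (Pc c (sub2 x y))%:C)).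
  apply: cmeasM; first exact: cmeasJ.
  apply: cmeas_re.
  exact: (measurable_section2 (G := fun x y : R2 => Pc c (sub2 x y)) x (measurable_Pc_sub c)).
apply: (le_trans (nc_cint leb2 mC)); rewrite lee_wpmul2l//.
apply: le_intE => //; first exact: cmeas_nc.
- by move=> y; exact: nc_ge0.
- by move=> y; rewrite ncM ncJ ncC (ger0_norm (Pc_ge0 _ _)).
Qed.

Lemma plancherel_le h : cintegrable leb2 h ->
  (\int[leb2]_t (nc (fourier h t) ^+ 2)%:E
   <= (4 * kap)%:E * \int[leb2]_x (nc (h x) ^+ 2)%:E)%E.
Proof.
move=> ih; have mF := cmeas_fourier ih.1.
pose c (n : nat) : R := n.+1%:R^-1.
have c0 n : 0 < c n by rewrite invr_gt0.
pose u n (t : R2) := (nc (fourier h t) ^+ 2 * Gk (scal (c n) t))%:E.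
have mu' n : measurable_fun setT (u n).
  apply/measurable_EFinP; apply: measurable_funM; first exact: cmeas_nc2.
  exact: measurableT_comp measurable_Gk (measurable_scal _).
have u0 n t : setT t -> (0 <= u n t)%E.
  by move=> _; rewrite lee_fin mulr_ge0 ?sqr_ge0// ltW// Gk_gt0.
have und t : setT t -> {homo u^~ t : n m / (n <= m)%N >-> (n <= m)%E}.
  move=> _ n m nm; rewrite lee_fin ler_wpM2l ?sqr_ge0//.
  have cc : c m <= c n by rewrite lef_pV2 ?posrE// ler_nat.
  by rewrite /Gk /= ler_pM ?expR_ge0// ler_expR lerN2 !normrM ler_wpM2r//
    !gtr0_norm.
have cv0 (a : R) : c n * a @[n --> \oo] --> (0 : R).
  rewrite -[X in _ --> X](mul0r a); apply: cvgM; last exact: cvg_cst.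
  exact: cvg_harmonic.
have e1 (a : R) : expR (- `|c n * a|) @[n --> \oo] --> (1 : R).
  rewrite -expR0 -oppr0 -[X in - X](normr0 R).
  apply: continuous_cvg; first exact: continuous_expR.
  by apply: cvgN; apply: cvg_norm.
have cvu t : u n t @[n --> \oo] --> (nc (fourier h t) ^+ 2)%:E.
  apply: cvg_EFin; first exact: nearW.
  rewrite -[X in _ --> X](mulr1); apply: cvgM; first exact: cvg_cst.
  by rewrite -[X in _ --> X](mulr1); apply: cvgM; exact: e1.
have := @cvg_monotone_convergence _ _ _ leb2 setT measurableT u mu' u0 und.
move=> cv.
rewrite (_ : (fun t => _) = fun t => limn (u^~ t)); last first.
  by apply/funext => t; apply/esym/cvg_lim => //; exact: cvu.
rewrite -(cvg_lim _ cv)//; apply: lime_le; first by apply/cvg_ex; eexists; exact: cv.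
by apply: nearW => n; exact: plancherel_Gk.
Qed.

End Plancherel.

Section Inversion.
Context {R : realType}.
Local Notation R2 := (measurableTypeR R * measurableTypeR R)%type.
Local Notation mR := (measurableTypeR R).
Implicit Types h g : R2 -> R[i].

Lemma cvg_affine (x z : R * R) (k : R * R -> R) : continuous k ->
  k (x.1 + n.+1%:R^-1 * z.1, x.2 + n.+1%:R^-1 * z.2) @[n --> \oo] --> k x.
Proof.
move=> ck.
have cv (a b : R) : a + n.+1%:R^-1 * b @[n --> \oo] --> a.
  rewrite -[X in _ --> X]addr0 -(mul0r b); apply: cvgD; first exact: cvg_cst.
  by apply: cvgM; [exact: cvg_harmonic|exact: cvg_cst].
apply: continuous_cvg; first exact: ck.
case: x => x1 x2; exact: (cvg_pair (cv x1 z.1) (cv x2 z.2)).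
Qed.

Lemma cvg_Gk (t : R * R) : Gk (scal n.+1%:R^-1 t) @[n --> \oo] --> (1 : R).
Proof.
pose c (n : nat) : R := n.+1%:R^-1.
have cv0 (a : R) : c n * a @[n --> \oo] --> (0 : R).
  rewrite -[X in _ --> X](mul0r a); apply: cvgM; last exact: cvg_cst.
  exact: cvg_harmonic.
have e1 (a : R) : expR (- `|c n * a|) @[n --> \oo] --> (1 : R).
  rewrite -expR0 -oppr0 -[X in - X](normr0 R).
  apply: continuous_cvg; first exact: continuous_expR.
  by apply: cvgN; apply: cvg_norm.
by rewrite -[X in _ --> X](mulr1); apply: cvgM; exact: e1.
Qed.

Lemma ReMr (w : R[i]) (a : R) : Re (w * a%:C) = Re w * a.
Proof. by rewrite ReM mulr0 subr0. Qed.

Lemma ImMr (w : R[i]) (a : R) : Im (w * a%:C) = Im w * a.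
Proof. by rewrite ImM mulr0 add0r. Qed.

Lemma cvg_scaleC (a : nat -> R) (l : R) (w : R[i]) : a n @[n --> \oo] --> l ->
  (Re ((a n)%:C * w) @[n --> \oo] --> Re (l%:C * w)) /\
  (Im ((a n)%:C * w) @[n --> \oo] --> Im (l%:C * w)).
Proof.
move=> al; split; rewrite mulrC.
- rewrite ReMr mulrC; under eq_fun do rewrite mulrC ReMr mulrC.
  by apply: cvgM => //; exact: cvg_cst.
- rewrite ImMr mulrC; under eq_fun do rewrite mulrC ImMr mulrC.
  by apply: cvgM => //; exact: cvg_cst.
Qed.

Theorem fourier_inversion (h : R * R -> R[i]) (M : R) (x : R * R) : cintegrable leb2 h ->
  continuous (Re \o h) -> continuous (Im \o h) ->
  (forall y, nc (h y) <= M) -> cintegrable leb2 (fourier h : R2 -> R[i]) ->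
  cint leb2 (fun t : R2 => fourier h t * conjc (cexp (dot x t))) = kap%:C * h x.
Proof.
move=> ih cR cI hM iF; have mh := ih.1; have mF := iF.1.
have M0 : 0 <= M by apply: le_trans (hM x); exact: nc_ge0.
pose c (n : nat) : R := n.+1%:R^-1.
have c0 n : 0 < c n by rewrite invr_gt0.
pose A n := cint leb2 (fun t : R2 =>
  fourier h t * ((Gk (scal (c n) t))%:C * conjc (cexp (dot x t)))).
have mG n : measurable_fun setT (fun t : R2 => Gk (scal (c n) t) : mR).
  exact: measurableT_comp measurable_Gk (measurable_scal _).
have mE : cmeas (fun t : R2 => conjc (cexp (dot x t))).
  by apply/cmeasJ/cmeas_cexp; exact: (@measurable_fun_dot R _ R2 (fun=> x) id).
have G0 n t : 0 <= Gk (scal (c n) t) by rewrite ltW// Gk_gt0.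
have AE n : A n = cint leb2 (fun z : R2 => h (affine2 x (c n, c n) z) * (pk z)%:C).
  pose W (t y : R2) : R[i] := h y * ((Gk (scal (c n) t))%:C * cexp (dot (sub2 y x) t)).
  have mW : cmeas (fun z : R2 * R2 => W z.1 z.2).
    apply: cmeasM; first exact: cmeas_comp mh measurable_snd.
    apply: cmeasM; first exact: cmeas_re (measurableT_comp (mG n) measurable_fst).
    apply: cmeas_cexp; apply: measurable_fun_dot; last exact: measurable_fst.
    by apply: measurable_sub2; [exact: measurable_snd|exact: measurable_cst].
  have WE (t : R2) : fourier h t * ((Gk (scal (c n) t))%:C * conjc (cexp (dot x t))) = cint leb2 (W t).
    rewrite fourierE mulrC -cintZ; last exact: cintegrable_fourier.
    apply: eq_cint => y; rewrite /W dot_sub2 cexpB; ring.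
  rewrite /A (eq_cint _ WE).
  have iG : (\int[leb2]_t (Gk (scal (c n) t))%:E < +oo)%E.
    have [_] := cintegrable_Gk (0, 0) (c0 n).
    by under eq_integral do rewrite ncM nc_cexp mulr1 ncC ger0_norm//.
  have mnh : measurable_fun setT (fun t : R2 => nc (h t) : mR) by exact: cmeas_nc.
  rewrite (@cint_Fubini_le _ _ _ _ _ leb2 leb2 _ _ _ mW (mG n) mnh (G0 n) _ iG ih.2); last 2 first.
  - by move=> y; exact: nc_ge0.
  - by move=> t y; rewrite !ncM nc_cexp mulr1 ncC (ger0_norm (G0 n t)) mulrC.
  have e (y : R2) : cint leb2 (W^~ y) = h y * (Pc (c n) (sub2 y x))%:C.
    rewrite /W cintZ ?cint_Gkc//; exact: cintegrable_Gk.
  rewrite (eq_cint _ e).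
  have cn0 : c n != 0 by rewrite gt_eqF.
  have iP : cintegrable leb2 (fun y : R2 => h y * (Pc (c n) (sub2 y x))%:C).
    have mP : measurable_fun setT (fun y : R2 => Pc (c n) (sub2 y x) : mR).
      apply: (measurableT_comp (measurable_Pc _)); apply: measurable_sub2 => //.
    apply: (@cintegrable_le _ _ R2 leb2 _ (fun y : R2 => M * Pc (c n) (sub2 y x))).
    - by apply: cmeasM => //; exact: cmeas_re.
    - exact: measurable_funM.
    - by move=> y; rewrite ncM ncC (ger0_norm (Pc_ge0 _ _)) ler_wpM2r ?Pc_ge0.
    - rewrite (intEZ leb2 M0 mP); last by move=> y; exact: Pc_ge0.
      by rewrite integral_Pc_sub1// -EFinM ltry.
  rewrite [LHS](@cint_affine2 R x (c n, c n))// -cintZ.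
    apply: eq_cint => z; rewrite mulrCA; congr (_ * _).
    rewrite -rmorphM; congr (_%:C); rewrite ger0_norm ?mulr_ge0 ?(ltW (c0 n))//.
    rewrite /Pc mulrA -expr2 divff ?expf_neq0// mul1r; congr pk.
    rewrite [RHS]surjective_pairing /scal /affine2/=; congr pair; field; exact: cn0.
  exact: (@cintegrable_affine2 R x (c n, c n) _ cn0 cn0 iP).
pose L1 := cint leb2 (fun t : R2 => fourier h t * conjc (cexp (dot x t))).
pose L2 := cint leb2 (fun z : R2 => h x * (pk z)%:C).
have mhx : measurable_fun setT (pk : R2 -> mR) by exact: measurable_pk.
have [R1 I1] : (Re (A n) @[n --> \oo] --> Re L1) /\ (Im (A n) @[n --> \oo] --> Im L1).
  apply: (@cint_dominated R _ R2 leb2 _ _ (fun t : R2 => nc (fourier h t))).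
  - by move=> n; apply: cmeasM => //; apply: cmeasM => //; exact: (cmeas_re (mG n)).
  - exact: cmeasM.
  - exact: cmeas_nc.
  - move=> t; have [hR _] := cvg_scaleC (fourier h t * conjc (cexp (dot x t))) (cvg_Gk t).
    by rewrite mul1r in hR; apply: cvg_trans hR; under eq_fun do rewrite mulrCA.
  - move=> t; have [_ hI] := cvg_scaleC (fourier h t * conjc (cexp (dot x t))) (cvg_Gk t).
    by rewrite mul1r in hI; apply: cvg_trans hI; under eq_fun do rewrite mulrCA.
  - move=> n t; rewrite !ncM ncJ nc_cexp mulr1 ncC (ger0_norm (G0 n t)).
    by rewrite ler_piMr ?nc_ge0// Gk_le1.
  - exact: iF.2.
have [R2' I2] : (Re (A n) @[n --> \oo] --> Re L2) /\ (Im (A n) @[n --> \oo] --> Im L2).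
  under [X in (X @ _ --> _) /\ _]eq_fun do rewrite AE.
  under [X in _ /\ (X @ _ --> _)]eq_fun do rewrite AE.
  apply: (@cint_dominated R _ R2 leb2 _ _ (fun t : R2 => M * pk t)).
  - by move=> n; apply: cmeasM; [exact: cmeas_affine2|exact: cmeas_re].
  - by apply: cmeasM; [exact: cmeas_cst|exact: cmeas_re].
  - exact: measurable_funM.
  - move=> t; rewrite ReMr; under eq_fun do rewrite ReMr.
    have hR : Re (h (affine2 x (c n, c n) t)) @[n --> \oo] --> Re (h x) := @cvg_affine x t _ cR.
    by apply: cvgM; [exact: hR|exact: cvg_cst].
  - move=> t; rewrite ImMr; under eq_fun do rewrite ImMr.
    have hI : Im (h (affine2 x (c n, c n) t)) @[n --> \oo] --> Im (h x) := @cvg_affine x t _ cI.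
    by apply: cvgM; [exact: hI|exact: cvg_cst].
  - by move=> n t; rewrite ncM ncC ger0_norm ?(ltW (pk_gt0 _))// ler_wpM2r// ltW// pk_gt0.
  - rewrite (intEZ leb2 M0 mhx); last by move=> t; rewrite ltW// pk_gt0.
    by rewrite integral_pk -EFinM ltry.
have LL : L1 = L2.
  apply: complexP.
  - exact: cvg_unique R1 R2'.
  - exact: cvg_unique I1 I2.
rewrite -/L1 LL /L2 cintZ.
  rewrite mulrC; congr (_ * _); apply: complexP => /=.
  - by rewrite /Rintegral integral_pk.
  - by rewrite /Rintegral integral0.
split; first exact: cmeas_re.
under eq_integral do rewrite ncC ger0_norm ?(ltW (pk_gt0 _))//.
by rewrite integral_pk ltry.
Qed.

End Inversion.

(** * Schwartz functions *)


Section PlaneTopology.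
Context {R : realType}.
Local Notation R2 := (measurableTypeR R * measurableTypeR R)%type.
Local Notation mR := (measurableTypeR R).

Definition box (x : R * R) (r : R) : set (R * R) :=
  [set y | `|x.1 - y.1| < r /\ `|x.2 - y.2| < r].

Lemma nbhs_boxP (x : R * R) (U : set (R * R)) :
  nbhs x U <-> exists2 r, 0 < r & box x r `<=` U.
Proof.
split.
- move=> /nbhs_ballP[r r0 xU]; exists r => // y [h1 h2]; apply: xU; split => //.
- move=> [r r0 xU]; apply/nbhs_ballP; exists r => // y [h1 h2]; exact: xU.
Qed.

Lemma measurable_box (x : R * R) (r : R) : @measurable _ R2 (box x r).
Proof.
rewrite (_ : box x r = ball x.1 r `*` ball x.2 r); last first.
  by apply/seteqP; split => y [].
by apply: measurableX; exact: measurable_ball.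
Qed.

Lemma open_measurable2 (U : set (R * R)) : open U -> @measurable _ R2 U.
Proof.
move=> oU.
pose B n (p q : rat) : set (R * R) := box (ratr p, ratr q) n.+1%:R^-1.
rewrite (_ : U = \bigcup_n \bigcup_p \bigcup_q [set z | B n p q z /\ B n p q `<=` U]).
  apply: bigcupT_measurable => n; apply: bigcupT_measurable_rat => p.
  apply: bigcupT_measurable_rat => q.
  have [h|h] := pselect (B n p q `<=` U).
  - rewrite (_ : [set z | _] = B n p q); first exact: measurable_box.
    by apply/seteqP; split => z //= [].
  - rewrite (_ : [set z | _] = set0); first exact: measurable0.
    by apply/seteqP; split => z //= [].
apply/seteqP; split => [x Ux|x [n _ [p _ [q _ [Bx BU]]]]]; last exact: BU.
have /nbhs_boxP[r r0 xU] : nbhs x U by exact: open_nbhs_nbhs.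
have [n nr] : exists n, n.+1%:R^-1 + n.+1%:R^-1 < r :> R.
  have := near_infty_natSinv_lt (PosNum (divr_gt0 r0 (ltr0n R 2))).
  move=> [n _ /(_ n (leqnn n))/= hn]; exists n.
  by rewrite (splitr r) ltrD.
have n0 : 0 < n.+1%:R^-1 :> R by rewrite invr_gt0.
have dens (a e : R) : 0 < e -> exists p : rat, `|ratr p - a| < e.
  move=> e0; have /rat_in_itvoo[p] : a - e < a + e by lra.
  by rewrite in_itv/= => /andP[h1 h2]; exists p; rewrite ltr_norml; apply/andP; split; lra.
have [p hp] := dens x.1 _ n0; have [q hq] := dens x.2 _ n0.
exists n => //; exists p => //; exists q => //; split; first by split.
move=> y [/= y1 y2]; apply: xU; split.
- by rewrite (_ : _ - _ = - (ratr p - x.1) + (ratr p - y.1)); [rewrite (le_lt_trans (ler_normD _ _))// normrN (lt_trans _ nr)// ltrD|ring].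
- by rewrite (_ : _ - _ = - (ratr q - x.2) + (ratr q - y.2)); [rewrite (le_lt_trans (ler_normD _ _))// normrN (lt_trans _ nr)// ltrD|ring].
Qed.

Lemma continuous_measurable2 (k : R * R -> R) : continuous k ->
  measurable_fun setT (k : R2 -> mR).
Proof.
move=> /continuousP ck; apply: (measurability _ (RGenOInfty.measurableE R)).
move=> /= _ [_ [a ->] <-]; apply: measurableI => //.
by apply: open_measurable2; apply: ck; exact: interval_open.
Qed.

End PlaneTopology.

Section SchwartzFacts.
Context {R : realType}.
Local Notation R2 := (measurableTypeR R * measurableTypeR R)%type.
Local Notation mR := (measurableTypeR R).

(* The square of the usual Japanese bracket. *)
Definition jap (z : R * R) : R := 1 + (z.1 ^+ 2 + z.2 ^+ 2).

Lemma jap_ge1 z : 1 <= jap z.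
Proof. by rewrite lerDl addr_ge0// sqr_ge0. Qed.

Lemma jap_gt0 z : 0 < jap z.
Proof. exact: lt_le_trans (jap_ge1 z). Qed.

Lemma measurable_jap : measurable_fun setT (jap : R2 -> mR).
Proof.
apply: measurable_funD; first exact: measurable_cst.
by apply: measurable_funD; apply: measurable_funX.
Qed.

Lemma jap_expn_le (N : nat) z :
  jap z ^+ N <= 3 ^+ N * (1 + (z.1 ^+ (2 * N) + z.2 ^+ (2 * N))).
Proof.
have z1 := sqr_ge0 z.1; have z2 := sqr_ge0 z.2.
have p1 : 0 <= z.1 ^+ (2 * N) by rewrite exprM exprn_ge0.
have p2 : 0 <= z.2 ^+ (2 * N) by rewrite exprM exprn_ge0.
have key m : jap z <= 3 * m -> 0 <= m -> jap z ^+ N <= 3 ^+ N * m ^+ N.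
  by move=> h m0; rewrite -exprMn lerXn2r// nnegrE ?mulr_ge0// ltW// jap_gt0.
have fin m : jap z ^+ N <= 3 ^+ N * m ^+ N -> m ^+ N <= 1 + (z.1 ^+ (2 * N) + z.2 ^+ (2 * N)) ->
    jap z ^+ N <= 3 ^+ N * (1 + (z.1 ^+ (2 * N) + z.2 ^+ (2 * N))).
  by move=> h1 h2; apply: le_trans h1 _; rewrite ler_wpM2l// exprn_ge0.
have [h1|h1] := leP (z.1 ^+ 2) 1; have [h2|h2] := leP (z.2 ^+ 2) 1;
  have [h3|h3] := leP (z.1 ^+ 2) (z.2 ^+ 2).
all: try (apply: (fin 1); [apply: key => //; rewrite /jap; lra | rewrite expr1n; lra]).
all: try (apply: (fin (z.1 ^+ 2)); [apply: key => //; rewrite /jap; lra | rewrite -exprM; lra]).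
all: try (apply: (fin (z.2 ^+ 2)); [apply: key => //; rewrite /jap; lra | rewrite -exprM; lra]).
Qed.

Lemma pk_ge z : 4 <= pk z * jap z ^+ 2.
Proof.
have z1 := sqr_ge0 z.1; have z2 := sqr_ge0 z.2.
have h1 : 0 < 1 + z.1 ^+ 2 by lra.
have h2 : 0 < 1 + z.2 ^+ 2 by lra.
rewrite /pk (_ : 2 / _ * (2 / _) * _ = 4 * (jap z ^+ 2 / ((1 + z.1 ^+ 2) * (1 + z.2 ^+ 2)))); last first.
  by field; rewrite !gt_eqF.
rewrite -[leLHS]mulr1 ler_wpM2l// ler_pdivlMr ?mulr_gt0// mul1r /jap.
by nra.
Qed.

Lemma pk_le1 z : pk z <= 4 :> R.
Proof.
have h (a : R) : 2 / (1 + a ^+ 2) <= 2.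
  have := sqr_ge0 a; move: (a ^+ 2) => b b0.
  by rewrite ler_pdivrMr; lra.
have h0 (a : R) : 0 <= 2 / (1 + a ^+ 2).
  by rewrite divr_ge0// addr_ge0// sqr_ge0.
by rewrite /pk (_ : 4 = 2 * 2); [apply: ler_pM|ring].
Qed.

Variable psi : R * R -> R[i].
Hypothesis psi_schwartz : schwartz psi.

Lemma schwartz_continuous : continuous (Re \o psi) /\ continuous (Im \o psi).
Proof.
case: psi_schwartz => -[sR sI] _ _; split.
- by have [] := sR [::].
- by have [] := sI [::].
Qed.

Lemma schwartz_cmeas : cmeas (psi : R2 -> R[i]).
Proof.
by have [cR cI] := schwartz_continuous; split; exact: continuous_measurable2.
Qed.

Lemma schwartz_jap (N : nat) : exists2 C, 0 < C &
  forall z, jap z ^+ N * nc (psi z) <= C.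
Proof.
case: psi_schwartz => _ rR rI.
have aux (g : R * R -> R) : rapidly_decreasing g ->
    exists2 C, 0 < C & forall z, jap z ^+ N * `|g z| <= C.
  move=> rg.
  have [M0 h0] := rg [::] 0%N 0%N.
  have [M1 h1] := rg [::] (2 * N)%N 0%N.
  have [M2 h2] := rg [::] 0%N (2 * N)%N.
  exists (3 ^+ N * (`|M0| + (`|M1| + `|M2|)) + 1).
    by rewrite ltr_wpDl// mulr_ge0 ?exprn_ge0// !addr_ge0.
  move=> z; apply: (@le_trans _ _ (3 ^+ N * (`|M0| + (`|M1| + `|M2|)))); last by rewrite lerDl.
  apply: le_trans (ler_wpM2r (normr_ge0 _) (jap_expn_le N z)) _.
  rewrite -mulrA ler_wpM2l ?exprn_ge0//.
  have := h0 z; have := h1 z; have := h2 z; rewrite /= !expr0 !mulr1 !mul1r.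
  rewrite !normrM ![`|_ ^+ (2 * N)|]ger0_norm; last 2 first.
    by rewrite exprM exprn_ge0// sqr_ge0.
    by rewrite exprM exprn_ge0// sqr_ge0.
  move=> k2 k1 k0; rewrite !mulrDl mul1r.
  by rewrite lerD ?(le_trans k0) ?ler_norm// lerD ?(le_trans k1) ?(le_trans k2) ?ler_norm.
have [C1 C10 h1] := aux _ rR; have [C2 C20 h2] := aux _ rI.
exists (C1 + C2); first exact: addr_gt0.
move=> z; have := nc_le (psi z) => h.
apply: le_trans (ler_wpM2l _ h) _; first by rewrite exprn_ge0// ltW// jap_gt0.
by rewrite mulrDr lerD.
Qed.

Lemma schwartz_decay (N : nat) : exists2 C, 0 < C &
  forall z, nc (psi z) <= C * pk z / jap z ^+ N.
Proof.
have [C C0 h] := schwartz_jap (N + 2); exists C => // z.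
have j0 := jap_gt0 z.
rewrite ler_pdivlMr ?exprn_gt0//.
have := h z; rewrite exprD => hz.
have pj := pk_ge z; have p0 := pk_gt0 z.
have n0 := nc_ge0 (psi z).
have hX : 0 <= nc (psi z) * jap z ^+ N by rewrite mulr_ge0// exprn_ge0// ltW.
rewrite -(ler_pM2r (exprn_gt0 2 j0)).
apply: (@le_trans _ _ C).
  have -> : nc (psi z) * jap z ^+ N * jap z ^+ 2 = jap z ^+ N * jap z ^+ 2 * nc (psi z) by ring.
  exact: hz.
by rewrite -mulrA ler_peMr ?(ltW C0)//; lra.
Qed.

End SchwartzFacts.

Section PsiFacts.
Context {R : realType}.
Local Notation R2 := (measurableTypeR R * measurableTypeR R)%type.
Local Notation mR := (measurableTypeR R).

Lemma in_L2P (f : R * R -> R[i]) : in_L2 f ->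
  cmeas (f : R2 -> R[i]) /\ (\int[leb2]_x (nc (f x) ^+ 2)%:E < +oo)%E.
Proof.
move=> [mR mI fn]; split; first by split.
have -> : (\int[leb2]_x (nc (f x) ^+ 2)%:E = 'N[leb2]_(2%:E)[EFin \o (nc \o f)] `^ 2)%E.
  rewrite poweR_Lnorm//; apply: eq_integral => x _.
  by rewrite /= ger0_norm ?nc_ge0// powR_mulrn// nc_ge0.
exact: poweR_lty.
Qed.

Lemma lty_fine (x : \bar R) : (0 <= x)%E -> (x < +oo)%E -> exists2 r, 0 <= r & x = r%:E.
Proof.
case: x => [r|//|//]; rewrite lee_fin => r0 _; by exists r.
Qed.

Variable psi : R * R -> R[i].
Hypothesis psi_schwartz : schwartz psi.

Lemma schwartz_le_pk : exists2 C, 0 < C & forall z, nc (psi z) <= C * pk z.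
Proof.
have [C C0 h] := schwartz_decay psi_schwartz 0; exists C => // z.
by have := h z; rewrite expr0 divr1.
Qed.

Lemma cintegrable_le_pk (g : R2 -> R[i]) (C : R) : 0 <= C -> cmeas g ->
  (forall z, nc (g z) <= C * pk z) -> cintegrable leb2 g.
Proof.
move=> C0 mg hg.
have mpk : measurable_fun setT (fun z : R2 => C * pk z : mR).
  exact: measurable_funM (measurable_cst _) measurable_pk.
apply: (cintegrable_le mg mpk hg).
rewrite (intEZ leb2 C0 measurable_pk); last by move=> z; rewrite ltW// pk_gt0.
by rewrite integral_pk -EFinM ltry.
Qed.

Lemma schwartz_cintegrable : cintegrable leb2 (psi : R2 -> R[i]).
Proof.
have [C C0 h] := schwartz_le_pk.
exact: cintegrable_le_pk (ltW C0) (schwartz_cmeas psi_schwartz) h.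
Qed.

Lemma schwartz_bounded : exists2 M, 0 < M & forall z, nc (psi z) <= M.
Proof.
have [C C0 h] := schwartz_le_pk; exists (C * 4); first by rewrite mulr_gt0.
by move=> z; apply: le_trans (h z) _; rewrite ler_wpM2l ?(ltW C0)// pk_le1.
Qed.

Hypothesis psi_supp : supp (fourier psi) `<=` `[1 / 2, 2] `*` `[1 / 2, 2].

Lemma psihat_neq0 (t : R * R) : fourier psi t != 0 ->
  (1 / 2 <= t.1 <= 2) /\ (1 / 2 <= t.2 <= 2).
Proof.
move=> ht; have [] : (`[1 / 2, 2] `*` `[1 / 2, 2]) t.
  by apply: psi_supp; apply: subset_closure.
by rewrite /= !in_itv.
Qed.

Lemma psihat_cmeas : cmeas (fourier psi : R2 -> R[i]).
Proof. exact/cmeas_fourier/schwartz_cmeas. Qed.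

Lemma psihat_le_pk : exists2 C, 0 < C & forall t, nc (fourier psi t) <= C * pk t.
Proof.
have [M M0 hM] := fourier_bound schwartz_cintegrable.
exists (25 / 4 * M + 1); first by rewrite ltr_wpDl// mulr_ge0.
move=> t; have [->|/psihat_neq0[/andP[h1 h2] /andP[h3 h4]]] := eqVneq (fourier psi t) 0.
  by rewrite nc0 mulr_ge0 ?(ltW (pk_gt0 _))// addr_ge0// mulr_ge0.
apply: le_trans (hM t) _.
have p0 := pk_gt0 t.
suff hp : 4 / 25 <= pk t.
  apply: (@le_trans _ _ ((25 / 4 * M + 1) * (4 / 25))); first by lra.
  by rewrite ler_wpM2l// addr_ge0// mulr_ge0.
have aux (a : R) : 1 / 2 <= a -> a <= 2 -> 2 / 5 <= 2 / (1 + a ^+ 2).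
  move=> a1 a2; have a4 : a ^+ 2 <= 4 by nra.
  have := sqr_ge0 a; move: (a ^+ 2) a4 => b b4 b0.
  by rewrite ler_pM2l// lef_pV2 ?posrE; lra.
rewrite (_ : 4 / 25 = 2 / 5 * (2 / 5)); last by field.
by rewrite /pk ler_pM ?aux// divr_ge0.
Qed.

Lemma psihat_cintegrable : cintegrable leb2 (fourier psi : R2 -> R[i]).
Proof.
have [C C0 h] := psihat_le_pk.
exact: cintegrable_le_pk (ltW C0) psihat_cmeas h.
Qed.

Lemma psi_inversion (x : R * R) :
  cint leb2 (fun t : R2 => fourier psi t * conjc (cexp (dot x t))) = kap%:C * psi x.
Proof.
have [M _ hM] := schwartz_bounded.
have [cR cI] := schwartz_continuous psi_schwartz.
exact: (fourier_inversion x schwartz_cintegrable cR cI hM psihat_cintegrable).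
Qed.

End PsiFacts.

(** * Wavelet energies *)


Section Cone.
Context {R : realType}.
Local Notation R2 := (measurableTypeR R * measurableTypeR R)%type.
Local Notation mR := (measurableTypeR R).

Definition cone (a b : R) : set (R * R) :=
  [set t | [/\ 0 < t.1, 0 < t.2, a * t.2 < t.1 & t.1 < b * t.2]].

Lemma measurable_lt (u v : R2 -> mR) : measurable_fun setT u -> measurable_fun setT v ->
  measurable [set z : R2 | u z < v z :> R].
Proof.
move=> mu' mv; have := measurable_fun_ltr mu' mv.
move=> /(_ measurableT [set true] I); rewrite setTI; congr measurable.
Qed.

Lemma measurable_cone a b : @measurable _ R2 (cone a b).
Proof.
rewrite (_ : cone a b = [set z : R2 | 0 < z.1 :> R] `&` [set z : R2 | 0 < z.2 :> R] `&`
   [set z : R2 | a * z.2 < z.1 :> R] `&` [set z : R2 | z.1 < b * z.2 :> R]); last first.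
  by apply/seteqP; split => z [] => [h1 h2 h3 h4|[[h1 h2] h3] h4].
have m1 : measurable_fun setT (fst : R2 -> mR) by exact: measurable_fst.
have m2 : measurable_fun setT (snd : R2 -> mR) by exact: measurable_snd.
have mc (c : R) : measurable_fun setT (fun z : R2 => c * z.2 : mR) by exact: measurable_funM.
have m0 : measurable_fun setT (fun z : R2 => 0 : mR) by exact: measurable_cst.
apply: measurableI; last exact: measurable_lt m1 (mc b).
apply: measurableI; last exact: measurable_lt (mc a) m1.
by apply: measurableI; [exact: measurable_lt m0 m1|exact: measurable_lt m0 m2].
Qed.

Lemma nbhs_cone (xi : R * R) a b : cone a b xi -> nbhs xi (cone a b).
Proof.
move=> [h1 h2 h3 h4]; apply: (@filterS _ (nbhs xi) _
  ([set t | 0 < t.1] `&` [set t | 0 < t.2] `&` [set t | 0 < t.1 - a * t.2] `&`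
   [set t | 0 < b * t.2 - t.1])).
  by move=> t [[[t1 t2]]]; rewrite /= !subr_gt0 => t3 t4.
have c1 : continuous (fst : R * R -> R) by move=> [z1 z2]; exact: cvg_fst.
have c2 : continuous (snd : R * R -> R) by move=> [z1 z2]; exact: cvg_snd.
have op (u : R * R -> R) : continuous u -> 0 < u xi -> nbhs xi [set t | 0 < u t].
  by move=> cu u0; exact: (cvgr_gt _ (cu xi) _ u0).
have cm (c : R) : continuous (fun t : R * R => c * t.2).
  by move=> z; apply: cvgM; [exact: cvg_cst|exact: c2].
apply: filterI; [apply: filterI; [apply: filterI|]|]; apply: op => //.
- by move=> z; apply: cvgB; [exact: c1|exact: cm].
- by rewrite subr_gt0.
- by move=> z; apply: cvgB; [exact: cm|exact: c1].
- by rewrite subr_gt0.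
Qed.

Lemma conical_cone (xi : R * R) a b : cone a b xi -> conical_nbhs xi (cone a b).
Proof.
move=> h; split; first by split; [exact: nbhs_cone|exact: measurable_cone].
move=> c t c0 [h1 h2 h3 h4]; split => /=; rewrite ?mulr_gt0//.
- by rewrite mulrCA ltr_pM2l.
- by rewrite mulrCA ltr_pM2l.
Qed.

Lemma Gamma_psiE (xi : R * R) : 0 < xi.1 -> 0 < xi.2 ->
  Gamma_psi xi = cone (1 / 5 * (xi.1 / xi.2)) (5 * (xi.1 / xi.2)).
Proof.
move=> x1 x2; apply/seteqP; split => t [h1 h2 h3 h4]; split => //.
- by rewrite -ltr_pdivlMr.
- by rewrite -ltr_pdivrMr.
- by rewrite ltr_pdivlMr.
- by rewrite ltr_pdivrMr.
Qed.

End Cone.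

Section WaveletEnergy.
Context {R : realType}.
Local Notation R2 := (measurableTypeR R * measurableTypeR R)%type.
Local Notation mR := (measurableTypeR R).
Implicit Types psi f : R * R -> R[i].

Definition dil (xi x t : R * R) : R * R := (xi.1 * (t.1 - x.1), xi.2 * (t.2 - x.2)).

Lemma dil_affine (xi x t : R * R) :
  dil xi x t = affine2 (- (xi.1 * x.1), - (xi.2 * x.2)) xi t.
Proof. by rewrite /dil /affine2 /=; congr pair; ring. Qed.

Lemma measurable_dil d (T : measurableType d) (u v w : T -> R2) :
  measurable_fun setT u -> measurable_fun setT v -> measurable_fun setT w ->
  measurable_fun setT (fun x => dil (u x) (v x) (w x) : R2).
Proof.
move=> mu' mv mw; apply: measurable_fun_pair.
- apply: measurable_funM; first exact: measurableT_comp measurable_fst mu'.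
  by apply: measurable_funB; [exact: measurableT_comp measurable_fst mw|exact: measurableT_comp measurable_fst mv].
- apply: measurable_funM; first exact: measurableT_comp measurable_snd mu'.
  by apply: measurable_funB; [exact: measurableT_comp measurable_snd mw|exact: measurableT_comp measurable_snd mv].
Qed.

Definition wfun psi f (xi x t : R * R) : R[i] :=
  f t * `|xi.1 * xi.2|%:C * conjc (psi (dil xi x t)).

Lemma waveletE psi f (x xi : R * R) : wavelet psi f x xi = cint leb2 (wfun psi f xi x : R2 -> R[i]).
Proof. by []. Qed.

Lemma cmeas_wfun psi f d (T : measurableType d) (u v w : T -> R2) :
  cmeas (psi : R2 -> R[i]) -> cmeas (f : R2 -> R[i]) ->
  measurable_fun setT u -> measurable_fun setT v -> measurable_fun setT w ->
  cmeas (fun z => wfun psi f (u z) (v z) (w z)).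
Proof.
move=> mpsi mf mu' mv mw; apply: cmeasM.
  apply: cmeasM; first exact: cmeas_comp mf mw.
  apply: cmeas_re; apply: measurableT_comp => //; apply: measurable_funM.
  - exact: measurableT_comp measurable_fst mu'.
  - exact: measurableT_comp measurable_snd mu'.
apply: cmeasJ; apply: (cmeas_comp mpsi (u := fun z => dil (u z) (v z) (w z))).
exact: measurable_dil.
Qed.

Lemma cmeas_wavelet psi f : cmeas (psi : R2 -> R[i]) -> cmeas (f : R2 -> R[i]) ->
  cmeas (fun z : R2 * R2 => wavelet psi f z.1 z.2).
Proof.
move=> mpsi mf.
apply: (@cmeas_cint1 _ _ _ (R2 * R2)%type R2 leb2 (fun z t => wfun psi f z.2 z.1 t)).
apply: cmeas_wfun => //.
- exact: measurableT_comp measurable_snd measurable_fst.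
- exact: measurableT_comp measurable_fst measurable_fst.
Qed.

Lemma measurable_sobolev (s : R) : measurable_fun setT (sobolev_weight s : R2 -> mR).
Proof.
apply: (measurableT_comp (measurable_powR s)); exact: measurable_jap.
Qed.

Lemma sobolev_ge0 (s : R) x : 0 <= sobolev_weight s x.
Proof. exact: powR_ge0. Qed.

Definition Venergy (s : R) (Gamma : set (R * R)) (xi : R * R) : R :=
  sobolev_weight s xi / `|xi.1 * xi.2| * \1_Gamma xi.

Lemma Venergy_ge0 s Gamma xi : 0 <= Venergy s Gamma xi.
Proof. by rewrite mulr_ge0 ?divr_ge0 ?sobolev_ge0. Qed.

Lemma measurable_indic2 (A : set (R * R)) : @measurable _ R2 A ->
  measurable_fun setT (\1_A : R2 -> mR).
Proof. by move=> mA; exact: measurable_indic. Qed.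

Lemma measurable_Venergy s Gamma : @measurable _ R2 Gamma ->
  measurable_fun setT (Venergy s Gamma : R2 -> mR).
Proof.
move=> mG; apply: measurable_funM; last exact: measurable_indic2.
apply: measurable_funM; first exact: measurable_sobolev.
rewrite (_ : (fun _ => _) = fun xi : R2 => `|xi.1 * xi.2| `^ (-1)).
  apply: (measurableT_comp (measurable_powR (-1))).
  by apply: measurableT_comp => //; apply: measurable_funM.
by apply/funext => xi; rewrite powR_inv1.
Qed.

Lemma integral_indicE d (T : measurableType d) (mu : {measure set T -> \bar R}) (A : set T)
  (k : T -> R) : (\int[mu]_(x in A) (k x)%:E = \int[mu]_x (k x * \1_A x)%:E)%E.
Proof.
rewrite integral_mkcond; apply: eq_integral => x _; rewrite patchE indicE.
by case: ifPn => _; rewrite ?mulr1 ?mulr0.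
Qed.

Lemma fourier_energyE (s : R) (g : R * R -> R[i]) Gamma :
  fourier_energy s g Gamma =
  (\int[leb2]_xi (nc (fourier g xi) ^+ 2 * sobolev_weight s xi * \1_Gamma xi)%:E)%E.
Proof. exact: (@integral_indicE _ R2). Qed.

Definition Iwave psi f (U : set (R * R)) (xi : R * R) : \bar R :=
  (\int[leb2]_x (nc (wavelet psi f x xi) ^+ 2 * \1_U x)%:E)%E.

Lemma Iwave_ge0 psi f U xi : (0 <= Iwave psi f U xi)%E.
Proof. by apply: intE_ge0 => x; rewrite mulr_ge0 ?sqr_ge0. Qed.

Lemma measurable_Iwave_aux psi f U : cmeas (psi : R2 -> R[i]) -> cmeas (f : R2 -> R[i]) ->
  @measurable _ R2 U ->
  measurable_fun setT (fun z : R2 * R2 => nc (wavelet psi f z.2 z.1) ^+ 2 * \1_U z.2 : mR).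
Proof.
move=> mpsi mf mU; apply: measurable_funM.
- apply: measurable_funX; apply: cmeas_nc.
  exact: cmeas_comp (cmeas_wavelet mpsi mf) (@measurable_swap _ _ _ _).
- exact: measurableT_comp (measurable_indic2 mU) measurable_snd.
Qed.

Lemma measurable_Iwave psi f U : cmeas (psi : R2 -> R[i]) -> cmeas (f : R2 -> R[i]) ->
  @measurable _ R2 U -> measurable_fun setT (Iwave psi f U : R2 -> \bar R).
Proof.
move=> mpsi mf mU.
apply: (@measurable_int2 _ _ _ R2 R2 leb2 (fun xi x => nc (wavelet psi f x xi) ^+ 2 * \1_U x)).
  exact: measurable_Iwave_aux.
by move=> xi x; rewrite mulr_ge0 ?sqr_ge0.
Qed.

Lemma wavelet_energyE (s : R) psi f (U Gamma : set (R * R)) :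
  cmeas (psi : R2 -> R[i]) -> cmeas (f : R2 -> R[i]) ->
  @measurable _ R2 U -> @measurable _ R2 Gamma ->
  wavelet_energy s psi f U Gamma =
  (\int[leb2]_xi ((Venergy s Gamma xi)%:E * Iwave psi f U xi))%E.
Proof.
move=> mpsi mf mU mG.
pose K (x xi : R2) := Venergy s Gamma xi * (nc (wavelet psi f x xi) ^+ 2 * \1_U x).
have mK0 := measurable_Iwave_aux mpsi mf mU.
have mK : measurable_fun setT (fun z : R2 * R2 => K z.1 z.2 : mR).
  apply: measurable_funM; first exact: measurableT_comp (measurable_Venergy s mG) measurable_snd.
  exact: measurableT_comp mK0 (@measurable_swap _ _ _ _).
have K0 x xi : 0 <= K x xi by rewrite mulr_ge0 ?Venergy_ge0// mulr_ge0 ?sqr_ge0.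
rewrite /wavelet_energy (@integral_indicE _ (R2 * R2)%type).
transitivity (\int[leb4]_z (K z.1 z.2)%:E)%E.
  apply: eq_integral => z _; congr EFin; rewrite /K /Venergy.
  have -> : \1_(U `*` Gamma) z = \1_U z.1 * \1_Gamma z.2 :> R.
    by rewrite !indicE in_setX -natrM mulnb.
  by ring.
transitivity (\int[leb2]_xi \int[leb2]_x (K x xi)%:E)%E.
  apply: (@fubini_tonelli2 _ _ R2 R2 R leb2 leb2 (fun z => (K z.1 z.2)%:E)).
  - exact/measurable_EFinP.
  - by move=> z; rewrite lee_fin.
apply: eq_integral => xi _; rewrite intEZ ?Venergy_ge0//.
- exact: (measurable_section2 (G := fun xi x : R2 => nc (wavelet psi f x xi) ^+ 2 * \1_U x) xi mK0).
- by move=> x; rewrite mulr_ge0 ?sqr_ge0.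
Qed.

End WaveletEnergy.

Section Localization.
Context {R : realType}.
Local Notation R2 := (measurableTypeR R * measurableTypeR R)%type.
Local Notation mR := (measurableTypeR R).
Implicit Types psi f q : R * R -> R[i].

Lemma box_finite (x : R * R) (r : R) : exists2 m : R, 0 <= m &
  (\int[leb2]_(y in setT) ((\1_(box x r) y : R)%:E) = m%:E)%E.
Proof.
have mb := measurable_box x r.
have -> : (\int[leb2]_y (\1_(box x r) y : R)%:E = leb2 (box x r))%E.
  by rewrite integral_indic// setIT.
apply/lty_fine; first exact: measure_ge0.
rewrite (_ : box x r = ball x.1 r `*` ball x.2 r); last first.
  by apply/seteqP; split => y [].
rewrite [X in (X < _)%E](_ : _ = lebesgue_measure (ball x.1 r) * lebesgue_measure (ball x.2 r))%E; last first.
  exact: (product_measure1E (@lebesgue_measure R) (@lebesgue_measure R) (measurable_ball _ _) (measurable_ball _ _)).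
have fb (a : R) : (lebesgue_measure (ball a r) < +oo)%E.
  rewrite ball_itv lebesgue_measure_itv/=; case: ifPn => _; last exact: ltry.
  by rewrite -EFinB ltry.
by rewrite lte_mul_pinfty// ge0_fin_numE.
Qed.

Lemma jap_cone (a b r : R) : 0 < a -> 0 < b -> 0 < r -> exists2 K, 0 < K &
  forall xi z : R * R, cone a b xi -> r * xi.1 <= `|z.1| \/ r * xi.2 <= `|z.2| ->
    jap xi <= K * jap z.
Proof.
move=> a0 b0 r0.
have r2 : 0 < r ^+ 2 by rewrite exprn_gt0.
have a2 : 0 < a ^+ 2 by rewrite exprn_gt0.
pose K := 1 + r ^- 2 * (1 + a ^- 2) + r ^- 2 * (1 + b ^+ 2).
have i1 : 0 < r ^- 2 by rewrite invr_gt0.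
have i2 : 0 < a ^- 2 by rewrite invr_gt0.
have p1 : 0 < r ^- 2 * (1 + a ^- 2) by rewrite mulr_gt0// addr_gt0.
have p2 : 0 < r ^- 2 * (1 + b ^+ 2) by rewrite mulr_gt0// ltr_pwDl// sqr_ge0.
have K0 : 0 < K by rewrite /K; lra.
exists K => // xi z [x1 x2 h1 h2] hz.
have key (k c : R) : 0 <= c -> xi.1 ^+ 2 + xi.2 ^+ 2 <= k * c -> 0 <= k -> k + 1 <= K -> c <= z.1 ^+ 2 + z.2 ^+ 2 ->
    jap xi <= K * jap z.
  move=> c0 hk k0 kK cz; rewrite /jap.
  have h3 : k * c <= K * (z.1 ^+ 2 + z.2 ^+ 2) by apply: ler_pM => //; lra.
  rewrite mulrDr mulr1; lra.
have sq (u v : R) : 0 <= u -> r * u <= `|v| -> u ^+ 2 <= r ^- 2 * v ^+ 2.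
  move=> u0 uv; rewrite mulrC ler_pdivlMr// mulrC -exprMn -[v ^+ 2]real_normK ?num_real//.
  by rewrite ler_sqr ?nnegrE// mulr_ge0// ltW.
have z1 := sqr_ge0 z.1; have z2 := sqr_ge0 z.2.
case: hz => hz.
- have hs := sq _ _ (ltW x1) hz.
  apply: (key (r ^- 2 * (1 + a ^- 2)) (z.1 ^+ 2)) => //; try (rewrite /K; lra).
  have : xi.2 ^+ 2 <= a ^- 2 * xi.1 ^+ 2.
    rewrite mulrC ler_pdivlMr// mulrC -exprMn ler_sqr ?nnegrE ?mulr_ge0 ?ltW//.
  have : a ^- 2 * xi.1 ^+ 2 <= a ^- 2 * (r ^- 2 * z.1 ^+ 2) by rewrite ler_pM2l.
  by rewrite (_ : r ^- 2 * (1 + a ^- 2) * z.1 ^+ 2 = r ^- 2 * z.1 ^+ 2 + a ^- 2 * (r ^- 2 * z.1 ^+ 2)); [lra|ring].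
- have hs := sq _ _ (ltW x2) hz.
  apply: (key (r ^- 2 * (1 + b ^+ 2)) (z.2 ^+ 2)) => //; try (rewrite /K; lra).
  have : xi.1 ^+ 2 <= b ^+ 2 * xi.2 ^+ 2.
    by rewrite -exprMn ler_sqr ?nnegrE ?mulr_ge0 ?ltW.
  have : b ^+ 2 * xi.2 ^+ 2 <= b ^+ 2 * (r ^- 2 * z.2 ^+ 2) by rewrite ler_wpM2l// sqr_ge0.
  by rewrite (_ : r ^- 2 * (1 + b ^+ 2) * z.2 ^+ 2 = r ^- 2 * z.2 ^+ 2 + b ^+ 2 * (r ^- 2 * z.2 ^+ 2)); [lra|ring].
Qed.

Lemma sobolev_le_jap (s : R) : 0 <= s -> exists M : nat, forall xi : R * R,
  sobolev_weight s xi <= jap xi ^+ M.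
Proof.
move=> s0; exists (Num.bound s) => xi.
rewrite -powR_mulrn ?(ltW (jap_gt0 _))//; apply: ler_powR; first exact: jap_ge1.
exact/ltW/archi_boundP.
Qed.

Lemma integral_pk_dil (xi x : R * R) : 0 < xi.1 -> 0 < xi.2 ->
  (\int[leb2]_t (`|xi.1 * xi.2| * pk (dil xi x t))%:E = (kap : R)%:E)%E.
Proof.
move=> x1 x2; rewrite -integral_pk.
rewrite [RHS](@integralR_affine2 R (- (xi.1 * x.1), - (xi.2 * x.2)) xi) ?gt_eqF//; last 2 first.
- exact: measurable_pk.
- by move=> z; rewrite ltW// pk_gt0.
under eq_integral do rewrite dil_affine.
rewrite intEZ//.
- exact: measurableT_comp measurable_pk (measurable_affine2 _ _).
- by move=> t; rewrite ltW// pk_gt0.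
Qed.

Lemma measurable_pk_dil (xi x : R * R) :
  measurable_fun setT (fun t : R2 => pk (dil xi x t) : mR).
Proof.
apply: (measurableT_comp measurable_pk).
exact: (@measurable_dil R _ R2 (fun=> xi) (fun=> x) id).
Qed.

Lemma wavelet_loc_bound psi q (x0 : R * R) (r a b : R) (N : nat) : schwartz psi ->
  in_L2 q -> 0 < r -> 0 < a -> 0 < b -> (forall y, box x0 (2 * r) y -> q y = 0) ->
  exists2 D, 0 <= D & forall x xi, box x0 r x -> cone a b xi ->
    nc (wavelet psi q x xi) ^+ 2 <= D * `|xi.1 * xi.2| / jap xi ^+ (2 * N).
Proof.
move=> hpsi /in_L2P[mq iq] r0 a0 b0 q0.
have mpsi := schwartz_cmeas hpsi.
have [Q Q0 QE] := lty_fine (intE_ge0 leb2 (fun x => sqr_ge0 (nc (q x)))) iq.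
have [C C0 hC] := schwartz_decay hpsi N.
have [K K0 hK] := jap_cone a0 b0 r0.
pose C' := C * K ^+ N.
have C'0 : 0 < C' by rewrite mulr_gt0// exprn_gt0.
have kap0 := @kap_gt0 R.
exists (16 * C' ^+ 2 * kap * Q).
  by rewrite mulr_ge0// mulr_ge0 ?(ltW kap0)// mulr_ge0// sqr_ge0.
move=> x xi xb xic; have [x1 x2 _ _] := xic.
have jN : 0 < jap xi ^+ N by rewrite exprn_gt0// jap_gt0.
have xx : 0 <= `|xi.1 * xi.2| by [].
pose c1 := C' / jap xi ^+ N.
have c10 : 0 < c1 by rewrite divr_gt0.
pose k (t : R2) := c1 * (`|xi.1 * xi.2| * pk (dil xi x t)).
have mk0 : measurable_fun setT (fun t : R2 => `|xi.1 * xi.2| * pk (dil xi x t) : mR).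
  exact: measurable_funM (measurable_cst _) (measurable_pk_dil xi x).
have p0 t : 0 <= `|xi.1 * xi.2| * pk (dil xi x t) by rewrite mulr_ge0// ltW// pk_gt0.
have mk : measurable_fun setT (k : R2 -> mR) by exact: measurable_funM (measurable_cst _) mk0.
have k0 t : 0 <= k t by rewrite mulr_ge0// ltW.
have ik : (\int[leb2]_t (k t)%:E = (c1 * kap)%:E)%E.
  by rewrite (intEZ leb2 (ltW c10) mk0 p0) integral_pk_dil// -EFinM.
have mG : cmeas (wfun psi q xi x : R2 -> R[i]).
  exact: (@cmeas_wfun R psi q _ R2 (fun=> xi) (fun=> x) id).
have hG (t : R2) : nc (wfun psi q xi x t) <= nc (q t) * k t.
  rewrite /wfun !ncM ncC ncJ normr_id -mulrA.
  have [->|qt] := eqVneq (q t) 0; first by rewrite nc0 !mul0r.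
  rewrite ler_wpM2l ?nc_ge0//.
  have hj : jap xi <= K * jap (dil xi x t).
    apply: hK => //; rewrite /dil/= !normrM (gtr0_norm x1) (gtr0_norm x2).
    move: xb => [b1 b2].
    have [h1|h1] := leP r `|t.1 - x.1|; first by left; rewrite mulrC ler_pM2l.
    have [h2|h2] := leP r `|t.2 - x.2|; first by right; rewrite mulrC ler_pM2l.
    exfalso; move/eqP: qt; apply; apply: q0; split.
    - rewrite (_ : _ - _ = (x0.1 - x.1) - (t.1 - x.1)); last by ring.
      by rewrite (le_lt_trans (ler_normB _ _))// mulr_natl mulr2n ltrD.
    - rewrite (_ : _ - _ = (x0.2 - x.2) - (t.2 - x.2)); last by ring.
      by rewrite (le_lt_trans (ler_normB _ _))// mulr_natl mulr2n ltrD.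
  rewrite /k mulrCA ler_wpM2l//; apply: le_trans (hC _) _.
  have jz : 0 < jap (dil xi x t) ^+ N by rewrite exprn_gt0// jap_gt0.
  have hjN : (jap (dil xi x t) ^+ N)^-1 <= K ^+ N / jap xi ^+ N.
    rewrite ler_pdivlMr// mulrC ler_pdivrMr// -exprMn lerXn2r// nnegrE.
      exact/ltW/jap_gt0.
    by rewrite mulr_ge0// ltW// jap_gt0.
  rewrite (_ : c1 * _ = C * pk (dil xi x t) * (K ^+ N / jap xi ^+ N)); last by rewrite /c1 /C'; ring.
  by rewrite ler_wpM2l// mulr_ge0// ltW// pk_gt0.
have := @nc_cint_CauchySchwarz R _ R2 leb2 _ (fun t => nc (q t)) k (c1 * kap) mG (cmeas_nc mq) mk
   (fun t => nc_ge0 _) k0 (mulr_gt0 c10 kap0).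
rewrite ik lexx => /(_ isT hG); rewrite -waveletE => hW.
rewrite -lee_fin; apply: le_trans hW _.
have c2 : 0 <= 4 * c1 * `|xi.1 * xi.2| by rewrite mulr_ge0// mulr_ge0// ltW.
apply: (@le_trans _ _ ((4 * (c1 * kap))%:E * \int[leb2]_t ((4 * c1 * `|xi.1 * xi.2|) * nc (q t) ^+ 2)%:E)%E).
  have c3 : 0 <= 4 * (c1 * kap) by rewrite mulr_ge0// mulr_ge0 ?(ltW c10)// ltW.
  rewrite lee_wpmul2l ?lee_fin//; apply: le_intE.
  - by apply: measurable_funM => //; exact: cmeas_nc2.
  - by apply: measurable_funM => //; exact: cmeas_nc2.
  - by move=> t; rewrite mulr_ge0// sqr_ge0.
  - move=> t; rewrite mulrC ler_wpM2r ?sqr_ge0//.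
    rewrite (_ : 4 * c1 * _ = c1 * (`|xi.1 * xi.2| * 4)); last by ring.
    by rewrite /k ler_wpM2l ?(ltW c10)// ler_wpM2l// pk_le1.
rewrite (intEZ leb2 c2 (cmeas_nc2 mq)); last by move=> t; rewrite sqr_ge0.
rewrite QE -!EFinM lee_fin le_eqVlt; apply/orP; left; apply/eqP.
by rewrite /c1 mulnC exprM; field; exact: lt0r_neq0.
Qed.

End Localization.

Section EnergyComparison.
Context {R : realType}.
Local Notation R2 := (measurableTypeR R * measurableTypeR R)%type.
Local Notation mR := (measurableTypeR R).
Implicit Types psi f g q : R * R -> R[i].

Lemma le_energy (u v : R2 -> \bar R) : measurable_fun setT u -> measurable_fun setT v ->
  (forall xi, 0 <= u xi)%E -> (forall xi, u xi <= v xi)%E ->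
  (\int[leb2]_xi u xi <= \int[leb2]_xi v xi)%E.
Proof. by move=> mu' mv u0 uv; apply: ge0_le_integral. Qed.

Lemma measurable_VI (s : R) psi f (U Gamma : set (R * R)) :
  cmeas (psi : R2 -> R[i]) -> cmeas (f : R2 -> R[i]) ->
  @measurable _ R2 U -> @measurable _ R2 Gamma ->
  measurable_fun setT (fun xi : R2 => (Venergy s Gamma xi)%:E * Iwave psi f U xi)%E.
Proof.
move=> mpsi mf mU mG; apply: emeasurable_funM; last exact: measurable_Iwave.
by apply/measurable_EFinP; exact: measurable_Venergy.
Qed.

Lemma VI_ge0 (s : R) psi f (U Gamma : set (R * R)) xi :
  (0 <= (Venergy s Gamma xi)%:E * Iwave psi f U xi)%E.
Proof. by rewrite mule_ge0 ?Iwave_ge0// lee_fin Venergy_ge0. Qed.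

Lemma wavelet_energy_loc (s : R) psi q (x0 : R * R) (r a b : R) : schwartz psi ->
  in_L2 q -> 0 <= s -> 0 < r -> 0 < a -> 0 < b -> (forall y, box x0 (2 * r) y -> q y = 0) ->
  (wavelet_energy s psi q (box x0 r) (cone a b) < +oo)%E.
Proof.
move=> hpsi qL2 s0 r0 a0 b0 q0.
have mpsi := schwartz_cmeas hpsi; have [mq _] := in_L2P qL2.
have [M hM] := @sobolev_le_jap R s s0.
have [D D0 hD] := wavelet_loc_bound (M + 2) hpsi qL2 r0 a0 b0 q0.
have [m m0 hm] := box_finite x0 r.
have mU := measurable_box x0 r; have mC := @measurable_cone R a b.
rewrite (wavelet_energyE s mpsi mq mU mC).
apply: (@le_lt_trans _ _ (\int[leb2]_xi (D * m * pk xi)%:E)%E); last first.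
  rewrite (intEZ leb2 (mulr_ge0 D0 m0) measurable_pk) ?integral_pk -?EFinM ?ltry//.
  by move=> z; rewrite ltW// pk_gt0.
apply: le_energy.
- exact: measurable_VI.
- by apply/measurable_EFinP; exact: measurable_funM (measurable_cst _) measurable_pk.
- by move=> xi; exact: VI_ge0.
move=> xi; rewrite /Venergy indicE.
have [|_] := boolP (xi \in cone a b); last first.
  rewrite mulr0 mul0e lee_fin.
  by apply: mulr_ge0; [exact: mulr_ge0|exact/ltW/pk_gt0].
rewrite inE mulr1 => xic; have [x1 x2 _ _] := xic.
pose A := D * `|xi.1 * xi.2| / jap xi ^+ (2 * (M + 2)).
have j0 := jap_gt0 xi.
have A0 : 0 <= A by rewrite divr_ge0 ?exprn_ge0 ?(ltW j0)// mulr_ge0.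
have IA : (Iwave psi q (box x0 r) xi <= (A * m)%:E)%E.
  rewrite EFinM -hm -(intEZ leb2 A0 (measurable_indic2 mU))//.
  apply: le_intE.
  - exact: (measurable_section2 (G := fun xi x : R2 => nc (wavelet psi q x xi) ^+ 2 * \1_(box x0 r) x) xi (measurable_Iwave_aux mpsi mq mU)).
  - exact: measurable_funM (measurable_cst _) (measurable_indic2 mU).
  - by move=> x; rewrite mulr_ge0 ?sqr_ge0.
  - move=> x; rewrite indicE; have [|_] := boolP (x \in _); last by rewrite !mulr0.
    by rewrite inE !mulr1 => xb; exact: hD.
have w0 : 0 <= sobolev_weight s xi / `|xi.1 * xi.2| by rewrite divr_ge0 ?sobolev_ge0.
apply: (@le_trans _ _ ((sobolev_weight s xi / `|xi.1 * xi.2|)%:E * (A * m)%:E)%E).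
  by rewrite lee_wpmul2l ?lee_fin.
rewrite -EFinM lee_fin.
have xx : `|xi.1 * xi.2| != 0 by rewrite normr_eq0 mulf_neq0// gt_eqF.
have j2 : jap xi ^- (M + 2) <= 1 by rewrite invf_le1 ?exprn_gt0// exprn_ege1// jap_ge1.
have jM : 0 < jap xi ^+ M by rewrite exprn_gt0.
rewrite /A [leLHS](_ : _ = D * m * (sobolev_weight s xi / jap xi ^+ M * (jap xi ^- 2) * jap xi ^- (M + 2))); last first.
  have -> : jap xi ^+ (2 * (M + 2)) = jap xi ^+ M * jap xi ^+ 2 * jap xi ^+ (M + 2).
    by rewrite -!exprD mul2n addnn.
  have jM2 : 0 < jap xi ^+ (M + 2) by rewrite exprn_gt0.
  have J2 : 0 < jap xi ^+ 2 by rewrite exprn_gt0.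
  move: (jap xi ^+ M) (jap xi ^+ (M + 2)) (jap xi ^+ 2) `|_| (sobolev_weight s xi) jM jM2 J2 xx => u v w n so hu hv hw hn.
  by field; rewrite hn !gt_eqF.
rewrite ler_wpM2l ?mulr_ge0//.
have h1 : sobolev_weight s xi / jap xi ^+ M <= 1 by rewrite ler_pdivrMr// mul1r hM.
have h10 : 0 <= sobolev_weight s xi / jap xi ^+ M by rewrite divr_ge0 ?sobolev_ge0// ltW.
have h2 : jap xi ^- 2 <= pk xi.
  have p0 := @pk_gt0 R xi; have := pk_ge xi => h; rewrite invf_ple ?posrE ?exprn_gt0//.
  by rewrite -[leLHS]mul1r ler_pdivrMr//; nra.
have h20 : 0 <= jap xi ^- 2 by rewrite invr_ge0 exprn_ge0 ?ltW.
have h30 : 0 <= jap xi ^- (M + 2) by rewrite invr_ge0 exprn_ge0 ?ltW.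
apply: (@le_trans _ _ (1 * pk xi * 1)); last by rewrite mul1r mulr1.
by apply: ler_pM => //; [exact: mulr_ge0|exact: ler_pM].
Qed.

Lemma wavelet_energy_subset (s : R) psi f (U U' G G' : set (R * R)) :
  cmeas (psi : R2 -> R[i]) -> cmeas (f : R2 -> R[i]) ->
  @measurable _ R2 U -> @measurable _ R2 G -> @measurable _ R2 U' -> @measurable _ R2 G' ->
  U' `<=` U -> G' `<=` G ->
  (wavelet_energy s psi f U' G' <= wavelet_energy s psi f U G)%E.
Proof.
move=> mpsi mf mU mG mU' mG' sU sG.
rewrite (wavelet_energyE s mpsi mf mU mG) (wavelet_energyE s mpsi mf mU' mG').
have ind (A B : set (R * R)) z : A `<=` B -> (\1_A z : R) <= \1_B z.
  move=> AB; rewrite !indicE ler_nat; have [|_] := boolP (z \in A); last by [].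
  by rewrite inE => /AB zB; rewrite mem_set.
apply: le_energy.
- exact: measurable_VI.
- exact: measurable_VI.
- by move=> xi; exact: VI_ge0.
move=> xi; apply: lee_pmul.
- by rewrite lee_fin Venergy_ge0.
- exact: Iwave_ge0.
- by rewrite lee_fin /Venergy ler_wpM2l ?ind// divr_ge0 ?sobolev_ge0.
- apply: le_intE.
  + exact: (measurable_section2 (G := fun xi x : R2 => nc (wavelet psi f x xi) ^+ 2 * \1_U' x) xi (measurable_Iwave_aux mpsi mf mU')).
  + exact: (measurable_section2 (G := fun xi x : R2 => nc (wavelet psi f x xi) ^+ 2 * \1_U x) xi (measurable_Iwave_aux mpsi mf mU)).
  + by move=> x; rewrite mulr_ge0 ?sqr_ge0.
  + by move=> x; rewrite ler_wpM2l ?sqr_ge0 ?ind.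
Qed.

Lemma cintegrable_wfun psi f (xi x : R * R) : schwartz psi -> in_L2 f ->
  0 < xi.1 -> 0 < xi.2 -> cintegrable leb2 (wfun psi f xi x : R2 -> R[i]).
Proof.
move=> hpsi /in_L2P[mf jf] x1 x2; have mpsi := schwartz_cmeas hpsi.
have [C C0 hC] := schwartz_le_pk hpsi.
have mk0 : measurable_fun setT (fun t : R2 => `|xi.1 * xi.2| * pk (dil xi x t) : mR).
  exact: measurable_funM (measurable_cst _) (measurable_pk_dil xi x).
have p0 t : 0 <= `|xi.1 * xi.2| * pk (dil xi x t) by rewrite mulr_ge0// ltW// pk_gt0.
have m1 : measurable_fun setT (fun t : R2 => `|xi.1 * xi.2| * nc (f t) ^+ 2 : mR).
  by apply: measurable_funM => //; exact: cmeas_nc2.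
have m2 : measurable_fun setT (fun t : R2 => 4 * C ^+ 2 * (`|xi.1 * xi.2| * pk (dil xi x t)) : mR).
  exact: measurable_funM (measurable_cst _) mk0.
have C2 : 0 <= 4 * C ^+ 2 by rewrite mulr_ge0// sqr_ge0.
apply: (@cintegrable_le _ _ R2 leb2 _ (fun t : R2 => `|xi.1 * xi.2| * nc (f t) ^+ 2
  + 4 * C ^+ 2 * (`|xi.1 * xi.2| * pk (dil xi x t)))).
- exact: (@cmeas_wfun R psi f _ R2 (fun=> xi) (fun=> x) id).
- exact: measurable_funD.
- move=> t; rewrite /wfun !ncM ncC ncJ normr_id.
  have h := hC (dil xi x t); have p1 := @pk_gt0 R (dil xi x t); have p4 := @pk_le1 R (dil xi x t).
  have n0 := nc_ge0 (psi (dil xi x t)); have f0 := nc_ge0 (f t).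
  rewrite (_ : _ + _ = `|xi.1 * xi.2| * (nc (f t) ^+ 2 + C ^+ 2 * (4 * pk (dil xi x t)))); last by ring.
  rewrite mulrAC mulrC ler_wpM2l//.
  move: (nc (psi _)) (nc (f t)) (pk _) h p1 p4 n0 f0 => u v p h p1 p4 u0 v0.
  have h1 : v * u <= v ^+ 2 + u ^+ 2 by have := sqr_ge0 (v - u); nra.
  have h2 : u ^+ 2 <= (C * p) ^+ 2.
    by rewrite ler_sqr ?nnegrE// mulr_ge0 ?ltW.
  have h3 : (C * p) ^+ 2 <= C ^+ 2 * (4 * p).
    by rewrite exprMn ler_wpM2l ?sqr_ge0// expr2 ler_wpM2r// ltW.
  by lra.
- rewrite (intED leb2 m1 m2); last 2 first.
  + by move=> t; rewrite mulr_ge0 ?sqr_ge0.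
  + by move=> t; rewrite mulr_ge0.
  rewrite (intEZ leb2 (normr_ge0 _) (cmeas_nc2 mf)); last by move=> t; rewrite sqr_ge0.
  rewrite (intEZ leb2 C2 mk0 p0) integral_pk_dil// -EFinM.
  by rewrite lte_add_pinfty ?ltry// lte_mul_pinfty.
Qed.

Lemma waveletD psi f g q (x xi : R * R) : schwartz psi -> in_L2 g -> in_L2 q ->
  (forall y, f y = g y + q y) -> 0 < xi.1 -> 0 < xi.2 ->
  wavelet psi f x xi = wavelet psi g x xi + wavelet psi q x xi.
Proof.
move=> hpsi gL qL fE x1 x2; rewrite !waveletE -cintD; last 2 first.
- exact: cintegrable_wfun.
- exact: cintegrable_wfun.
by apply: eq_cint => t; rewrite /wfun fE !mulrDl.
Qed.

Lemma weighted_integralD (V : R2 -> mR) (I1 I2 I3 : R2 -> \bar R) :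
  (forall xi, 0 <= V xi) -> measurable_fun setT V ->
  measurable_fun setT I1 -> measurable_fun setT I2 -> measurable_fun setT I3 ->
  (forall xi, 0 <= I1 xi)%E -> (forall xi, 0 <= I2 xi)%E -> (forall xi, 0 <= I3 xi)%E ->
  (forall xi, V xi = 0 \/ (I1 xi <= 2%:E * I2 xi + 2%:E * I3 xi)%E) ->
  (\int[leb2]_xi ((V xi)%:E * I2 xi) < +oo)%E ->
  (\int[leb2]_xi ((V xi)%:E * I3 xi) < +oo)%E ->
  (\int[leb2]_xi ((V xi)%:E * I1 xi) < +oo)%E.
Proof.
move=> V0 mV m1 m2 m3 p1 p2 p3 h e2 e3.
have mVE : measurable_fun setT (fun xi : R2 => (V xi)%:E) by exact/measurable_EFinP.
have mm1 := emeasurable_funM mVE m1.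
have mm2 := emeasurable_funM mVE m2.
have mm3 := emeasurable_funM mVE m3.
have q2 xi : (0 <= (V xi)%:E * I2 xi)%E by rewrite mule_ge0 ?lee_fin.
have q3 xi : (0 <= (V xi)%:E * I3 xi)%E by rewrite mule_ge0 ?lee_fin.
apply: (@le_lt_trans _ _ (\int[leb2]_xi (2%:E * ((V xi)%:E * I2 xi) +
   2%:E * ((V xi)%:E * I3 xi)))%E).
  apply: le_energy => //.
  - exact: emeasurable_funD (measurable_funeM _ mm2) (measurable_funeM _ mm3).
  - by move=> xi; rewrite mule_ge0 ?lee_fin.
  move=> xi; have [->|hle] := h xi; first by rewrite !mul0e !mule0 adde0.
  rewrite ![(2%:E * _)%E]muleCA -ge0_muleDr ?mule_ge0//.
  by rewrite lee_wpmul2l ?lee_fin.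
rewrite (ge0_integralD leb2 measurableT); last 4 first.
- by move=> xi _; rewrite mule_ge0.
- exact: measurable_funeM mm2.
- by move=> xi _; rewrite mule_ge0.
- exact: measurable_funeM mm3.
rewrite (ge0_integralZl leb2 measurableT mm2)//.
rewrite (ge0_integralZl leb2 measurableT mm3)//.
by rewrite lte_add_pinfty// lte_mul_pinfty.
Qed.

Lemma IwaveD psi f g q (U : set (R * R)) (xi : R * R) : schwartz psi ->
  in_L2 f -> in_L2 g -> in_L2 q -> (forall y, f y = g y + q y) ->
  @measurable _ R2 U -> 0 < xi.1 -> 0 < xi.2 ->
  (Iwave psi f U xi <= 2%:E * Iwave psi g U xi + 2%:E * Iwave psi q U xi)%E.
Proof.
move=> hpsi fL gL qL fE mU x1 x2.
have mpsi := schwartz_cmeas hpsi.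
have [mf _] := in_L2P fL; have [mg _] := in_L2P gL; have [mq _] := in_L2P qL.
have sec h (mh : cmeas (h : R2 -> R[i])) := measurable_section2
  (G := fun xi x : R2 => nc (wavelet psi h x xi) ^+ 2 * \1_U x) xi (measurable_Iwave_aux mpsi mh mU).
have p0 h (x : R2) : 0 <= nc (wavelet psi h x xi) ^+ 2 * \1_U x by rewrite mulr_ge0 ?sqr_ge0.
have s2 h (mh : cmeas (h : R2 -> R[i])) :
    measurable_fun setT (fun x : R2 => 2 * (nc (wavelet psi h x xi) ^+ 2 * \1_U x) : mR).
  exact: measurable_funM (measurable_cst _) (sec h mh).
have e h (mh : cmeas (h : R2 -> R[i])) :
    (2%:E * Iwave psi h U xi = \int[leb2]_x (2 * (nc (wavelet psi h x xi) ^+ 2 * \1_U x))%:E)%E.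
  by rewrite (intEZ leb2 _ (sec _ mh) (p0 h)).
have q0 h (x : R2) : 0 <= 2 * (nc (wavelet psi h x xi) ^+ 2 * \1_U x).
  by apply: mulr_ge0 => //; exact: p0.
have sumE : (2%:E * Iwave psi g U xi + 2%:E * Iwave psi q U xi =
    \int[leb2]_x (2 * (nc (wavelet psi g x xi) ^+ 2 * \1_U x) +
                  2 * (nc (wavelet psi q x xi) ^+ 2 * \1_U x))%:E)%E.
  rewrite (intED leb2 (s2 _ mg) (s2 _ mq) (q0 g) (q0 q)).
  by congr (_ + _)%E; [exact: e g mg|exact: e q mq].
rewrite sumE; apply: le_intE; [exact: sec mf| |exact: p0|].
  exact: measurable_funD (s2 _ mg) (s2 _ mq).
move=> x; rewrite (waveletD x hpsi gL qL fE x1 x2).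
have h := ncD_sqr (wavelet psi g x xi) (wavelet psi q x xi).
have i0 : 0 <= \1_U x :> R by [].
by move: (nc _ ^+ 2) (nc _ ^+ 2) (nc _ ^+ 2) (\1_U x : R) h i0 => u v w i h i0; nra.
Qed.

Lemma wavelet_energyD (s : R) psi f g q (U G : set (R * R)) : schwartz psi ->
  in_L2 f -> in_L2 g -> in_L2 q -> (forall y, f y = g y + q y) ->
  @measurable _ R2 U -> @measurable _ R2 G -> (forall xi, G xi -> 0 < xi.1 /\ 0 < xi.2) ->
  (wavelet_energy s psi g U G < +oo)%E -> (wavelet_energy s psi q U G < +oo)%E ->
  (wavelet_energy s psi f U G < +oo)%E.
Proof.
move=> hpsi fL gL qL fE mU mG G0.
have mpsi := schwartz_cmeas hpsi.
have [mf _] := in_L2P fL; have [mg _] := in_L2P gL; have [mq _] := in_L2P qL.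
rewrite (wavelet_energyE s mpsi mg mU mG) (wavelet_energyE s mpsi mq mU mG).
rewrite (wavelet_energyE s mpsi mf mU mG).
apply: weighted_integralD.
- by move=> xi; exact: Venergy_ge0.
- exact: measurable_Venergy.
- exact: measurable_Iwave.
- exact: measurable_Iwave.
- exact: measurable_Iwave.
- by move=> xi; exact: Iwave_ge0.
- by move=> xi; exact: Iwave_ge0.
- by move=> xi; exact: Iwave_ge0.
move=> xi; have [Gxi|nG] := pselect (G xi).
  by right; have [x1 x2] := G0 _ Gxi; exact: IwaveD.
by left; rewrite /Venergy indicE memNset// mulr0.
Qed.

End EnergyComparison.

(** * Wavelet energy in terms of the Fourier transform *)


Section PlaneWaveletPlancherel.
Context {R : realType}.
Local Notation R2 := (measurableTypeR R * measurableTypeR R)%type.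
Local Notation mR := (measurableTypeR R).
Implicit Types psi f g h q : R * R -> R[i].

Definition pm (xi x : R * R) : R * R := (xi.1 * x.1, xi.2 * x.2).

Lemma pm_affine xi x : pm xi x = affine2 (0, 0) xi x.
Proof. by rewrite /pm /affine2 /= !add0r. Qed.

Lemma pmC xi x : pm xi x = pm x xi.
Proof. by rewrite /pm /= mulrC [X in (_, X)]mulrC. Qed.

Lemma measurable_pm d (T : measurableType d) (u v : T -> R2) :
  measurable_fun setT u -> measurable_fun setT v ->
  measurable_fun setT (fun x => pm (u x) (v x) : R2).
Proof.
move=> mu' mv; apply: measurable_fun_pair; apply: measurable_funM.
- exact: measurableT_comp measurable_fst mu'.
- exact: measurableT_comp measurable_fst mv.
- exact: measurableT_comp measurable_snd mu'.
- exact: measurableT_comp measurable_snd mv.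
Qed.

Lemma measurable_pm1 xi : measurable_fun setT (pm xi : R2 -> R2).
Proof. exact: (@measurable_pm _ R2 (fun=> xi) id). Qed.

Lemma dot_dil xi x t eta : dot (dil xi x t) eta = dot t (pm xi eta) - dot x (pm xi eta).
Proof. by rewrite /dot /dil /pm /=; ring. Qed.

Lemma dot_pm xi x eta : dot eta (pm xi x) = dot x (pm xi eta).
Proof. by rewrite /dot /pm /=; ring. Qed.

Variable psi : R * R -> R[i].
Hypothesis psi_schwartz : schwartz psi.
Hypothesis psi_supp : supp (fourier psi) `<=` `[1 / 2, 2] `*` `[1 / 2, 2].

Lemma psihat_sq : exists2 B : R, 0 <= B &
  (\int[leb2]_t (nc (fourier psi t) ^+ 2)%:E <= B%:E)%E.
Proof.
have [C C0 hC] := psihat_le_pk psi_schwartz psi_supp.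
have C2 : 0 <= 4 * C ^+ 2 by rewrite mulr_ge0// sqr_ge0.
exists (4 * C ^+ 2 * kap); first by rewrite mulr_ge0// ltW// kap_gt0.
rewrite EFinM -integral_pk -(intEZ leb2 C2 measurable_pk); last first.
  by move=> t; exact/ltW/pk_gt0.
apply: le_intE.
- exact: cmeas_nc2 (psihat_cmeas psi_schwartz).
- exact: measurable_funM (measurable_cst _) measurable_pk.
- by move=> t; exact: sqr_ge0.
- move=> t; have p0 := @pk_gt0 R t; have p4 := @pk_le1 R t; have h := hC t.
  have n0 := nc_ge0 (fourier psi t).
  move: (nc _) (pk t) p0 p4 h n0 => u p p0 p4 h u0.
  have h2 : u ^+ 2 <= (C * p) ^+ 2 by rewrite ler_sqr ?nnegrE// mulr_ge0 ?ltW.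
  have h3 : (C * p) ^+ 2 <= C ^+ 2 * (4 * p).
    by rewrite exprMn ler_wpM2l ?sqr_ge0// expr2 ler_wpM2r// ltW.
  by lra.
Qed.

Variable h : R * R -> R[i].
Hypothesis ih : cintegrable leb2 (h : R2 -> R[i]).

Definition vfun (xi eta : R * R) : R[i] := fourier psi eta * conjc (fourier h (pm xi eta)).

Lemma cmeas_vfun2 : cmeas (fun z : R2 * R2 => vfun z.1 z.2).
Proof.
apply: cmeasM; first exact: cmeas_comp (psihat_cmeas psi_schwartz) measurable_snd.
apply: cmeasJ; apply: (cmeas_comp (cmeas_fourier ih.1) (u := fun z : R2 * R2 => pm z.1 z.2)).
by apply: measurable_pm; [exact: measurable_fst|exact: measurable_snd].
Qed.

Lemma cintegrable_vfun xi : cintegrable leb2 (vfun xi : R2 -> R[i]).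
Proof.
have [M M0 hM] := fourier_bound ih.
have [mP jP] := psihat_cintegrable psi_schwartz psi_supp.
have mn := cmeas_nc mP.
apply: (@cintegrable_le _ _ R2 leb2 _ (fun t : R2 => M * nc (fourier psi t))).
- exact: (cmeas_section2 (G := fun xi eta : R2 => vfun xi eta) xi cmeas_vfun2).
- exact: measurable_funM (measurable_cst _) mn.
- by move=> t; rewrite ncM ncJ mulrC ler_wpM2r ?nc_ge0.
- rewrite (intEZ leb2 M0 mn); last by move=> t; exact: nc_ge0.
  by rewrite lte_mul_pinfty.
Qed.

Lemma wavelet_fourier x xi :
  kap%:C * wavelet psi h x xi = `|xi.1 * xi.2|%:C * conjc (fourier (vfun xi) (pm xi x)).
Proof.
have iP := psihat_cintegrable psi_schwartz psi_supp.
have [mP jP] := iP; have [mh jh] := ih.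
pose G (t eta : R2) : R[i] := h t * (conjc (fourier psi eta) * cexp (dot (dil xi x t) eta)).
have mG : cmeas (fun z : R2 * R2 => G z.1 z.2).
  apply: cmeasM; first exact: cmeas_comp mh measurable_fst.
  apply: cmeasM; first exact: cmeasJ (cmeas_comp mP measurable_snd).
  apply: cmeas_cexp; apply: measurable_fun_dot; last exact: measurable_snd.
  by apply: measurable_dil; [exact: measurable_cst|exact: measurable_cst|exact: measurable_fst].
have iE (z : R * R) : cintegrable leb2 (fun t : R2 => fourier psi t * conjc (cexp (dot z t))).
  split; last by under eq_integral do rewrite ncM ncJ nc_cexp mulr1.
  apply: cmeasM => //; apply: cmeasJ; apply: cmeas_cexp.
  exact: (@measurable_fun_dot R _ R2 (fun=> z) id).
have iE' (z : R * R) : cintegrable leb2 (fun t : R2 => conjc (fourier psi t) * cexp (dot z t)).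
  split; last by under eq_integral do rewrite ncM ncJ nc_cexp mulr1.
  apply: cmeasM; first exact: cmeasJ.
  apply: cmeas_cexp; exact: (@measurable_fun_dot R _ R2 (fun=> z) id).
have psiE z : kap%:C * conjc (psi z) = cint leb2 (fun t : R2 => conjc (fourier psi t) * cexp (dot z t)).
  rewrite -[kap%:C]conjc_real -conjcM -(psi_inversion psi_schwartz psi_supp z) -cintJ//.
  by apply: eq_cint => t; rewrite conjcM conjcK.
have E1 (t : R2) : kap%:C * wfun psi h xi x t = `|xi.1 * xi.2|%:C * cint leb2 (G t).
  rewrite /G cintZ// -psiE /wfun; ring.
have mW : cmeas (wfun psi h xi x : R2 -> R[i]).
  exact: (@cmeas_wfun R psi h _ R2 (fun=> xi) (fun=> x) id (schwartz_cmeas psi_schwartz)).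
have [B B0 hB] := schwartz_bounded psi_schwartz.
have iW : cintegrable leb2 (wfun psi h xi x : R2 -> R[i]).
  have c0 : 0 <= `|xi.1 * xi.2| * B by rewrite mulr_ge0// ltW.
  apply: (@cintegrable_le _ _ R2 leb2 _ (fun t : R2 => `|xi.1 * xi.2| * B * nc (h t))) => //.
  - exact: measurable_funM (measurable_cst _) (cmeas_nc mh).
  - move=> t; rewrite /wfun !ncM ncC ncJ normr_id -mulrA mulrC ler_wpM2r ?nc_ge0//.
    by rewrite ler_wpM2l.
  - rewrite (intEZ leb2 c0 (cmeas_nc mh)); last by move=> t; exact: nc_ge0.
    by rewrite lte_mul_pinfty.
have iG : cintegrable leb2 (fun t => cint leb2 (G t)).
  have [xx|xx] := eqVneq `|xi.1 * xi.2| 0; last first.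
    have -> : (fun t => cint leb2 (G t)) = fun t : R2 => (`|xi.1 * xi.2|%:C^-1 * kap%:C) * wfun psi h xi x t.
      apply/funext => t; rewrite -mulrA E1 mulKf//.
      by apply: contra xx => /eqP[->].
    exact: cintegrableZ.
  have c0 : 0 <= fine (\int[leb2]_t (nc (fourier psi t))%:E)%E * 2.
    by rewrite mulr_ge0// fine_ge0// intE_ge0// => t; exact: nc_ge0.
  apply: (@cintegrable_le _ _ R2 leb2 _ (fun t : R2 => fine (\int[leb2]_t (nc (fourier psi t))%:E)%E * 2 * nc (h t))).
  - exact: cmeas_cint1.
  - exact: measurable_funM (measurable_cst _) (cmeas_nc mh).
  - move=> t; rewrite /G cintZ// ncM mulrC ler_wpM2r ?nc_ge0// -lee_fin EFinM fineK; last first.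
      by rewrite ge0_fin_numE// intE_ge0// => u; exact: nc_ge0.
    apply: le_trans (nc_cint leb2 (iE' _).1) _; rewrite muleC.
    by under eq_integral do rewrite ncM ncJ nc_cexp mulr1.
  - rewrite (intEZ leb2 c0 (cmeas_nc mh)); last by move=> t; exact: nc_ge0.
    by rewrite lte_mul_pinfty.
rewrite waveletE -cintZ// (eq_cint leb2 E1) cintZ//; congr (_ * _).
rewrite (@cint_Fubini_le _ _ _ _ _ leb2 leb2 _ _ _ mG (cmeas_nc mh) (cmeas_nc mP) _ _ jh jP); last 3 first.
- by move=> t; exact: nc_ge0.
- by move=> t; exact: nc_ge0.
- by move=> t eta; rewrite /G !ncM ncJ nc_cexp mulr1.
rewrite fourierE -cintJ; last exact: cintegrable_fourier (cintegrable_vfun xi).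
apply: eq_cint => eta; rewrite /G /vfun !conjcM conjcK dot_pm.
have -> : (fun t : R2 => h t * (conjc (fourier psi eta) * cexp (dot (dil xi x t) eta))) =
   fun t => (conjc (fourier psi eta) * conjc (cexp (dot x (pm xi eta)))) * (h t * cexp (dot t (pm xi eta))).
  by apply/funext => t; rewrite dot_dil cexpB; ring.
rewrite cintZ; last exact: cintegrable_fourier.
by rewrite -[cint _ _]fourierE; ring.
Qed.

Lemma wavelet_sq_le xi : 0 < xi.1 -> 0 < xi.2 ->
  (\int[leb2]_x (nc (wavelet psi h x xi) ^+ 2)%:E <=
   (4 / kap * `|xi.1 * xi.2|)%:E * \int[leb2]_eta (nc (vfun xi eta) ^+ 2)%:E)%E.
Proof.
move=> x1 x2; have k0 := @kap_gt0 R.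
have mv := cmeas_fourier (cintegrable_vfun xi).1.
have xx : 0 < `|xi.1 * xi.2| by rewrite normr_gt0 mulf_neq0 ?gt_eqF.
have e (x : R2) : nc (wavelet psi h x xi) ^+ 2 =
    kap ^- 2 * `|xi.1 * xi.2| * (`|xi.1 * xi.2| * nc (fourier (vfun xi) (pm xi x)) ^+ 2).
  have := congr1 (fun z => nc z) (wavelet_fourier x xi).
  rewrite !ncM ncJ !ncC normr_id (ger0_norm (ltW k0)) => hh.
  have -> : nc (wavelet psi h x xi) = kap^-1 * (`|xi.1 * xi.2| * nc (fourier (vfun xi) (pm xi x))).
    by rewrite -hh mulKf// gt_eqF.
  by rewrite exprMn exprVn; ring.
rewrite (eq_integral _ _ (fun x _ => congr1 EFin (e x))).
have mm : measurable_fun setT (fun x : R2 => nc (fourier (vfun xi) (pm xi x)) ^+ 2 : mR).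
  exact: measurableT_comp (cmeas_nc2 mv) (measurable_pm1 xi).
have c1 : 0 <= kap ^- 2 * `|xi.1 * xi.2| by rewrite mulr_ge0 ?invr_ge0 ?sqr_ge0.
rewrite (intEZ leb2 c1 (measurable_funM (measurable_cst _) mm)); last first.
  by move=> x; apply: mulr_ge0; [exact: normr_ge0|exact: exprn_ge0 _ (nc_ge0 _)].
rewrite (intEZ leb2 (ltW xx) mm (fun x => sqr_ge0 _)).
have := integralR_affine2 (0, 0) (lt0r_neq0 x1) (lt0r_neq0 x2) (cmeas_nc2 mv) (fun z => sqr_ge0 _).
under [X in _ = (_ * X)%E -> _]eq_integral do rewrite -pm_affine.
move=> <-.
have := plancherel_le (cintegrable_vfun xi) => hp.
apply: (@le_trans _ _ ((kap ^- 2 * `|xi.1 * xi.2|)%:E * ((4 * kap)%:E * \int[leb2]_x (nc (vfun xi x) ^+ 2)%:E))%E).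
  by rewrite lee_wpmul2l ?lee_fin.
rewrite muleA -EFinM (_ : kap ^- 2 * `|xi.1 * xi.2| * (4 * kap) = 4 / kap * `|xi.1 * xi.2|)//.
by field; rewrite gt_eqF.
Qed.

End PlaneWaveletPlancherel.

Section PartA.
Context {R : realType}.
Local Notation R2 := (measurableTypeR R * measurableTypeR R)%type.
Local Notation mR := (measurableTypeR R).
Implicit Types psi f g h q : R * R -> R[i].

Lemma sobolev_le_scale (s K : R) (x y : R * R) : 0 <= s -> 0 <= K ->
  jap x <= K * jap y -> sobolev_weight s x <= K `^ s * sobolev_weight s y.
Proof.
move=> s0 K0 xy; rewrite /sobolev_weight -powRM//; last exact/ltW/jap_gt0.
apply: ge0_ler_powR => //; rewrite nnegrE; first exact/ltW/jap_gt0.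
by rewrite mulr_ge0//; exact/ltW/jap_gt0.
Qed.

Lemma jap_pm_ge (xi eta : R * R) : 1 / 2 <= eta.1 -> 1 / 2 <= eta.2 ->
  jap xi <= 4 * jap (pm xi eta).
Proof.
move=> h1 h2; rewrite /jap /pm /= !exprMn.
have a1 : 1 / 4 <= eta.1 ^+ 2 by nra.
have a2 : 1 / 4 <= eta.2 ^+ 2 by nra.
have := sqr_ge0 xi.1; have := sqr_ge0 xi.2.
move: (xi.1 ^+ 2) (xi.2 ^+ 2) (eta.1 ^+ 2) (eta.2 ^+ 2) a1 a2 => u v p q a1 a2 v0 u0.
have : u * (1 / 4) <= u * p by rewrite ler_wpM2l.
have : v * (1 / 4) <= v * q by rewrite ler_wpM2l.
lra.
Qed.

Lemma cone_pm (rho : R) (xi eta : R * R) : 0 < rho ->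
  cone (10 / 11 * rho) (11 / 10 * rho) xi ->
  1 / 2 <= eta.1 <= 2 -> 1 / 2 <= eta.2 <= 2 ->
  cone (1 / 5 * rho) (5 * rho) (pm xi eta).
Proof.
move=> r0 [x1 x2 h1 h2] /andP[e1 e2] /andP[e3 e4].
have rx : 0 < rho * xi.2 by rewrite mulr_gt0.
have k1 : xi.1 * (1 / 2) <= xi.1 * eta.1 by rewrite ler_pM2l.
have k2 : xi.1 * eta.1 <= xi.1 * 2 by rewrite ler_pM2l.
have k3 : rho * xi.2 * (1 / 2) <= rho * xi.2 * eta.2 by rewrite ler_pM2l.
have k4 : rho * xi.2 * eta.2 <= rho * xi.2 * 2 by rewrite ler_pM2l.
split => /=.
- by rewrite mulr_gt0//; lra.
- by rewrite mulr_gt0//; lra.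
- by rewrite (_ : 1 / 5 * rho * _ = 1 / 5 * (rho * xi.2 * eta.2)); [lra|ring].
- by rewrite (_ : 5 * rho * _ = 5 * (rho * xi.2 * eta.2)); [lra|ring].
Qed.

Lemma wavelet_energy_of_fourier psi h (s : R) (U Gs Gb : set (R * R)) :
  schwartz psi -> supp (fourier psi) `<=` `[1 / 2, 2] `*` `[1 / 2, 2] ->
  cintegrable leb2 (h : R2 -> R[i]) -> 0 <= s ->
  @measurable _ R2 U -> @measurable _ R2 Gs -> @measurable _ R2 Gb ->
  (forall xi, Gs xi -> 0 < xi.1 /\ 0 < xi.2) ->
  (forall xi eta : R * R, Gs xi -> 1 / 2 <= eta.1 <= 2 -> 1 / 2 <= eta.2 <= 2 -> Gb (pm xi eta)) ->
  (fourier_energy s h Gb < +oo)%E -> (wavelet_energy s psi h U Gs < +oo)%E.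
Proof.
move=> hpsi hsupp ih s0 mU mGs mGb Gs0 hG.
have mpsi := schwartz_cmeas hpsi; have [mh jh] := ih.
have mF := cmeas_fourier mh; have mP := psihat_cmeas hpsi.
have kap0 := @kap_gt0 R.
rewrite fourier_energyE (wavelet_energyE s mpsi mh mU mGs).
pose Kf (t : R2) := nc (fourier h t) ^+ 2 * sobolev_weight s t * \1_Gb t.
have mK : measurable_fun setT (Kf : R2 -> mR).
  apply: measurable_funM; last exact: measurable_indic2.
  by apply: measurable_funM; [exact: cmeas_nc2|exact: measurable_sobolev].
have K0 t : 0 <= Kf t.
  by apply: mulr_ge0 => //; apply: mulr_ge0; [exact: sqr_ge0|exact: sobolev_ge0].
rewrite -/(Kf _) => eK.
have [E E0 EE] := lty_fine (intE_ge0 leb2 K0) eK.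
pose c := 4 / kap * 4 `^ s.
have c0 : 0 <= c by rewrite mulr_ge0 ?powR_ge0// divr_ge0// ltW.
pose Phi (xi eta : R2) := c * nc (fourier psi eta) ^+ 2 * Kf (pm xi eta).
have mPhi : measurable_fun setT (fun z : R2 * R2 => Phi z.1 z.2 : mR).
  apply: measurable_funM.
    apply: measurable_funM => //.
    exact: measurableT_comp (cmeas_nc2 mP) measurable_snd.
  apply: (measurableT_comp mK).
  by apply: measurable_pm; [exact: measurable_fst|exact: measurable_snd].
have Phi0 xi eta : 0 <= Phi xi eta.
  by apply: mulr_ge0 => //; apply: mulr_ge0 => //; exact: sqr_ge0.
apply: (@le_lt_trans _ _ (\int[leb2]_xi \int[leb2]_eta (Phi xi eta)%:E)%E).
  apply: le_energy.
  - exact: measurable_VI.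
  - exact: (@measurable_int2 _ _ _ R2 R2 leb2 Phi mPhi Phi0).
  - by move=> xi; exact: VI_ge0.
  move=> xi; have [Gxi|nG] := pselect (Gs xi); last first.
    have -> : Venergy s Gs xi = 0 by rewrite /Venergy indicE memNset// mulr0.
    by rewrite mul0e; exact: intE_ge0.
  have [x1 x2] := Gs0 _ Gxi.
  have xx : 0 < `|xi.1 * xi.2| by rewrite normr_gt0 mulf_neq0 ?gt_eqF.
  have VE : Venergy s Gs xi = sobolev_weight s xi / `|xi.1 * xi.2|.
    by rewrite /Venergy indicE mem_set// mulr1.
  have V0 : 0 <= Venergy s Gs xi by exact: Venergy_ge0.
  have IW : (Iwave psi h U xi <= \int[leb2]_x (nc (wavelet psi h x xi) ^+ 2)%:E)%E.
    apply: le_intE.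
    - exact: (measurable_section2 (G := fun xi x : R2 => nc (wavelet psi h x xi) ^+ 2 * \1_U x) xi (measurable_Iwave_aux mpsi mh mU)).
    - exact: cmeas_nc2 (cmeas_section1 (G := fun x xi : R2 => wavelet psi h x xi) xi (cmeas_wavelet mpsi mh)).
    - by move=> x; apply: mulr_ge0 => //; exact: sqr_ge0.
    - by move=> x; rewrite ler_piMr ?sqr_ge0// indicE; case: (_ \in _).
  apply: (@le_trans _ _ ((Venergy s Gs xi)%:E * ((4 / kap * `|xi.1 * xi.2|)%:E * \int[leb2]_eta (nc (vfun psi h xi eta) ^+ 2)%:E))%E).
    rewrite lee_wpmul2l ?lee_fin//; apply: le_trans IW _.
    exact: wavelet_sq_le.
  rewrite muleA -EFinM VE.
  have -> : sobolev_weight s xi / `|xi.1 * xi.2| * (4 / kap * `|xi.1 * xi.2|) = 4 / kap * sobolev_weight s xi.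
    by field; rewrite !gt_eqF.
  have mv : measurable_fun setT (fun eta : R2 => nc (vfun psi h xi eta) ^+ 2 : mR).
    exact: cmeas_nc2 (cmeas_section2 (G := fun xi eta : R2 => vfun psi h xi eta) xi (cmeas_vfun2 hpsi ih)).
  have w0 : 0 <= 4 / kap * sobolev_weight s xi.
    by rewrite mulr_ge0 ?sobolev_ge0// divr_ge0// ltW.
  rewrite -(intEZ leb2 w0 mv (fun x => sqr_ge0 _)).
  apply: le_intE.
  - exact: measurable_funM (measurable_cst _) mv.
  - exact: (measurable_section2 (G := Phi) xi mPhi).
  - by move=> eta; apply: mulr_ge0 => //; exact: sqr_ge0.
  move=> eta; rewrite /vfun ncM ncJ exprMn /Phi.
  have [->|hneq] := eqVneq (fourier psi eta) 0; first by rewrite nc0 expr0n/= !mul0r !mulr0 mul0r.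
  have [h1 h2] := psihat_neq0 hsupp hneq.
  rewrite /Kf indicE mem_set ?mulr1; last exact: hG.
  have /andP[e1 _] := h1; have /andP[e2 _] := h2.
  have hw := sobolev_le_scale s0 (ler0n R 4) (jap_pm_ge xi e1 e2).
  have k4 : 0 <= 4 / kap :> R by rewrite divr_ge0// ltW.
  have := sqr_ge0 (nc (fourier psi eta)); have := sqr_ge0 (nc (fourier h (pm xi eta))).
  rewrite /c; move: (nc (fourier psi eta) ^+ 2) (nc (fourier h (pm xi eta)) ^+ 2) hw k4.
  move: (sobolev_weight s xi) (sobolev_weight s (pm xi eta)) (4 `^ s) (4 / kap) => w w' d k u v hw k4 u0 v0.
  rewrite (_ : k * w * (u * v) = k * u * v * w); last by ring.
  rewrite (_ : k * d * u * (v * w') = k * u * v * (d * w')); last by ring.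
  by rewrite ler_wpM2l// mulr_ge0// mulr_ge0.
rewrite (@tonelliR _ _ _ _ _ leb2 leb2 Phi mPhi Phi0).
have [B B0 hB] := psihat_sq hpsi hsupp.
have c4 : 0 <= 4 * c * E by rewrite mulr_ge0// mulr_ge0.
apply: (@le_lt_trans _ _ (\int[leb2]_eta (4 * c * E * nc (fourier psi eta) ^+ 2)%:E)%E); last first.
  rewrite (intEZ leb2 c4 (cmeas_nc2 mP) (fun x => sqr_ge0 _)).
  apply: (@le_lt_trans _ _ ((4 * c * E)%:E * B%:E)%E); last by rewrite -EFinM ltry.
  by rewrite lee_wpmul2l ?lee_fin.
apply: le_energy.
- exact: (@measurable_int2 _ _ _ R2 R2 leb2 (fun eta xi => Phi xi eta) (measurableT_comp mPhi (@measurable_swap _ _ _ _)) (fun eta xi => Phi0 xi eta)).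
- by apply/measurable_EFinP; exact: measurable_funM (measurable_cst _) (cmeas_nc2 mP).
- by move=> eta; exact: intE_ge0.
move=> eta.
have mKe : measurable_fun setT (fun xi : R2 => Kf (pm xi eta) : mR).
  apply: (measurableT_comp mK); exact: (@measurable_pm R _ R2 id (fun=> eta)).
have ce : 0 <= c * nc (fourier psi eta) ^+ 2 by rewrite mulr_ge0 ?sqr_ge0.
rewrite (intEZ leb2 ce mKe (fun x => K0 _)).
have [->|hneq] := eqVneq (fourier psi eta) 0.
  by rewrite nc0 expr0n/= !mulr0 mul0e.
have [/andP[h1 _] /andP[h2 _]] := psihat_neq0 hsupp hneq.
have e1 : 0 < eta.1 by lra.
have e2 : 0 < eta.2 by lra.
have := integralR_affine2 (0, 0) (lt0r_neq0 e1) (lt0r_neq0 e2) mK K0.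
under [X in _ = (_ * X)%E -> _]eq_integral do rewrite -pm_affine pmC.
rewrite EE => hE.
have i0 : (0 <= \int[leb2]_xi (Kf (pm xi eta))%:E)%E by exact: intE_ge0.
have ifin : (\int[leb2]_xi (Kf (pm xi eta))%:E < +oo)%E.
  rewrite ltey; apply/eqP => iy; move: hE; rewrite iy gt0_muley//.
  by rewrite lte_fin normr_gt0 mulf_neq0 ?gt_eqF.
have [J J0 JE] := lty_fine i0 ifin.
rewrite JE -EFinM lee_fin; rewrite JE -EFinM in hE.
case: hE => hE.
have hJ : J <= 4 * E.
  rewrite hE ger0_norm ?mulr_ge0 ?(ltW e1) ?(ltW e2)//.
  have : 1 / 4 <= eta.1 * eta.2 by nra.
  by move=> hq; have := ler_wpM2r J0 hq; lra.
rewrite (_ : 4 * c * E * _ = c * nc (fourier psi eta) ^+ 2 * (4 * E)); last by ring.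
by rewrite ler_wpM2l.
Qed.

End PartA.

Section Cutoff.
Context {R : realType}.
Local Notation R2 := (measurableTypeR R * measurableTypeR R)%type.
Local Notation mR := (measurableTypeR R).
Implicit Types psi f g h q phi : R * R -> R[i].

Lemma in_L2_intro f : cmeas (f : R2 -> R[i]) ->
  (\int[leb2]_x (nc (f x) ^+ 2)%:E < +oo)%E -> in_L2 f.
Proof.
move=> [mR mI] fn; split => //; rewrite /finite_norm unlock; apply: poweR_lty.
apply: le_lt_trans fn; rewrite le_eqVlt; apply/orP; left; apply/eqP.
by apply: eq_integral => x _; rewrite /= ger0_norm ?nc_ge0// powR_mulrn// nc_ge0.
Qed.

Lemma in_L2_le f g (M : R) : in_L2 f -> cmeas (g : R2 -> R[i]) -> 0 <= M ->
  (forall x, nc (g x) <= M * nc (f x)) -> in_L2 g.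
Proof.
move=> /in_L2P[mf jf] mg M0 h; apply: in_L2_intro => //.
apply: (@le_lt_trans _ _ (\int[leb2]_x (M ^+ 2 * nc (f x) ^+ 2)%:E)%E).
  apply: le_intE.
  - exact: cmeas_nc2 mg.
  - exact: measurable_funM (measurable_cst _) (cmeas_nc2 mf).
  - by move=> x; exact: sqr_ge0.
  - by move=> x; rewrite -exprMn ler_sqr ?nnegrE ?mulr_ge0 ?nc_ge0// h.
rewrite (intEZ leb2 (sqr_ge0 M) (cmeas_nc2 mf) (fun x => sqr_ge0 _)).
by rewrite lte_mul_pinfty// lee_fin sqr_ge0.
Qed.

Lemma cintegrable_local f g (M rho : R) (x0 : R * R) : in_L2 f -> cmeas (g : R2 -> R[i]) ->
  0 <= M -> (forall x, nc (g x) <= M * nc (f x)) ->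
  (forall x, ~ box x0 rho x -> g x = 0) -> cintegrable leb2 (g : R2 -> R[i]).
Proof.
move=> /in_L2P[mf jf] mg M0 h h0.
have [m m0 hm] := box_finite x0 rho.
have mb := measurable_indic2 (measurable_box x0 rho).
have m2 : measurable_fun setT (fun x : R2 => M * nc (f x) ^+ 2 : mR).
  exact: measurable_funM (measurable_cst _) (cmeas_nc2 mf).
have m1 : measurable_fun setT (fun x : R2 => M * \1_(box x0 rho) x : mR).
  exact: measurable_funM (measurable_cst _) mb.
apply: (@cintegrable_le _ _ R2 leb2 _ (fun x : R2 => M * nc (f x) ^+ 2 + M * \1_(box x0 rho) x)) => //.
- exact: measurable_funD.
- move=> x; rewrite indicE; have [|nb] := boolP (x \in _).
    move=> _; apply: le_trans (h x) _; rewrite -mulrDr ler_wpM2l//.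
    have := sqr_ge0 (nc (f x) - 1); have := sqr_ge0 (nc (f x)).
    by rewrite /=; move: (nc (f x)) => u; nra.
  rewrite h0; last by move: nb; rewrite notin_setE.
  by rewrite nc0 mulr0 addr0 mulr_ge0// sqr_ge0.
- rewrite (intED leb2 m2 m1); last 2 first.
  + by move=> x; rewrite mulr_ge0// sqr_ge0.
  + by move=> x; rewrite mulr_ge0.
  rewrite (intEZ leb2 M0 (cmeas_nc2 mf) (fun x => sqr_ge0 _)).
  rewrite (intEZ leb2 M0 mb)// hm -EFinM.
  by rewrite lte_add_pinfty ?ltry// lte_mul_pinfty.
Qed.

Lemma compact_bound (A : set (R * R)) (k : R * R -> R) : compact A -> continuous k ->
  exists2 M, 0 <= M & forall x, A x -> `|k x| <= M.
Proof.
move=> cA ck.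
have cK : compact (k @` A).
  by apply: continuous_compact => //; exact: continuous_subspaceT.
have [M [_ hM]] := compact_bounded cK.
exists (`|M| + 1); first by rewrite addr_ge0.
move=> x Ax; apply: (hM (`|M| + 1)); last by exists x.
by rewrite (le_lt_trans (ler_norm M))// ltrDl.
Qed.

Lemma cutoff_facts (x0 : R * R) phi : cutoff_at x0 phi ->
  [/\ cmeas (phi : R2 -> R[i]), exists2 M, 0 <= M & forall x, nc (phi x) <= M,
      exists rho, forall x, ~ box (0, 0) rho x -> phi x = 0 &
      exists2 r, 0 < r & forall x, box x0 (2 * r) x -> phi x = 1].
Proof.
move=> [[[sR sI] cS] near1].
have cR : continuous (Re \o phi) by have [] := sR [::].
have cI : continuous (Im \o phi) by have [] := sI [::].
have out x : ~ supp phi x -> phi x = 0.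
  move=> nS; apply: contrapT => /eqP px; apply: nS; exact: subset_closure.
split.
- by split; exact: continuous_measurable2.
- have [M1 M10 h1] := compact_bound cS cR; have [M2 M20 h2] := compact_bound cS cI.
  exists (M1 + M2); first exact: addr_ge0.
  move=> x; have [Sx|nS] := pselect (supp phi x).
    by apply: le_trans (nc_le _) _; rewrite lerD ?h1 ?h2.
  by rewrite out// nc0 addr_ge0.
- have c1 : continuous (fst : R * R -> R) by move=> [z1 z2]; exact: cvg_fst.
  have c2 : continuous (snd : R * R -> R) by move=> [z1 z2]; exact: cvg_snd.
  have [M1 M10 h1] := compact_bound cS c1; have [M2 M20 h2] := compact_bound cS c2.
  exists (M1 + M2 + 1) => x nb; apply: out => Sx; apply: nb; split => /=.
  + by rewrite sub0r normrN (le_lt_trans (h1 _ Sx))//; lra.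
  + by rewrite sub0r normrN (le_lt_trans (h2 _ Sx))//; lra.
- have /nbhs_boxP[r r0 hr] := near1; exists (r / 2); first by rewrite divr_gt0.
  by move=> x xb; apply: hr; rewrite mulrC divfK// in xb.
Qed.

Lemma in_cone_ratio (xi : R * R) (a b : R) : 0 < xi.1 -> 0 < xi.2 -> a < 1 -> 1 < b ->
  cone (a * (xi.1 / xi.2)) (b * (xi.1 / xi.2)) xi.
Proof.
move=> x1 x2 a1 b1; split => //; rewrite -mulrA divfK ?gt_eqF//.
- by rewrite -[ltRHS]mul1r ltr_pM2r.
- by rewrite -[ltLHS]mul1r ltr_pM2r.
Qed.

Theorem microlocal_PU_of_fourier_energy psi f (x0 xi0 : R * R) (s : R) phi : schwartz psi ->
  supp (fourier psi) `<=` `[1 / 2, 2] `*` `[1 / 2, 2] -> in_L2 f ->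
  0 < xi0.1 -> 0 < xi0.2 -> 0 <= s -> cutoff_at x0 phi ->
  (fourier_energy s (fun x => phi x * f x)%R (Gamma_psi xi0) < +oo)%E ->
  microlocal_PU psi s f x0 xi0.
Proof.
move=> hpsi hsupp fL x1 x2 s0 hphi hE.
have [mphi [M M0 hM] [rho hrho] [r r0 hr]] := cutoff_facts hphi.
have [mf jf] := in_L2P fL.
pose h (x : R * R) := phi x * f x.
pose q (x : R * R) := f x - phi x * f x.
have mh : cmeas (h : R2 -> R[i]) by exact: cmeasM.
have hle x : nc (h x) <= M * nc (f x) by rewrite ncM ler_wpM2r ?nc_ge0.
have hL := in_L2_le fL mh M0 hle.
have qL : in_L2 q.
  apply: (in_L2_le (M := 1 + M) fL); first exact: cmeasB.
    by rewrite addr_ge0.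
  by move=> x; apply: le_trans (ncD _ _) _; rewrite ncN mulrDl mul1r lerD2l; exact: hle.
have ih : cintegrable leb2 (h : R2 -> R[i]).
  apply: (cintegrable_local (x0 := (0, 0)) (rho := rho) fL mh M0 hle) => x /hrho.
  by rewrite /h => ->; rewrite mul0r.
pose rat := xi0.1 / xi0.2.
have rat0 : 0 < rat by rewrite divr_gt0.
pose Gs := cone (10 / 11 * rat) (11 / 10 * rat).
exists (box x0 r), Gs; split.
- by split; [apply/nbhs_boxP; exists r|exact: measurable_box].
- apply: conical_cone; apply: in_cone_ratio => //; lra.
have mU := measurable_box x0 r; have mG := @measurable_cone R (10 / 11 * rat) (11 / 10 * rat).
apply: (@wavelet_energyD _ s psi f h q (box x0 r) Gs) => //.
- by move=> y; rewrite /q addrC subrK.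
- by move=> xi [].
- apply: (wavelet_energy_of_fourier hpsi hsupp ih s0 mU mG
    (@measurable_cone R (1 / 5 * rat) (5 * rat))).
  + by move=> xi [].
  + by move=> xi eta hxi; exact: cone_pm.
  + by move: hE; rewrite Gamma_psiE.
- apply: wavelet_energy_loc => //.
  + by rewrite mulr_gt0//; lra.
  + by rewrite mulr_gt0//; lra.
  + by move=> y /hr hy; rewrite /q hy mul1r subrr.
Qed.

End Cutoff.

(** * Bump functions *)


Section Smooth1.
Context {R : realType}.
Implicit Types k l : R -> R.

Fixpoint diffn (n : nat) (k : R -> R) : Prop :=
  if n is m.+1 then exists2 k' : R -> R, (forall x : R, is_derive x 1 k (k' x)) & diffn m k'
  else True.

Definition smooth1 k := forall n, diffn n k.

Lemma diffnS n k : diffn n.+1 k -> diffn n k.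
Proof. by elim: n k => // n IHn k [k' dk /IHn hk]; exists k'. Qed.

Lemma diffn_cst n c : diffn n (fun=> c).
Proof. by elim: n c => // n IHn c; exists (fun=> 0) => // x; exact: is_derive_cst. Qed.

Lemma diffnD n k l : diffn n k -> diffn n l -> diffn n (fun x => k x + l x).
Proof.
elim: n k l => // n IHn k l [k' dk hk] [l' dl hl]; exists (fun x => k' x + l' x).
  by move=> x; have := dk x; have := dl x => *; exact: is_deriveD.
exact: IHn.
Qed.

Lemma diffnM n k l : diffn n k -> diffn n l -> diffn n (fun x => k x * l x).
Proof.
elim: n k l => // n IHn k l hk hl; case: (hk) => k' dk hk'; case: (hl) => l' dl hl'.
exists (fun x => k x * l' x + l x * k' x).
  by move=> x; have := dk x; have := dl x => *; exact: is_deriveM.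
by apply: diffnD; apply: IHn => //; exact: diffnS.
Qed.

Lemma diffnN n k : diffn n k -> diffn n (fun x => - k x).
Proof.
move=> hk; rewrite (_ : (fun x => _) = fun x => (-1) * k x).
  by apply: diffnM => //; exact: diffn_cst.
by apply/funext => x; rewrite mulN1r.
Qed.

Lemma diffnV n k : (forall x, k x != 0) -> diffn n k -> diffn n (fun x => (k x)^-1).
Proof.
move=> k0; elim: n => // n IHn hk; case: (hk) => k' dk hk'.
exists (fun x => - ((k x)^-1 * (k x)^-1) * k' x).
  move=> x; have dkx := dk x; apply: (is_derive_eq (is_deriveV (k0 x) dkx)).
  by rewrite -exprVn expr2.
have hV := IHn (diffnS hk).
by apply: diffnM => //; apply: diffnN; exact: diffnM.
Qed.

Lemma diffn_affine n k (a b : R) : diffn n k -> diffn n (fun x => k (a * x + b)).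
Proof.
elim: n k => // n IHn k [k' dk hk]; exists (fun x => k' (a * x + b) * a).
  move=> x; have dkx := dk (a * x + b).
  have da : is_derive x 1 (fun y : R => a * y + b) a.
    by apply: is_derive_eq; rewrite addr0 /GRing.scale/= mulr1.
  exact: (is_derive1_comp (f := k) (g := fun y => a * y + b)).
by apply: diffnM; [exact: IHn|exact: diffn_cst].
Qed.

Definition flat (j : nat) (x : R) : R := if 0 < x then x ^- j * expR (- x^-1) else 0.

Lemma flat_ge0 j x : 0 <= flat j x.
Proof.
rewrite /flat; by case: ifPn => // x0; rewrite mulr_ge0 ?expR_ge0// invr_ge0 exprn_ge0// ltW.
Qed.

Lemma flat_le j : exists2 C : R, 0 <= C & forall x, flat j x <= C * `|x|.
Proof.
exists (j.+1`!)%:R => // x; rewrite /flat; case: ifPn => [x0|_]; last by rewrite mulr_ge0.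
rewrite gtr0_norm// expRN ler_pdivrMr ?expR_gt0//.
have := @expR_ge1Dxn R x^-1 j; rewrite invr_ge0 (ltW x0) => /(_ isT) h.
have fj : 0 < (j.+1`!)%:R :> R by rewrite ltr0n fact_gt0.
have : (j.+1`!)%:R * x * (x^-1 ^+ j.+1 / (j.+1`!)%:R) <= (j.+1`!)%:R * x * expR x^-1.
  by rewrite ler_pM2l ?mulr_gt0//; lra.
apply: le_trans; rewrite exprVn exprS le_eqVlt; apply/orP; left; apply/eqP.
have xj : x ^+ j != 0 by rewrite expf_neq0// gt_eqF.
by move: (x ^+ j) xj => u u0; field; rewrite u0 !gt_eqF.
Qed.

Lemma flat_gt0 j x : 0 < x -> flat j x = x ^- j * expR (- x^-1).
Proof. by rewrite /flat => ->. Qed.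


Lemma is_derive_near (k l : R -> R) (x a : R) : {near x, k =1 l} ->
  is_derive x 1 k a -> is_derive x 1 l a.
Proof.
move=> kl [dk <-]; apply: DeriveDef; first exact: near_eq_derivable dk.
by rewrite -(near_eq_derive _ kl).
Qed.

Lemma is_derive_flat (j : nat) (x : R) :
  is_derive x 1 (flat j) (- j%:R * flat j.+1 x + flat j.+2 x).
Proof.
have [x0|x0|<-] := ltgtP 0 x.
- have hn : {near x, (fun y : R => (y^-1) ^+ j * expR (- y^-1)) =1 flat j}.
    by near=> y; rewrite flat_gt0 ?exprVn//; near: y; exact: lt_nbhsr.
  apply: (is_derive_near hn).
  have dV : is_derive x 1 (fun y : R => y^-1) (- x ^- 2).
    by apply: (is_derive_eq (is_deriveV (f := id) (lt0r_neq0 x0) (is_derive_id x 1))); rewrite /GRing.scale/= mulr1.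
  have dN : is_derive x 1 (fun y : R => - y^-1) (x ^- 2).
    by apply: (is_derive_eq (is_deriveN dV)); rewrite opprK.
  have dE : is_derive x 1 (fun y : R => expR (- y^-1)) (expR (- x^-1) * x ^- 2).
    exact: (is_derive1_comp (f := expR) (g := fun y : R => - y^-1)).
  have dX : is_derive x 1 (fun y : R => (y^-1) ^+ j) (j%:R * x^-1 ^+ j.-1 * (- x ^- 2)).
    have -> : (fun y : R => (y^-1) ^+ j) = (fun y : R => y^-1) ^+ j.
      by apply/funext => y; rewrite exprfctE.
    exact: is_deriveX.
  apply: (is_derive_eq (is_deriveM dX dE)).
  rewrite /GRing.scale/= !flat_gt0// -!exprVn.
  case: j {hn dX} => [|j]; rewrite ?expr0/= !exprS ?mulNrn; move: (x^-1) => u; move: (expR _) => e; ring.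
- have hn : {near x, (fun y : R => 0) =1 flat j}.
    by near=> y; rewrite /flat ifF//; apply/negbTE; rewrite -leNgt ltW//; near: y; exact: lt_nbhsl.
  apply: (is_derive_near hn).
  by rewrite /flat ltNge (ltW x0)/= mulr0 addr0; exact: is_derive_cst.
- rewrite {2 3}/flat ltxx mulr0 addr0.
  have [C C0 hC] := flat_le j.+1.
  have h : (fun h : R => h^-1 *: ((flat j \o shift 0) (h *: (1 : R)) - flat j 0)) @ 0^' --> (0 : R).
    rewrite (_ : (fun h : R => _) = flat j.+1); last first.
      apply/funext => h; rewrite /= /GRing.scale/= mulr1 addr0 {2}/flat ltxx subr0.
      rewrite /flat; case: ifPn => _; last by rewrite mulr0.
      by rewrite mulrA -exprVn -exprS exprVn.
    apply: cvg_within_filter.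
    apply: (@squeeze_cvgr _ _ _ _ (fun=> 0) (fun h => C * `|h|)).
    + by near=> h; rewrite flat_ge0 hC.
    + exact: cvg_cst.
    + rewrite -[X in _ --> X](mulr0 C) -{2}(normr0 R); apply: cvgMr; apply: cvg_norm; exact: cvg_id.
  apply: DeriveDef; first by apply/cvg_ex; exists 0.
  by apply: cvg_lim => //; exact: Rhausdorff.
Unshelve. all: by end_near. Qed.

End Smooth1.

Section Bump1.
Context {R : realType}.

Lemma smooth1_derive (k : R -> R) : smooth1 k ->
  exists2 k' : R -> R, (forall x : R, is_derive x 1 k (k' x)) & smooth1 k'.
Proof.
move=> sk; have [k' dk _] := sk 1%N; exists k' => // n.
have [k2 dk2] := sk n.+1; suff -> : k2 = k' by [].
by apply/funext => x; have [_ <-] := dk x; have [_ <-] := dk2 x.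
Qed.

Lemma is_derive_continuous (k k' : R -> R) : (forall x : R, is_derive x 1 k (k' x)) ->
  continuous k.
Proof.
by move=> dk x; apply/differentiable_continuous/derivable1_diffP; have [] := dk x.
Qed.

Lemma smooth1_continuous (k : R -> R) : smooth1 k -> continuous k.
Proof. by move=> /smooth1_derive[k' dk _]; exact: is_derive_continuous dk. Qed.

Lemma smooth1_flat (j : nat) : smooth1 (@flat R j).
Proof.
move=> n; elim: n j => // n IHn j; exists (fun x => - j%:R * flat j.+1 x + flat j.+2 x).
  exact: is_derive_flat.
by apply: diffnD => //; apply: diffnM => //; exact: diffn_cst.
Qed.

Lemma flat0_gt0 (x : R) : 0 < x -> 0 < flat 0 x.
Proof. by move=> x0; rewrite flat_gt0// expr0 invr1 mul1r expR_gt0. Qed.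

Lemma flat0_eq0 (x : R) : x <= 0 -> flat 0 x = 0.
Proof. by move=> x0; rewrite /flat ltNge x0. Qed.

Lemma flat_den (x : R) : 0 < flat 0 x + flat 0 (1 - x).
Proof.
have [x0|x0] := ltP 0 x; first by rewrite ltr_pwDl ?flat0_gt0 ?flat_ge0.
by rewrite ltr_wpDl ?flat_ge0// flat0_gt0//; lra.
Qed.

Definition ramp (x : R) := flat 0 x * (flat 0 x + flat 0 (1 - x))^-1.

Lemma smooth1_ramp : smooth1 ramp.
Proof.
have f1 : smooth1 (fun x : R => flat 0 (1 - x)).
  move=> n; have -> : (fun x : R => flat 0 (1 - x)) = fun x => flat 0 ((-1) * x + 1).
    by apply/funext => x; congr flat; ring.
  by apply: diffn_affine; exact: smooth1_flat.
move=> n; apply: diffnM; first exact: smooth1_flat.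
apply: diffnV; first by move=> x; rewrite gt_eqF// flat_den.
by apply: diffnD; [exact: smooth1_flat|exact: f1].
Qed.

Lemma ramp_eq0 x : x <= 0 -> ramp x = 0.
Proof. by move=> x0; rewrite /ramp flat0_eq0// mul0r. Qed.

Lemma ramp_eq1 x : 1 <= x -> ramp x = 1.
Proof.
move=> x1; rewrite /ramp (@flat0_eq0 (1 - x)) ?addr0; last by lra.
by rewrite divff// gt_eqF// flat0_gt0//; lra.
Qed.

Lemma bump1 (x0 r : R) : 0 < r -> exists k : R -> R,
  [/\ smooth1 k, forall y, r <= `|x0 - y| -> k y = 0 & forall y, `|x0 - y| <= r / 2 -> k y = 1].
Proof.
move=> r0; exists (fun y => ramp (- (2 / r) * y + (2 + 2 / r * x0)) * ramp (2 / r * y + (2 - 2 / r * x0))).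
have e1 y : - (2 / r) * y + (2 + 2 / r * x0) = 2 / r * (r + (x0 - y)) by field; rewrite gt_eqF.
have e2 y : 2 / r * y + (2 - 2 / r * x0) = 2 / r * (r - (x0 - y)) by field; rewrite gt_eqF.
have c0 : 0 < 2 / r by rewrite divr_gt0.
split.
- by move=> n; apply: diffnM; apply: diffn_affine; exact: smooth1_ramp.
- move=> y; rewrite e1 e2 ler_normr => /orP[h|h].
  + by rewrite [X in _ * X]ramp_eq0 ?mulr0// pmulr_rle0//; lra.
  + by rewrite ramp_eq0 ?mul0r// pmulr_rle0//; lra.
- move=> y; rewrite e1 e2 ler_norml => /andP[h1 h2].
  have e3 : 2 / r * (r / 2) = 1 by field; rewrite gt_eqF.
  have g u : r / 2 <= u -> 1 <= 2 / r * u by move=> hu; rewrite -[leLHS]e3 ler_pM2l.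
  by rewrite !ramp_eq1 ?mulr1//; apply: g; lra.
Qed.

End Bump1.

Section ProductSmooth.
Context {R : realType}.

Lemma is_derive_prod (k k' l l' : R -> R) (b : bool) (x : R * R) :
  (forall x : R, is_derive x 1 k (k' x)) -> (forall x : R, is_derive x 1 l (l' x)) ->
  is_derive x (basis2 b) (fun y : R * R => k y.1 * l y.2)
    (if b then k x.1 * l' x.2 else k' x.1 * l x.2).
Proof.
move=> dk dl.
have h : (fun h : R => h^-1 *: (((fun y : R * R => k y.1 * l y.2) \o shift x) (h *: basis2 b) - k x.1 * l x.2))
    @ 0^' --> (if b then k x.1 * l' x.2 else k' x.1 * l x.2).
  case: b.
  - have [/cvg_ex[/= m hm] hl] := dl x.2.
    have em : m = l' x.2 by rewrite -hl; apply/esym/cvg_lim => //; exact: Rhausdorff.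
    rewrite (_ : (fun h : R => _) = fun h => k x.1 * (h^-1 *: ((l \o shift x.2) (h *: (1 : R)) - l x.2))).
      by apply: cvgMr; rewrite -em.
    by apply/funext => h; rewrite /= /GRing.scale/= mulr0 add0r; ring.
  - have [/cvg_ex[/= m hm] hl] := dk x.1.
    have em : m = k' x.1 by rewrite -hl; apply/esym/cvg_lim => //; exact: Rhausdorff.
    rewrite (_ : (fun h : R => _) = fun h => (h^-1 *: ((k \o shift x.1) (h *: (1 : R)) - k x.1)) * l x.2).
      by apply: cvgMl; rewrite -em.
    by apply/funext => h; rewrite /= /GRing.scale/= mulr0 add0r; ring.
apply: DeriveDef; first by apply/cvg_ex; eexists; exact: h.
by apply: cvg_lim => //; exact: Rhausdorff.
Qed.

Lemma smooth_prod (k l : R -> R) : smooth1 k -> smooth1 l ->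
  smooth (fun x : R * R => k x.1 * l x.2).
Proof.
move=> sk sl w.
have [k2 [l2 [sk2 sl2 ->]]] : exists k2 l2 : R -> R, [/\ smooth1 k2, smooth1 l2 &
    iter_partial w (fun x : R * R => k x.1 * l x.2) = fun x => k2 x.1 * l2 x.2].
  elim: w => [|b w [k2 [l2 [/smooth1_derive[k' dk sk'] /smooth1_derive[l' dl sl'] e]]]].
    by exists k, l.
  have s2 : smooth1 k2 by move=> n; apply: diffnS; exists k'.
  have s3 : smooth1 l2 by move=> n; apply: diffnS; exists l'.
  exists (if b then k2 else k'), (if b then l' else l2); split; [by case: b..|].
  rewrite /= -/(iter_partial w _) e; apply/funext => x.
  by have [_ ->] := is_derive_prod b x dk dl; case: b.
split.
- have c1 := smooth1_continuous sk2; have c2 := smooth1_continuous sl2.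
  move=> x; apply: (@cvgM _ _ _ _ (fun y : R * R => k2 y.1) (fun y => l2 y.2)).
  + by apply: (@cvg_comp _ _ _ fst k2); [case: x => ? ?; exact: cvg_fst|exact: c1].
  + by apply: (@cvg_comp _ _ _ snd l2); [case: x => ? ?; exact: cvg_snd|exact: c2].
- move=> b x.
  have [k' dk _] := smooth1_derive sk2; have [l' dl _] := smooth1_derive sl2.
  by have [] := is_derive_prod b x dk dl.
Qed.

Lemma cutoff_prod (k l : R -> R) (x0 : R * R) (r : R) : 0 < r -> smooth1 k -> smooth1 l ->
  (forall y, r <= `|x0.1 - y| -> k y = 0) -> (forall y, r <= `|x0.2 - y| -> l y = 0) ->
  (forall y, `|x0.1 - y| <= r / 2 -> k y = 1) -> (forall y, `|x0.2 - y| <= r / 2 -> l y = 1) ->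
  cutoff_at x0 (fun x => (k x.1 * l x.2)%:C).
Proof.
move=> r0 sk sl k0 l0 k1 l1; split; last first.
  apply/nbhs_boxP; exists (r / 2); first by rewrite divr_gt0.
  by move=> y [h1 h2]; rewrite k1 ?l1 ?mulr1// ltW.
split; first split.
- exact: smooth_prod.
- have -> : Im \o (fun x : R * R => (k x.1 * l x.2)%:C) = fun x => (fun=> 0 : R) x.1 * (fun=> 0 : R) x.2.
    by apply/funext => x /=; rewrite mulr0.
  by apply: (@smooth_prod (fun=> 0) (fun=> 0)) => n; exact: diffn_cst.
- have H : hausdorff_space (R * R)%type by exact: norm_hausdorff.
  have cK := compact_setX (@segment_compact _ (x0.1 - r) (x0.1 + r)) (@segment_compact _ (x0.2 - r) (x0.2 + r)).
  rewrite /supp -precompactE; apply: (precompact_subset _ (compact_precompact H cK)).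
  move=> y /= h; have [h1|h1] := leP r `|x0.1 - y.1|; first by rewrite k0// mul0r eqxx in h.
  have [h2|h2] := leP r `|x0.2 - y.2|; first by rewrite l0// mulr0 eqxx in h.
  by move: h1 h2; rewrite !ltr_norml => /andP[? ?] /andP[? ?]; split; rewrite /= in_itv/=; apply/andP; split; lra.
Qed.

End ProductSmooth.

Section FourierDecay1.
Context {R : realType}.
Local Notation mu := (@lebesgue_measure R).
Local Notation mR := (measurableTypeR R).

Lemma continuous_patch_bound (k : R -> R) (L : R) : continuous k ->
  (forall x, L < `|x| -> k x = 0) -> exists2 C, 0 <= C & forall x, `|k x| <= C * (2 / (1 + x ^+ 2)).
Proof.
move=> ck k0.
have cK : compact (k @` `[- L, L]).
  by apply: continuous_compact; [exact: continuous_subspaceT|exact: segment_compact].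
have [M [_ hM]] := compact_bounded cK.
exists ((`|M| + 1) * (1 + L ^+ 2)); first by rewrite mulr_ge0 ?addr_ge0// sqr_ge0.
have M1 : 0 <= `|M| + 1 by rewrite addr_ge0.
move=> x; have x2 := sqr_ge0 x; have [h|h] := leP `|x| L; last first.
  by rewrite k0// normr0 mulr_ge0 ?mulr_ge0 ?addr_ge0 ?sqr_ge0// invr_ge0; lra.
apply: (@le_trans _ _ (`|M| + 1)).
  apply: (hM (`|M| + 1)); first by rewrite (le_lt_trans (ler_norm M))// ltrDl.
  by exists x => //; rewrite /= in_itv/= -ler_norml.
rewrite -mulrA ler_peMr// mulrA ler_pdivlMr; last by lra.
have : x ^+ 2 <= L ^+ 2 by rewrite -(real_normK (num_real x)) lerXn2r// nnegrE (le_trans _ h).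
by lra.
Qed.

Lemma continuous_mR (k : R -> R) : continuous k -> measurable_fun setT (k : mR -> mR).
Proof. by move=> ck; exact: continuous_measurable_fun. Qed.

Lemma cintegrable_patch (k : R -> R) (L z : R) : continuous k ->
  (forall x, L < `|x| -> k x = 0) -> cintegrable mu (fun x => (k x)%:C * cexp (x * z)).
Proof.
move=> ck k0; have [C C0 hC] := continuous_patch_bound ck k0.
apply: (@cintegrable_le _ _ _ _ _ (fun x : mR => C * (2 / (1 + x ^+ 2)))).
- apply: cmeasM; first by apply: cmeas_re; exact: continuous_mR.
  apply: cmeas_cexp; apply: continuous_mR => x.
  by apply: cvgM; [exact: cvg_id|exact: cvg_cst].
- exact: (measurable_funM (measurable_cst _) measurable_p1).
- by move=> x; rewrite ncM nc_cexp mulr1 ncC.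
- have mV := continuous_mR (@continuous_oneDsqrV R).
  have V0 (x : R) : 0 <= (1 + x ^+ 2)^-1 by rewrite invr_ge0 addr_ge0// sqr_ge0.
  rewrite intEZ//; [|exact: measurable_p1|by move=> x; rewrite mulr_ge0].
  by rewrite intEZ// integral_oneDsqrV -!EFinM ltry.
Qed.

Lemma integral_derive_patch (G g : R -> R) (L : R) : (forall x : R, is_derive x 1 G (g x)) ->
  continuous g -> (forall x, L < `|x| -> G x = 0) -> Rintegral mu setT g = 0.
Proof.
move=> dG cg G0; pose K := `|L| + 1.
have LK : L < K by rewrite (le_lt_trans (ler_norm L))// ltrDl.
have K0 : 0 < K by rewrite ltr_pwDr.
have g0 x : K < `|x| -> g x = 0.
  move=> h; have [_ <-] := dG x.
  have hn : {near x, G =1 (fun=> 0)}.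
    near=> y; apply: G0; near: y.
    exact: (@cvgr_norm_gt _ _ _ _ _ id x cvg_id _ (lt_trans LK h)).
  by rewrite (near_eq_derive _ hn) derive_cst.
have cG := is_derive_continuous dG.
have e : (\int[mu]_(x in `[(- K)%R, K]) (g x)%:E = (G K)%:E - (G (- K))%:E)%E.
  apply: continuous_FTC2.
  - by rewrite gtrN.
  - exact: continuous_subspaceT.
  - split; first by move=> x _; have [] := dG x.
    + exact/cvg_at_right_filter/cG.
    + exact/cvg_at_left_filter/cG.
  - by move=> x _; rewrite derive1E; have [_] := dG x.
rewrite /Rintegral (_ : (\int[mu]_x (g x)%:E = 0)%E)//.
rewrite !G0 ?normrN ?gtr0_norm// subee// in e.
rewrite -e [RHS]integral_mkcond; apply: eq_integral => x _.
rewrite patchE; case: ifPn => //; rewrite notin_setE/= in_itv/= => /negP.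
by rewrite -ler_norml -ltNge => /g0 ->.
Unshelve. all: by end_near. Qed.

Lemma fourier_derive (k k' : R -> R) (L z : R) : (forall x : R, is_derive x 1 k (k' x)) ->
  continuous k' -> (forall x, L < `|x| -> k x = 0) -> (forall x, L < `|x| -> k' x = 0) ->
  nc (cint mu (fun x => (k x)%:C * cexp (x * z))) * `|z| =
  nc (cint mu (fun x => (k' x)%:C * cexp (x * z))).
Proof.
move=> dk ck' k0 k'0; have ck := is_derive_continuous dk.
have i1 := cintegrable_patch z ck k0; have i2 := cintegrable_patch z ck' k'0.
have dz (x : R) : is_derive x 1 (fun x : R => x * z) z.
  by apply: is_derive_eq; rewrite /GRing.scale/= mulr0 add0r mulr1.
have dc (x : R) : is_derive x 1 (fun x : R => cos (x * z)) (- sin (x * z) * z).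
  exact: (is_derive1_comp (f := cos) (g := fun x : R => x * z)).
have ds (x : R) : is_derive x 1 (fun x : R => sin (x * z)) (cos (x * z) * z).
  exact: (is_derive1_comp (f := sin) (g := fun x : R => x * z)).
have cc := is_derive_continuous dc; have cs := is_derive_continuous ds.
have e : cint mu (fun x => (k' x)%:C * cexp (x * z)) +
         (0 -i* z) * cint mu (fun x => (k x)%:C * cexp (x * z)) = 0.
  rewrite -cintZ// -cintD//; last exact: cintegrableZ.
  apply: complexP => /=.
  - rewrite (_ : _ \o _ = fun x => k x * (- sin (x * z) * z) + cos (x * z) * k' x).
      apply: (integral_derive_patch (G := fun x => k x * cos (x * z)) (L := L)).
      + by move=> x; have := dk x; have := dc x => *; exact: is_deriveM.
      + move=> x; apply: cvgD; apply: cvgM; [exact: ck| |exact: cc|exact: ck'].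
        by apply: cvgM; [apply: cvgN; exact: cs|exact: cvg_cst].
      + by move=> x /k0 ->; rewrite mul0r.
    by apply/funext => x /=; ring.
  - rewrite (_ : _ \o _ = fun x => k x * - (cos (x * z) * z) + (- sin (x * z)) * k' x).
      apply: (integral_derive_patch (G := fun x => k x * - sin (x * z)) (L := L)).
      + move=> x; have := dk x; have := ds x => ? ?; apply: is_deriveM.
      + move=> x; apply: cvgD; apply: cvgM; [exact: ck| |apply: cvgN; exact: cs|exact: ck'].
        by apply: cvgN; apply: cvgM; [exact: cc|exact: cvg_cst].
      + by move=> x /k0 ->; rewrite mul0r.
    by apply/funext => x /=; ring.
move/eqP: e; rewrite addr_eq0 => /eqP ->; rewrite ncN ncM mulrC; congr (_ * _).
by rewrite nc_def/= expr0n add0r sqrrN sqrtr_sqr.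
Qed.

Lemma fourier_decay1 (k : R -> R) (L : R) (N : nat) : smooth1 k -> (forall x, L < `|x| -> k x = 0) ->
  exists2 C, 0 <= C & forall z, nc (cint mu (fun x => (k x)%:C * cexp (x * z))) * `|z| ^+ N <= C.
Proof.
elim: N k => [|N IHN] k sk k0.
  have ck := smooth1_continuous sk.
  have [C C0 hC] := continuous_patch_bound ck k0.
  have mk : measurable_fun setT (k : mR -> mR) by exact: continuous_mR.
  have ik : (\int[mu]_x (`|k x|)%:E < +oo)%E.
    have [_] := cintegrable_patch 0 ck k0; apply: le_lt_trans; apply: le_intE => //.
    - exact: measurableT_comp.
    - exact: (cmeas_nc (cintegrable_patch 0 ck k0).1).
    - by move=> x; rewrite ncM nc_cexp mulr1 ncC.
  exists (2 * fine (\int[mu]_x (`|k x|)%:E)%E).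
    by rewrite mulr_ge0// fine_ge0// intE_ge0.
  move=> z; rewrite expr0 mulr1 -lee_fin EFinM fineK; last first.
    by rewrite ge0_fin_numE ?intE_ge0.
  have h := nc_cint mu (cintegrable_patch z ck k0).1.
  apply: (le_trans h).
  rewrite lee_pmul2l ?lte_fin//; apply: le_intE.
  - exact: (cmeas_nc (cintegrable_patch z ck k0).1).
  - exact: measurableT_comp.
  - by move=> x; exact: nc_ge0.
  - by move=> x; rewrite ncM nc_cexp mulr1 ncC.
have [k' dk sk'] := smooth1_derive sk.
have k'0 x : L < `|x| -> k' x = 0.
  move=> h; have [_ <-] := dk x.
  have hn : {near x, k =1 (fun=> 0)}.
    by near=> y; apply: k0; near: y; exact: (@cvgr_norm_gt _ _ _ _ _ id x cvg_id _ h).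
  by rewrite (near_eq_derive _ hn) derive_cst.
have [C C0 hC] := IHN k' sk' k'0; exists C => // z.
rewrite exprS mulrA (fourier_derive z dk _ k0 k'0)//; exact: smooth1_continuous.
Unshelve. all: by end_near. Qed.

End FourierDecay1.

Section Bump2.
Context {R : realType}.
Local Notation mu := (@lebesgue_measure R).
Local Notation mR := (measurableTypeR R).
Local Notation R2 := (measurableTypeR R * measurableTypeR R)%type.

Lemma le_pk_jap (a C : R) (N : nat) z : 0 <= a -> a * jap z ^+ (N + 2) <= C ->
  a <= C * pk z / jap z ^+ N.
Proof.
move=> a0 h; have j0 := jap_gt0 z; have pj := pk_ge z; have p0 := pk_gt0 z.
have jN := exprn_gt0 N j0; have jN2 := exprn_gt0 (N + 2) j0.
have C0 : 0 <= C by apply: le_trans h; rewrite mulr_ge0// ltW.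
rewrite ler_pdivlMr//.
rewrite -(ler_pM2r (exprn_gt0 2 j0)) -mulrA -exprD; apply: (le_trans h).
by rewrite -mulrA ler_peMr//; lra.
Qed.

Lemma fourier_prod (k l : R -> R) (L : R) (t : R * R) : continuous k -> continuous l ->
  (forall x, L < `|x| -> k x = 0) -> (forall x, L < `|x| -> l x = 0) ->
  cintegrable (leb2 : set R2 -> \bar R) (fun x : R2 => (k x.1 * l x.2)%:C * cexp (dot x t)) /\
  fourier (fun x => (k x.1 * l x.2)%:C) t =
  cint mu (fun x => (k x)%:C * cexp (x * t.1)) * cint mu (fun x => (l x)%:C * cexp (x * t.2)).
Proof.
move=> ck cl k0 l0.
have i1 := cintegrable_patch t.1 ck k0; have i2 := cintegrable_patch t.2 cl l0.
have [C C0 hC] := continuous_patch_bound ck k0; have [D D0 hD] := continuous_patch_bound cl l0.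
pose G (x y : mR) := ((k x)%:C * cexp (x * t.1)) * ((l y)%:C * cexp (y * t.2)).
have eG (x : R2) : (k x.1 * l x.2)%:C * cexp (dot x t) = G x.1 x.2.
  rewrite /G /dot cexpD (_ : (k x.1 * l x.2)%:C = (k x.1)%:C * (l x.2)%:C) ?rmorphM//.
  by move: (cexp _) (cexp _) (_%:C) (_%:C) => a b c d; ring.
have mG : cmeas (fun x : R2 => G x.1 x.2).
  by apply: cmeasM; [exact: (cmeas_comp i1.1 measurable_fst)|exact: (cmeas_comp i2.1 measurable_snd)].
have iG : cintegrable (leb2 : set R2 -> \bar R) (fun x : R2 => G x.1 x.2).
  apply: (@cintegrable_le _ _ _ _ _ (fun x : R2 => (C * D) * pk x)) => //.
  - exact: (measurable_funM (measurable_cst _) measurable_pk).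
  - move=> x; rewrite /G !ncM !nc_cexp !mulr1 !ncC /pk.
    rewrite (_ : forall a b c d : R, a * b * (c * d) = a * c * (b * d)); last by move=> *; ring.
    by apply: ler_pM.
  - rewrite intEZ ?integral_pk ?mulr_ge0//; first exact: ltry.
    + exact: measurable_pk.
    + by move=> x; exact/ltW/pk_gt0.
split.
  by rewrite (_ : (fun x : R2 => _) = fun x : R2 => G x.1 x.2)//; apply/funext.
rewrite fourierE (eq_cint _ eG) (cint_prod iG) mulrC -cintZ//.
apply: eq_cint => x; rewrite /G cintZ//; exact: mulrC.
Qed.

Lemma bump (x0 : R * R) (r : R) : 0 < r -> exists phi : R * R -> R[i],
  [/\ cutoff_at x0 phi, forall x, ~ box x0 r x -> phi x = 0 &
    forall N, exists2 C, 0 <= C & forall z, nc (fourier phi z) <= C * pk z / jap z ^+ N].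
Proof.
move=> r0; have [k [sk k0 k1]] := bump1 x0.1 r0; have [l [sl l0 l1]] := bump1 x0.2 r0.
exists (fun x => (k x.1 * l x.2)%:C); split.
- exact: cutoff_prod r0 sk sl k0 l0 k1 l1.
- move=> x nb; have [h1|h1] := leP r `|x0.1 - x.1|; first by rewrite k0// mul0r.
  by have [h2|h2] := leP r `|x0.2 - x.2|; [rewrite l0// mulr0|case: nb].
move=> N; pose L := `|x0.1| + `|x0.2| + r.
have far (a : R) x : `|a| <= `|x0.1| + `|x0.2| -> L < `|x| -> r <= `|a - x|.
  move=> h1 h2; have := ler_normD (x - a) a; rewrite subrK distrC.
  by move: h2; rewrite /L; lra.
have kL x : L < `|x| -> k x = 0 by move=> h; apply/k0/far => //; rewrite lerDl.
have lL x : L < `|x| -> l x = 0 by move=> h; apply/l0/far => //; rewrite lerDr.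
have ck := smooth1_continuous sk; have cl := smooth1_continuous sl.
have [A A0 hA] := fourier_decay1 0 sk kL; have [B B0 hB] := fourier_decay1 0 sl lL.
have [A' A0' hA'] := fourier_decay1 (2 * (N + 2)) sk kL.
have [B' B0' hB'] := fourier_decay1 (2 * (N + 2)) sl lL.
exists (3 ^+ (N + 2) * (A * B + (A' * B + A * B'))).
  by rewrite mulr_ge0 ?exprn_ge0// addr_ge0 ?addr_ge0 ?mulr_ge0.
move=> z; apply: le_pk_jap; first exact: nc_ge0.
rewrite (fourier_prod z ck cl kL lL).2 ncM.
have := hA z.1; have := hB z.2; have := hA' z.1; have := hB' z.2.
rewrite !expr0 !mulr1; have := nc_ge0 (cint mu (fun x => (k x)%:C * cexp (x * z.1))).
have := nc_ge0 (cint mu (fun x => (l x)%:C * cexp (x * z.2))).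
move: (nc _) (nc _) => u v v0 u0 h1 h2 h3 h4.
apply: (@le_trans _ _ (u * v * (3 ^+ (N + 2) * (1 + (z.1 ^+ (2 * (N + 2)) + z.2 ^+ (2 * (N + 2))))))).
  by apply: ler_wpM2l; [exact: mulr_ge0|exact: jap_expn_le].
rewrite !exprM -!(real_normK (num_real z.1)) -!(real_normK (num_real z.2)) -!exprM.
have := exprn_ge0 (2 * (N + 2)) (normr_ge0 z.1); have := exprn_ge0 (2 * (N + 2)) (normr_ge0 z.2).
move: h1 h2; move: (`|z.1| ^+ _) (`|z.2| ^+ _) => p q h1 h2 q0 p0.
rewrite mulrCA ler_wpM2l ?exprn_ge0//.
have -> : u * v * (1 + (p + q)) = u * v + ((u * p) * v + u * (v * q)) by ring.
by rewrite lerD ?ler_pM// lerD//; apply: ler_pM => //; exact: mulr_ge0.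
Qed.

End Bump2.

(** * Averaging the multiplier over the frequencies *)


Section Averaging.
Context {R : realType}.
Local Notation R2 := (measurableTypeR R * measurableTypeR R)%type.
Local Notation mR := (measurableTypeR R).

Lemma measurable_inv : measurable_fun setT (fun x : mR => x^-1 : mR).
Proof.
rewrite (_ : (fun _ => _) = fun x : mR => x * (x ^+ 2) `^ (-1)).
  apply: measurable_funM => //.
  by apply: (measurableT_comp (measurable_powR (-1))); exact: measurable_funX.
apply/funext => x; rewrite powR_inv1 ?sqr_ge0//.
have [->|x0] := eqVneq x 0; first by rewrite invr0 mul0r.
by rewrite expr2 invfM mulrA divff// mul1r.
Qed.

Definition pdiv (s x : R * R) : R * R := (s.1 / x.1, s.2 / x.2).

Lemma measurable_pdiv d (T : measurableType d) (u v : T -> R2) :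
  measurable_fun setT u -> measurable_fun setT v ->
  measurable_fun setT (fun x => pdiv (u x) (v x) : R2).
Proof.
move=> mu' mv; apply: measurable_fun_pair; apply: measurable_funM.
- exact: measurableT_comp measurable_fst mu'.
- exact: measurableT_comp measurable_inv (measurableT_comp measurable_fst mv).
- exact: measurableT_comp measurable_snd mu'.
- exact: measurableT_comp measurable_inv (measurableT_comp measurable_snd mv).
Qed.

Definition quad : set (R * R) := [set t | 0 < t.1 /\ 0 < t.2].

Lemma measurable_quad : @measurable _ R2 quad.
Proof.
rewrite (_ : quad = [set z : R2 | 0 < z.1 :> R] `&` [set z : R2 | 0 < z.2 :> R]); last first.
  by apply/seteqP; split => z [].
by apply: measurableI; apply: measurable_lt => //; exact: measurable_cst.
Qed.

Definition wq (x : R * R) : R := \1_quad x * (x.1 * x.2)^-1.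

Lemma wq_ge0 x : 0 <= wq x.
Proof.
rewrite /wq indicE; have [h|h] := asboolP (quad x); last by rewrite memNset ?mul0r.
by case: h => h1 h2; rewrite mulr_ge0// invr_ge0 mulr_ge0// ltW.
Qed.

Lemma wqE x : quad x -> wq x = (x.1 * x.2)^-1.
Proof. by move=> h; rewrite /wq indicE mem_set// mul1r. Qed.

Lemma wq_eq0 x : ~ quad x -> wq x = 0.
Proof. by move=> h; rewrite /wq indicE memNset// mul0r. Qed.

Lemma measurable_wq : measurable_fun setT (wq : R2 -> mR).
Proof.
apply: (measurable_funM (measurable_indic2 measurable_quad)).
by apply: (measurableT_comp measurable_inv); apply: measurable_funM.
Qed.

Variable psi : R * R -> R[i].
Hypothesis psi_schwartz : schwartz psi.
Hypothesis psi_supp : supp (fourier psi) `<=` `[1 / 2, 2] `*` `[1 / 2, 2].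

Definition Psi (v eta : R * R) : R[i] := conjc (fourier psi eta) * conjc (cexp (dot v eta)).

Lemma nc_Psi v eta : nc (Psi v eta) = nc (fourier psi eta).
Proof. by rewrite /Psi ncM !ncJ nc_cexp mulr1. Qed.

Lemma cmeas_Psi d (T : measurableType d) (u v : T -> R2) :
  measurable_fun setT u -> measurable_fun setT v -> cmeas (fun x => Psi (u x) (v x)).
Proof.
move=> mu' mv; apply: cmeasM; apply: cmeasJ.
  exact: cmeas_comp (psihat_cmeas psi_schwartz) mv.
by apply: cmeas_cexp; exact: measurable_fun_dot.
Qed.

Definition wker (v s x : R * R) : R[i] := (wq x)%:C * Psi v (pdiv s x).

Lemma cmeas_wker d (T : measurableType d) (u v w : T -> R2) :
  measurable_fun setT u -> measurable_fun setT v -> measurable_fun setT w ->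
  cmeas (fun x => wker (u x) (v x) (w x)).
Proof.
move=> mu' mv mw; apply: cmeasM.
  by apply: cmeas_re; exact: measurableT_comp measurable_wq mw.
by apply: (cmeas_Psi mu' (v := fun x => pdiv (v x) (w x))); exact: measurable_pdiv.
Qed.

Lemma wker_supp v s x : wker v s x != 0 ->
  [/\ quad x, s.1 / 2 <= x.1 <= 2 * s.1 & s.2 / 2 <= x.2 <= 2 * s.2].
Proof.
rewrite /wker; have [[x1 x2]|h] := asboolP (quad x); last by rewrite wq_eq0// mul0r eqxx.
have [h|] := eqVneq (fourier psi (pdiv s x)) 0; first by rewrite /Psi h conjc0 mul0r mulr0 eqxx.
move=> /(psihat_neq0 psi_supp)[] /=.
rewrite !ler_pdivlMr// !ler_pdivrMr// => /andP[h1 h2] /andP[h3 h4] _.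
by split => //; apply/andP; split; lra.
Qed.

Lemma wker_le M v s x : 0 < s.1 -> 0 < s.2 -> (forall t, nc (fourier psi t) <= M) ->
  nc (wker v s x) <= 4 * M / (s.1 * s.2) * \1_(box s (s.1 + s.2)) x.
Proof.
move=> s1 s2 hM; have M0 : 0 <= M by apply: le_trans (hM (0, 0)); exact: nc_ge0.
have ss : 0 < s.1 * s.2 by rewrite mulr_gt0.
have [->|] := eqVneq (wker v s x) 0.
  by rewrite nc0 mulr_ge0// divr_ge0 ?mulr_ge0// ltW.
move=> /wker_supp[[x1 x2] /andP[h1 h2] /andP[h3 h4]].
have -> : \1_(box s (s.1 + s.2)) x = 1 :> R.
  by rewrite indicE mem_set//; split; rewrite ltr_norml; apply/andP; split; lra.
rewrite mulr1 /wker ncM ncC nc_Psi ger0_norm ?wq_ge0// wqE// mulrAC.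
have xx : 0 < x.1 * x.2 by rewrite mulr_gt0.
rewrite ler_pM ?nc_ge0 ?invr_ge0 ?(ltW xx)//.
rewrite ler_pdivlMr// mulrC ler_pdivrMr//.
by nra.
Qed.

Lemma cintegrable_wker v s : 0 < s.1 -> 0 < s.2 -> cintegrable leb2 (wker v s : R2 -> R[i]).
Proof.
move=> s1 s2.
have [M M0 hM] := fourier_bound (schwartz_cintegrable psi_schwartz).
have [m m0 hm] := box_finite s (s.1 + s.2).
have mb := measurable_indic2 (measurable_box s (s.1 + s.2)).
have c0 : 0 <= 4 * M / (s.1 * s.2) by rewrite divr_ge0 ?mulr_ge0// ltW.
apply: (@cintegrable_le _ _ R2 leb2 _ (fun x => 4 * M / (s.1 * s.2) * \1_(box s (s.1 + s.2)) x)).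
- exact: (@cmeas_wker _ R2 (fun=> v) (fun=> s) id).
- exact: (measurable_funM (measurable_cst _) mb).
- by move=> x; exact: wker_le.
- by rewrite (intEZ leb2 c0 mb) ?hm -?EFinM ?ltry// => x; rewrite indicE.
Qed.

Definition avg (v s : R * R) : R[i] := cint leb2 (wker v s : R2 -> R[i]).

Lemma avg_const v s : 0 < s.1 -> 0 < s.2 -> avg v s = avg v (1, 1).
Proof.
move=> s1 s2; have ss : 0 < s.1 * s.2 by rewrite mulr_gt0.
rewrite {1}/avg (@cint_affine2 _ (0, 0) s (wker v s)) ?gt_eqF//; last exact: cintegrable_wker.
rewrite -cintZ; last by apply: (cintegrable_affine2 _ (b := s)); rewrite ?gt_eqF//; exact: cintegrable_wker.
apply: eq_cint => t; rewrite -pm_affine /wker.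
have [[t1 t2]|h] := asboolP (quad t); last first.
  rewrite !wq_eq0 ?mul0r ?mulr0// => -[/= h1 h2]; apply: h.
  by move: h1 h2; rewrite !pmulr_rgt0.
have -> : pdiv s (pm s t) = pdiv (1, 1) t.
  by rewrite /pdiv /pm /=; congr (_, _); field; rewrite !gt_eqF.
rewrite mulrA -rmorphM !wqE//; last by split; rewrite /= mulr_gt0.
congr ((_%:C) * _); rewrite ger0_norm ?(ltW ss)//=; field; rewrite !gt_eqF//.
Qed.

End Averaging.

Section AveragingNonzero.
Context {R : realType}.
Local Notation R2 := (measurableTypeR R * measurableTypeR R)%type.
Local Notation mR := (measurableTypeR R).
Variable psi : R * R -> R[i].
Hypothesis psi_schwartz : schwartz psi.
Hypothesis psi_supp : supp (fourier psi) `<=` `[1 / 2, 2] `*` `[1 / 2, 2].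

Lemma indic1 (A : set (R * R)) x : A x -> \1_A x = 1 :> R.
Proof. by move=> h; rewrite indicE mem_set. Qed.

Lemma indic0 (A : set (R * R)) x : ~ A x -> \1_A x = 0 :> R.
Proof. by move=> h; rewrite indicE memNset. Qed.

Lemma integral_quad_gt0 : (0 < \int[leb2]_x (\1_(@quad R) x : R)%:E)%E.
Proof.
pose A := box ((1, 1) : R * R) 1; have mb : measurable (A : set R2) := measurable_box _ _.
apply: (@lt_le_trans _ _ (\int[leb2]_x (\1_A x : R)%:E)%E).
  rewrite integral_indic// setIT.
  rewrite (_ : A = ball (1 : R) 1 `*` ball (1 : R) 1); last by apply/seteqP; split => y [].
  rewrite [ltRHS](_ : _ = lebesgue_measure (ball (1%R : R) 1%R) * lebesgue_measure (ball (1%R : R) 1%R))%E; last first.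
    exact: (product_measure1E (@lebesgue_measure R) (@lebesgue_measure R) (measurable_ball _ _) (measurable_ball _ _)).
  by rewrite lebesgue_measure_ball// -EFinM lte_fin.
apply: le_intE.
- exact: measurable_indic2.
- exact: (measurable_indic2 (@measurable_quad R)).
- by move=> x; rewrite indicE.
- move=> x; rewrite !indicE; have [h|h] := asboolP (A x); last by rewrite memNset.
  rewrite (mem_set h) mem_set//.
  by move: h => []; rewrite /= !ltr_norml => /andP[? ?] /andP[? ?]; split; lra.
Qed.

Lemma fourier_reflect (p : R * R) :
  cint leb2 (fun v : R2 => psi (affine2 (0, 0) (-1, -1) v) * conjc (cexp (dot v p))) = fourier psi p.
Proof.
have ip := cintegrable_fourier p (schwartz_cintegrable psi_schwartz).
have n1 : (-1 : R) != 0 by rewrite oppr_eq0.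
rewrite fourierE (cint_affine2 (0, 0) (b := (-1, -1)) n1 n1 ip)/= mulrNN mulr1 normr1 mul1r.
apply: eq_cint => v; congr (_ * _); rewrite -[LHS]/(conjc (cexp (dot v p))) -cexpN; congr cexp.
by rewrite /dot /affine2/=; ring.
Qed.

(* Pair [avg] with [v |-> psi (- v)], whose integral against [Psi v] produces
   [|psihat|^2]. *)
Lemma avg_eq0_sq (s : R * R) : quad s -> (forall v, avg psi v s = 0) ->
  (\int[leb2]_x (wq x * nc (fourier psi (pdiv s x)) ^+ 2)%:E = 0)%E.
Proof.
move=> [s1 s2] h0; have ip := schwartz_cintegrable psi_schwartz.
have [M M0 hM] := fourier_bound ip.
have [m m0 hm] := box_finite s (s.1 + s.2).
have mb := measurable_indic2 (measurable_box s (s.1 + s.2)).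
pose C := 4 * M / (s.1 * s.2).
have C0 : 0 <= C by rewrite divr_ge0 ?mulr_ge0// ltW.
pose kk (x : R2) : R := C * \1_(box s (s.1 + s.2)) x.
have mkk : measurable_fun setT (kk : R2 -> mR) by exact: (measurable_funM (measurable_cst _) mb).
have kk0 x : 0 <= kk x by apply: mulr_ge0 => //; rewrite indicE.
have ikk : (\int[leb2]_x (kk x)%:E < +oo)%E.
  by rewrite (intEZ leb2 C0 mb) ?hm -?EFinM ?ltry// => x; rewrite indicE.
have n1 : (-1 : R) != 0 by rewrite oppr_eq0.
pose rp (v : R2) := psi (affine2 (0, 0) (-1, -1) v).
have irp : cintegrable leb2 rp by exact: (cintegrable_affine2 (0, 0) (b := (-1, -1)) n1 n1 ip).
have mp : measurable_fun setT (fun x : R2 => pdiv s x : R2).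
  exact: (@measurable_pdiv _ _ R2 (fun=> s) id).
pose G (v x : R2) := rp v * wker psi v s x.
have mG : cmeas (fun z : R2 * R2 => G z.1 z.2).
  apply: cmeasM; first exact: cmeas_comp irp.1 measurable_fst.
  by apply: (cmeas_wker psi_schwartz (u := fst) (v := fun=> s) (w := snd)).
have e1 : cint leb2 (fun v => cint leb2 (G v)) = 0.
  rewrite -[RHS](cint0 (leb2 : {measure set R2 -> \bar R})); apply: eq_cint => v.
  rewrite /G cintZ; last exact: cintegrable_wker.
  by rewrite -[cint _ _]/(avg psi v s) h0 mulr0.
have e2 := @cint_Fubini_le _ _ _ _ _ leb2 leb2 G (fun v => nc (rp v)) kk mG (cmeas_nc irp.1) mkk
  (fun v => nc_ge0 _) kk0 irp.2 ikk.
rewrite e1 in e2.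
have hG (v x : R2) : nc (G v x) <= nc (rp v) * kk x.
  by rewrite /G ncM ler_wpM2l ?nc_ge0//; exact: wker_le.
have e3 (x : R2) : cint leb2 (G^~ x) = (wq x * nc (fourier psi (pdiv s x)) ^+ 2)%:C.
  rewrite /G (_ : (fun v : R2 => _) = fun v : R2 => ((wq x)%:C * conjc (fourier psi (pdiv s x))) *
     (rp v * conjc (cexp (dot v (pdiv s x))))); last first.
    by apply/funext => v; rewrite /wker /Psi; ring.
  rewrite cintZ.
    by rewrite fourier_reflect -mulrA [conjc _ * _]mulrC mul_conjc -rmorphM.
  split; last by under eq_integral do rewrite ncM ncJ nc_cexp mulr1; exact: irp.2.
  apply: cmeasM; first exact: irp.1.
  apply: cmeasJ; apply: cmeas_cexp.
  exact: (@measurable_fun_dot _ _ R2 id (fun=> pdiv s x)).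
have mk : measurable_fun setT (fun x : R2 => wq x * nc (fourier psi (pdiv s x)) ^+ 2 : mR).
  apply: (measurable_funM (@measurable_wq R)).
  exact: measurableT_comp (cmeas_nc2 (psihat_cmeas psi_schwartz)) mp.
have k0 (x : R2) : 0 <= wq x * nc (fourier psi (pdiv s x)) ^+ 2 by rewrite mulr_ge0 ?wq_ge0 ?sqr_ge0.
have hk (x : R2) : wq x * nc (fourier psi (pdiv s x)) ^+ 2 <= M * kk x.
  have := wker_le psi_supp (0, 0) x s1 s2 hM; rewrite /wker ncM ncC ger0_norm ?wq_ge0// nc_Psi.
  rewrite -/C => h; rewrite expr2 mulrA mulrC.
  by apply: ler_pM => //; rewrite ?nc_ge0// mulr_ge0 ?wq_ge0 ?nc_ge0.
rewrite -(nc_cint_real mk k0).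
  by rewrite -(eq_cint _ e3) -e2// nc0.
apply: (@le_lt_trans _ _ (\int[leb2]_x (M * kk x)%:E)%E).
  by apply: le_intE => //; exact: (measurable_funM (measurable_cst _) mkk).
by rewrite (intEZ leb2 M0 mkk)// lte_mul_pinfty.
Qed.

Lemma psihat_sq_eq0 : (\int[leb2]_t (nc (fourier psi t) ^+ 2)%:E = 0)%E -> forall x, psi x = 0.
Proof.
move=> h0 x; have ip := psihat_cintegrable psi_schwartz psi_supp.
pose A := box ((1, 1) : R * R) 2.
have mb : measurable_fun setT (\1_A : R2 -> mR) := measurable_indic2 (measurable_box _ _).
have [m m0 hm] := box_finite ((1, 1) : R * R) 2.
have mn := cmeas_nc ip.1.
have k0 := @kap_gt0 R.
pose G (t : R2) := fourier psi t * conjc (cexp (dot x t)).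
have mG : cmeas G.
  apply: cmeasM; first exact: ip.1.
  by apply: cmeasJ; apply: cmeas_cexp; exact: (@measurable_fun_dot _ _ R2 (fun=> x) id).
have hle (t : R2) : nc (G t) <= nc (fourier psi t) * \1_A t.
  rewrite /G ncM ncJ nc_cexp mulr1.
  have [->|/(psihat_neq0 psi_supp)[/andP[? ?] /andP[? ?]]] := eqVneq (fourier psi t) 0.
    by rewrite nc0 mul0r.
  by rewrite indicE mem_set ?mulr1//; split => /=; rewrite ltr_norml; apply/andP; split; lra.
have m1 : (\int[leb2]_t (\1_A t : R)%:E <= (m + 1)%:E)%E.
  by rewrite hm lee_fin; lra.
have m2 : 0 < m + 1 by lra.
have := nc_cint_CauchySchwarz mG mn mb (fun t => nc_ge0 _) (fun t => ltac:(by rewrite indicE)) m2 m1 hle.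
rewrite (psi_inversion psi_schwartz psi_supp) => h.
have h2 : ((nc (kap%:C * psi x) ^+ 2)%:E <= 0)%E.
  apply: (le_trans h); rewrite [X in (_ * X)%E](_ : _ = 0)%E ?mule0//.
  apply/eqP; rewrite eq_le; apply/andP; split; last first.
    by apply: intE_ge0 => t; apply: mulr_ge0; [exact: sqr_ge0|rewrite indicE].
  rewrite -h0; apply: le_intE.
  - exact: (measurable_funM (cmeas_nc2 ip.1) mb).
  - exact: cmeas_nc2 ip.1.
  - by move=> t; apply: mulr_ge0; [exact: sqr_ge0|rewrite indicE].
  - by move=> t; rewrite ler_piMr ?sqr_ge0// indicE; case: (_ \in _).
apply: nc_eq0; move: h2; rewrite lee_fin ncM ncC gtr0_norm// exprMn pmulr_rle0 ?exprn_gt0//.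
by move=> h2; apply/eqP; rewrite -sqrf_eq0 eq_le h2 sqr_ge0.
Qed.

Lemma psihat_quad (s x : R * R) : quad x -> fourier psi (pdiv s x) != 0 -> quad s.
Proof.
move=> [x1 x2] /(psihat_neq0 psi_supp)[] /=.
rewrite !ler_pdivlMr// => /andP[h3 _] /andP[h4 _]; split; lra.
Qed.

Lemma pdiv_affine (s x : R * R) : quad x -> pdiv (affine2 (0, 0) x s) x = s.
Proof.
case: s => a c [x1 x2]; rewrite /pdiv /affine2/= !add0r.
by rewrite [x.1 * _]mulrC [x.2 * _]mulrC !mulfK ?gt_eqF.
Qed.

Lemma avg_neq0 : (exists x, psi x != 0) -> exists v, avg psi v (1, 1) != 0.
Proof.
move=> [x /eqP px]; apply: contrapT => hv; apply: px; apply: psihat_sq_eq0.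
have h0 v : avg psi v (1, 1) = 0.
  by apply: contrapT => /eqP h; apply: hv; exists v.
have h1 s : quad s -> (\int[leb2]_x (wq x * nc (fourier psi (pdiv s x)) ^+ 2)%:E = 0)%E.
  by move=> qs; apply: avg_eq0_sq => // v; case: qs => ? ?; rewrite avg_const.
have [B B0 hB] := psihat_sq psi_schwartz psi_supp.
have i0 : (0 <= \int[leb2]_t (nc (fourier psi t) ^+ 2)%:E)%E by apply: intE_ge0 => t; exact: sqr_ge0.
have [b b0 hb] := lty_fine i0 (le_lt_trans hB (ltry _)).
have mn := cmeas_nc2 (psihat_cmeas psi_schwartz).
pose G (s x : R2) : R := \1_(@quad R) s * (wq x * nc (fourier psi (pdiv s x)) ^+ 2).
have mG : measurable_fun setT (fun z : R2 * R2 => G z.1 z.2 : mR).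
  apply: measurable_funM; first exact: measurableT_comp (measurable_indic2 (@measurable_quad R)) measurable_fst.
  apply: measurable_funM; first exact: measurableT_comp (@measurable_wq R) measurable_snd.
  apply: (measurableT_comp mn); apply: measurable_pdiv; [exact: measurable_fst|exact: measurable_snd].
have G0 s x' : 0 <= G s x'.
  by apply: mulr_ge0; [rewrite indicE|apply: mulr_ge0; [exact: wq_ge0|exact: sqr_ge0]].
have e1 : (\int[leb2]_s \int[leb2]_x (G s x)%:E = 0)%E.
  apply: integral0_eq => s _; have [qs|qs] := asboolP (quad s).
    rewrite -(h1 s qs); congr (integral _ _ _); apply/funext => x1; congr EFin.
    by rewrite /G (indic1 qs) mul1r.
  apply: integral0_eq => x1 _.
  by rewrite /G (indic0 qs) mul0r.
have e2 (x' : R2) : (\int[leb2]_s (G s x')%:E = (b * \1_(@quad R) x')%:E)%E.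
  have [qx|qx] := asboolP (quad x'); last first.
    rewrite (indic0 qx) mulr0; apply: integral0_eq => ? _.
    by rewrite /G (wq_eq0 qx) mul0r mulr0.
  case: (qx) => x1 x2; have xx : 0 < x'.1 * x'.2 by rewrite mulr_gt0.
  have mk : measurable_fun setT (fun s : R2 => nc (fourier psi (pdiv s x')) ^+ 2 : mR).
    by apply: (measurableT_comp mn); exact: (@measurable_pdiv _ _ R2 id (fun=> x')).
  have -> : (fun s : R2 => (G s x')%:E) = fun s : R2 => (wq x' * nc (fourier psi (pdiv s x')) ^+ 2)%:E.
    apply/funext => s; rewrite /G; have [->|] := eqVneq (fourier psi (pdiv s x')) 0.
      by rewrite nc0 expr0n/= mulr0 mulr0.
    move=> /(psihat_quad qx) qs.
    by rewrite (indic1 qs) mul1r.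
  rewrite (intEZ leb2 (wq_ge0 x') mk (fun s => sqr_ge0 _)).
  rewrite (integralR_affine2 (0, 0) (lt0r_neq0 x1) (lt0r_neq0 x2) mk (fun s => sqr_ge0 _)).
  have -> : (fun s : R2 => (nc (fourier psi (pdiv (affine2 (0, 0) x' s) x')) ^+ 2)%:E) =
      fun s => (nc (fourier psi s) ^+ 2)%:E.
    by apply/funext => s; rewrite (pdiv_affine s qx).
  rewrite hb (wqE qx) (gtr0_norm xx) (indic1 qx) mulr1 muleA -!EFinM mulVf ?mul1r//.
  exact: lt0r_neq0 xx.
move: e1; rewrite (@tonelliR _ _ _ _ _ leb2 leb2 G mG G0); under eq_integral do rewrite e2.
rewrite (intEZ leb2 b0 (measurable_indic2 (@measurable_quad R))) => [|y]; last by rewrite indicE.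
move=> /eqP; rewrite mule_eq0 => /orP[/eqP e|]; last by rewrite gt_eqF// integral_quad_gt0.
exact: etrans hb e.
Qed.

End AveragingNonzero.

Section Window.
Context {R : realType}.
Local Notation R2 := (measurableTypeR R * measurableTypeR R)%type.
Local Notation mR := (measurableTypeR R).

(* The square ]10/21, 21/10[^2: it contains [xi / tau] as soon as
   [1/2 <= sigma / xi <= 2] and [`|tau - sigma| <= tau / 25]. *)
Definition win : set (R * R) := box (541 / 420, 541 / 420) (341 / 420).

Lemma winP (t : R * R) : win t <->
  (10 / 21 < t.1 < 21 / 10) /\ (10 / 21 < t.2 < 21 / 10).
Proof.
have h (a : R) : (`|541 / 420 - a| < 341 / 420) = (10 / 21 < a < 21 / 10).
  by rewrite ltr_norml; apply/andP/andP => -[? ?]; split; lra.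
by rewrite /win /box /= !h.
Qed.

Definition wwin (tau xi : R * R) : R := wq xi * \1_win (pdiv xi tau).

Lemma indic_ge0 (A : set (R * R)) x : 0 <= \1_A x :> R.
Proof. by rewrite indicE. Qed.

Lemma wwin_ge0 tau xi : 0 <= wwin tau xi.
Proof. by apply: mulr_ge0; [exact: wq_ge0|exact: indic_ge0]. Qed.

Lemma measurable_wwin d (T : measurableType d) (u v : T -> R2) :
  measurable_fun setT u -> measurable_fun setT v ->
  measurable_fun setT (fun x => wwin (u x) (v x) : mR).
Proof.
move=> mu' mv; apply: measurable_funM.
  exact: measurableT_comp (@measurable_wq R) mv.
apply: (measurableT_comp (measurable_indic2 (measurable_box _ _))).
exact: measurable_pdiv.
Qed.

Lemma wwin_eq0 tau xi : ~ win (pdiv xi tau) -> wwin tau xi = 0.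
Proof. by move=> h; rewrite /wwin (indic0 h) mulr0. Qed.

Lemma invr_le_win (a : R) : 10 / 21 < a -> 0 < a /\ a^-1 <= 21 / 10.
Proof.
move=> ha; have a0 : 0 < a by lra.
by split => //; rewrite -[leRHS]invrK lef_pV2 ?posrE ?invr_gt0//; lra.
Qed.

Lemma integral_wwin : exists2 K : R, 0 < K &
  forall tau, quad tau -> (\int[leb2]_xi (wwin tau xi)%:E <= K%:E)%E.
Proof.
have [m m0 hm] := box_finite ((541 / 420, 541 / 420) : R * R) (341 / 420).
have c0 : 0 <= (21 / 10) ^+ 2 :> R by exact: sqr_ge0.
exists ((21 / 10) ^+ 2 * m + 1); first by rewrite ltr_wpDl// mulr_ge0.
move=> tau [t1 t2]; have tt : 0 < tau.1 * tau.2 by rewrite mulr_gt0.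
have mw : measurable_fun setT (fun xi : R2 => wwin tau xi : mR).
  exact: (@measurable_wwin _ R2 (fun=> tau) id).
have mb := measurable_indic2 (measurable_box ((541 / 420, 541 / 420) : R * R) (341 / 420)).
rewrite (integralR_affine2 (0, 0) (lt0r_neq0 t1) (lt0r_neq0 t2) mw (wwin_ge0 tau)).
rewrite (gtr0_norm tt) -(intEZ leb2 (ltW tt) _ (fun x => wwin_ge0 _ _)); last first.
  exact: measurableT_comp mw (measurable_affine2 _ _).
apply: (@le_trans _ _ (\int[leb2]_x ((21 / 10) ^+ 2 * \1_win x)%:E)%E); last first.
  rewrite (intEZ leb2 c0 mb (indic_ge0 _)) hm -EFinM lee_fin; lra.
apply: le_intE.
- apply: (measurable_funM (measurable_cst _)).
  exact: measurableT_comp mw (measurable_affine2 _ _).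
- exact: (measurable_funM (measurable_cst _) mb).
- by move=> x; apply: mulr_ge0; [exact: ltW|exact: wwin_ge0].
- move=> x; rewrite /wwin.
  have -> : pdiv (affine2 (0, 0) tau x) tau = x.
    case: x => a c; rewrite /pdiv /affine2/= !add0r.
    by rewrite [tau.1 * _]mulrC [tau.2 * _]mulrC !mulfK ?gt_eqF.
  have [h|h] := asboolP (win x); last by rewrite (indic0 h) !mulr0.
  rewrite (indic1 h) !mulr1; move/winP: h => [/andP[h1 h2] /andP[h3 h4]].
  have [x1 i1] := invr_le_win h1; have [x2 i2] := invr_le_win h3.
  rewrite wqE; last by split; rewrite /= add0r mulr_gt0.
  rewrite /= !add0r; have -> : tau.1 * tau.2 * (tau.1 * x.1 * (tau.2 * x.2))^-1 = x.1^-1 * x.2^-1.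
    by field; rewrite !gt_eqF.
  by rewrite expr2 ler_pM// invr_ge0 ltW.
Qed.

Variable psi : R * R -> R[i].
Hypothesis psi_schwartz : schwartz psi.
Hypothesis psi_supp : supp (fourier psi) `<=` `[1 / 2, 2] `*` `[1 / 2, 2].

Definition pker (v tau s xi : R * R) : R[i] := (wwin tau xi)%:C * Psi psi v (pdiv s xi).

Lemma cmeas_pker v d (T : measurableType d) (t u w : T -> R2) :
  measurable_fun setT t -> measurable_fun setT u -> measurable_fun setT w ->
  cmeas (fun x => pker v (t x) (u x) (w x)).
Proof.
move=> mt mu' mw; apply: cmeasM; first by apply: cmeas_re; exact: measurable_wwin.
apply: (cmeas_Psi psi_schwartz (u := fun=> v) (v := fun x => pdiv (u x) (w x))) => //.
exact: measurable_pdiv.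
Qed.

Lemma nc_pker v tau s xi : nc (pker v tau s xi) = wwin tau xi * nc (fourier psi (pdiv s xi)).
Proof. by rewrite /pker ncM ncC nc_Psi ger0_norm ?wwin_ge0. Qed.

Lemma pker_wker v tau s xi : quad tau -> `|tau.1 - s.1| <= tau.1 / 25 ->
  `|tau.2 - s.2| <= tau.2 / 25 -> pker v tau s xi = wker psi v s xi.
Proof.
move=> [t1 t2]; rewrite !ler_norml => /andP[h1 h2] /andP[h3 h4].
have -> : pker v tau s xi = wker psi v s xi * (\1_win (pdiv xi tau))%:C.
  by rewrite /pker /wker /wwin rmorphM; exact: mulrAC.
have [h0|h0] := eqVneq (wker psi v s xi) 0; first by rewrite h0 mul0r.
suff w : win (pdiv xi tau) by rewrite (indic1 w) mulr1.
have [[x1 x2] /andP[h5 h6] /andP[h7 h8]] := wker_supp psi_supp h0.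
apply/winP; rewrite /= (ltr_pdivlMr _ _ t1) (ltr_pdivlMr _ _ t2) (ltr_pdivrMr _ _ t1) (ltr_pdivrMr _ _ t2).
by split; apply/andP; split; lra.
Qed.

Lemma cint_pker_near v tau s : quad tau -> `|tau.1 - s.1| <= tau.1 / 25 ->
  `|tau.2 - s.2| <= tau.2 / 25 ->
  cint leb2 (pker v tau s : R2 -> R[i]) = avg psi v (1, 1).
Proof.
move=> qt h1 h2; case: (qt) => t1 t2.
rewrite -(avg_const psi_schwartz psi_supp v (s := s)); first last.
- by move: h2; rewrite ler_norml => /andP[? ?]; lra.
- by move: h1; rewrite ler_norml => /andP[? ?]; lra.
by apply: eq_cint => xi; exact: pker_wker.
Qed.

Lemma cint_pker_bound : exists2 D : R, 0 <= D & forall v tau s, quad tau ->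
  nc (cint leb2 (pker v tau s : R2 -> R[i])) <= D.
Proof.
have [M M0 hM] := fourier_bound (schwartz_cintegrable psi_schwartz).
have [K K0 hK] := integral_wwin.
exists (2 * (M * K)); first by rewrite !mulr_ge0// ltW.
move=> v tau s qt.
have mp : cmeas (pker v tau s : R2 -> R[i]).
  exact: (@cmeas_pker v _ R2 (fun=> tau) (fun=> s) id).
have mw : measurable_fun setT (fun xi : R2 => wwin tau xi : mR).
  exact: (@measurable_wwin _ R2 (fun=> tau) id).
rewrite -lee_fin EFinM; apply: (le_trans (nc_cint leb2 mp)).
rewrite lee_pmul2l ?lte_fin//.
apply: (@le_trans _ _ (\int[leb2]_xi (M * wwin tau xi)%:E)%E).
  apply: le_intE.
  - exact: cmeas_nc.
  - exact: (measurable_funM (measurable_cst _) mw).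
  - by move=> x; exact: nc_ge0.
  - by move=> x; rewrite nc_pker mulrC ler_wpM2r ?wwin_ge0.
rewrite (intEZ leb2 M0 mw (wwin_ge0 tau)) EFinM lee_wpmul2l ?lee_fin//.
exact: hK.
Qed.

End Window.

(** * Fourier energy in terms of the wavelet transform *)


Section Products.
Context {R : realType}.
Local Notation R2 := (measurableTypeR R * measurableTypeR R)%type.
Local Notation mR := (measurableTypeR R).

Lemma sub2_affine (t s : R * R) : sub2 t s = affine2 t (-1, -1) s.
Proof. by rewrite /sub2 /affine2/= !mulN1r. Qed.

Lemma sub2K (t s : R * R) : sub2 t (sub2 t s) = s.
Proof. by case: s => a b; rewrite /sub2/=; congr (_, _); rewrite subKr. Qed.

Variables phi g : R * R -> R[i].
Hypothesis iphi : cintegrable leb2 (phi : R2 -> R[i]).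
Hypothesis iphihat : cintegrable leb2 (fourier phi : R2 -> R[i]).
Hypothesis ig : cintegrable leb2 (g : R2 -> R[i]).

Lemma cintegrable_sub2 (h : R2 -> R[i]) (tau : R * R) : cintegrable leb2 h ->
  cintegrable leb2 (fun s : R2 => h (sub2 tau s)).
Proof.
move=> ih; have n1 : (-1 : R) != 0 by rewrite oppr_eq0.
have -> : (fun s : R2 => h (sub2 tau s)) = fun s => h (affine2 tau (-1, -1) s).
  by apply/funext => s; rewrite sub2_affine.
exact: (cintegrable_affine2 tau (b := (-1, -1)) n1 n1 ih).
Qed.

Lemma cint_sub2 (h : R2 -> R[i]) (tau : R * R) : cintegrable leb2 h ->
  cint leb2 h = cint leb2 (fun s : R2 => h (sub2 tau s)).
Proof.
move=> ih; have n1 : (-1 : R) != 0 by rewrite oppr_eq0.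
rewrite (cint_affine2 tau (b := (-1, -1)) n1 n1 ih) mulrNN mulr1 normr1 mul1r.
by apply: eq_cint => s; rewrite sub2_affine.
Qed.

Lemma cintegrable_boundedM (h k : R2 -> R[i]) (M : R) : cintegrable leb2 h -> cmeas k ->
  (forall x, nc (k x) <= M) -> cintegrable leb2 (fun x => h x * k x).
Proof.
move=> ih mk hM; have M0 : 0 <= M by apply: le_trans (hM (0, 0)); exact: nc_ge0.
have mn := cmeas_nc ih.1.
apply: (@cintegrable_le _ _ R2 leb2 _ (fun x => M * nc (h x))).
- exact: cmeasM ih.1 mk.
- exact: (measurable_funM (measurable_cst _) mn).
- by move=> x; rewrite ncM mulrC ler_wpM2r ?nc_ge0.
- by rewrite (intEZ leb2 M0 mn (fun x => nc_ge0 _)) lte_mul_pinfty// ih.2.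
Qed.

Lemma product_fourier (M : R) (tau : R * R) : (forall x, nc (phi x) <= M) ->
  (forall x, cint leb2 (fun t : R2 => fourier phi t * conjc (cexp (dot x t))) = kap%:C * phi x) ->
  kap%:C * fourier (fun x => phi x * g x) tau =
  cint leb2 (fun s : R2 => fourier g s * fourier phi (sub2 tau s)).
Proof.
move=> hM hinv; have [N N0 hN] := fourier_bound ig.
have mghat := cmeas_fourier ig.1.
pose G (x t : R2) := (g x * cexp (dot x tau)) * (fourier phi t * conjc (cexp (dot x t))).
have mG : cmeas (fun z : R2 * R2 => G z.1 z.2).
  apply: cmeasM.
    exact: cmeas_comp (cintegrable_fourier tau ig).1 measurable_fst.
  apply: cmeasM; first exact: cmeas_comp iphihat.1 measurable_snd.
  by apply: cmeasJ; apply: cmeas_cexp; exact: measurable_dot2.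
have hG (x t : R2) : nc (G x t) <= nc (g x) * nc (fourier phi t).
  by rewrite /G !ncM ncJ !nc_cexp !mulr1.
have ipg : cintegrable leb2 (fun x : R2 => phi x * g x).
  have -> : (fun x : R2 => phi x * g x) = fun x => g x * phi x.
    by apply/funext => x; rewrite mulrC.
  exact: cintegrable_boundedM ig iphi.1 hM.
have iin (x : R2) : cintegrable leb2 (fun t : R2 => fourier phi t * conjc (cexp (dot x t))).
  apply: (cintegrable_boundedM (M := 1) iphihat).
    by apply: cmeasJ; apply: cmeas_cexp; exact: (@measurable_fun_dot _ _ R2 (fun=> x) id).
  by move=> t; rewrite ncJ nc_cexp.
have e1 : kap%:C * fourier (fun x => phi x * g x) tau = cint leb2 (fun x => cint leb2 (G x)).
  rewrite fourierE -cintZ; last exact: cintegrable_fourier.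
  apply: eq_cint => x; rewrite /G cintZ// hinv; move: (kap%:C) (phi x) (g x) (cexp _) => a b c d; ring.
rewrite e1 (@cint_Fubini_le _ _ _ _ _ leb2 leb2 G _ _ mG (cmeas_nc ig.1) (cmeas_nc iphihat.1)
  (fun=> nc_ge0 _) (fun=> nc_ge0 _) ig.2 iphihat.2 hG).
have e2 (t : R2) : cint leb2 (G^~ t) = fourier phi t * fourier g (sub2 tau t).
  rewrite [fourier g _]fourierE -cintZ; last exact: cintegrable_fourier.
  apply: eq_cint => x; rewrite /G [dot x (sub2 _ _)]dotC dot_sub2 cexpB (dotC tau) (dotC t).
  move: (fourier _ _) (g x) (cexp _) (conjc _) => a b c d; ring.
have mgs : cmeas (fun t : R2 => fourier g (sub2 tau t)).
  by apply: (cmeas_comp mghat); exact: (@measurable_sub2 _ _ R2 (fun=> tau) id).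
have ih := cintegrable_boundedM iphihat mgs (fun t => hN (sub2 tau t)).
rewrite (eq_cint _ e2) (cint_sub2 tau ih).
by apply: eq_cint => s; rewrite sub2K mulrC.
Qed.

Variable psi : R * R -> R[i].
Hypothesis psi_schwartz : schwartz psi.
Hypothesis psi_supp : supp (fourier psi) `<=` `[1 / 2, 2] `*` `[1 / 2, 2].

Definition Vt (v tau xi : R * R) : R[i] :=
  cint leb2 (fun s : R2 => fourier g s * fourier phi (sub2 tau s) * Psi psi v (pdiv s xi)).

Definition shift2 (v xi x : R * R) : R * R := (x.1 + v.1 / xi.1, x.2 + v.2 / xi.2).

Lemma cmeas_Vt_integrand v : cmeas (fun z : (R2 * R2) * R2 =>
  fourier g z.2 * fourier phi (sub2 z.1.1 z.2) * Psi psi v (pdiv z.2 z.1.2)).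
Proof.
have m11 : measurable_fun setT (fun z : (R2 * R2) * R2 => z.1.1).
  exact: measurableT_comp measurable_fst measurable_fst.
have m12 : measurable_fun setT (fun z : (R2 * R2) * R2 => z.1.2).
  exact: measurableT_comp measurable_snd measurable_fst.
have m2 : measurable_fun setT (fun z : (R2 * R2) * R2 => z.2) by exact: measurable_snd.
apply: cmeasM; first apply: cmeasM.
- exact: cmeas_comp (cmeas_fourier ig.1) m2.
- apply: (cmeas_comp iphihat.1 (u := fun z : (R2 * R2) * R2 => sub2 z.1.1 z.2)).
  exact: measurable_sub2.
- apply: (cmeas_Psi psi_schwartz (u := fun=> v) (v := fun z : (R2 * R2) * R2 => pdiv z.2 z.1.2)) => //.
  exact: measurable_pdiv.
Qed.

Lemma cmeas_Vt v : cmeas (fun z : R2 * R2 => Vt v z.1 z.2).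
Proof. exact: (cmeas_cint2 leb2 (cmeas_Vt_integrand v)). Qed.

Lemma cintegrable_Vt_integrand v tau xi : cintegrable leb2 (fun s : R2 =>
  fourier g s * fourier phi (sub2 tau s) * Psi psi v (pdiv s xi)).
Proof.
have [N N0 hN] := fourier_bound ig.
have [M M0 hM] := fourier_bound (schwartz_cintegrable psi_schwartz).
apply: (cintegrable_boundedM (M := M)); last first.
- by move=> x; rewrite nc_Psi.
- apply: (cmeas_Psi psi_schwartz (u := fun=> v) (v := fun s : R2 => pdiv s xi)) => //.
  exact: (@measurable_pdiv _ _ R2 id (fun=> xi)).
have -> : (fun s : R2 => fourier g s * fourier phi (sub2 tau s)) =
  fun s => fourier phi (sub2 tau s) * fourier g s by apply/funext => s; rewrite mulrC.
exact: cintegrable_boundedM (cintegrable_sub2 tau iphihat) (cmeas_fourier ig.1) hN.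
Qed.

Lemma wavelet_shift_bound v xi : exists2 B, 0 <= B & forall x, nc (wavelet psi g (shift2 v xi x) xi) <= B.
Proof.
have [N N0 hN] := fourier_bound (cintegrable_vfun psi_schwartz psi_supp ig xi).
have k0 := @kap_gt0 R.
exists (kap^-1 * (`|xi.1 * xi.2| * N)); first by rewrite mulr_ge0 ?mulr_ge0// invr_ge0 ltW.
move=> x; have := congr1 (fun z => nc z) (wavelet_fourier psi_schwartz psi_supp ig (shift2 v xi x) xi).
rewrite !ncM ncJ !ncC normr_id (gtr0_norm k0) => h.
rewrite ler_pdivlMl// h; apply: ler_wpM2l => //; exact: normr_ge0.
Qed.

Lemma Vt_fourier v tau xi : quad xi ->
  Vt v tau xi = kap%:C * fourier (fun x => phi x * wavelet psi g (shift2 v xi x) xi) tau.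
Proof.
move=> qx; case: (qx) => x1 x2; have xx : 0 < xi.1 * xi.2 by rewrite mulr_gt0.
have [N N0 hN] := fourier_bound ig.
have ip := psihat_cintegrable psi_schwartz psi_supp.
have [B B0 hB] := wavelet_shift_bound v xi.
have mW : cmeas (fun x : R2 => wavelet psi g (shift2 v xi x) xi).
  apply: (cmeas_comp (cmeas_wavelet (schwartz_cmeas psi_schwartz) ig.1) (u := fun x : R2 => (shift2 v xi x, xi) : R2 * R2)).
  apply: measurable_fun_pair => //; apply: measurable_fun_pair; apply: measurable_funD => //; exact: measurable_cst.
have iW : cintegrable leb2 (fun x : R2 => phi x * wavelet psi g (shift2 v xi x) xi).
  exact: cintegrable_boundedM iphi mW hB.
pose K (eta : R2) := `|xi.1 * xi.2|%:C * (Psi psi v eta * fourier g (pm xi eta)).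
have mK : cmeas K.
  apply: cmeasM; first exact: cmeas_cst.
  apply: cmeasM.
    by apply: (cmeas_Psi psi_schwartz (u := fun=> v) (v := id)).
  exact: cmeas_comp (cmeas_fourier ig.1) (measurable_pm1 xi).
pose G (x eta : R2) := (phi x * cexp (dot x tau)) * (K eta * conjc (cexp (dot x (pm xi eta)))).
have mG : cmeas (fun z : R2 * R2 => G z.1 z.2).
  apply: cmeasM.
    exact: cmeas_comp (cintegrable_fourier tau iphi).1 measurable_fst.
  apply: cmeasM; first exact: cmeas_comp mK measurable_snd.
  apply: cmeasJ; apply: cmeas_cexp.
  apply: (measurable_fun_dot measurable_fst (v := fun z : R2 * R2 => pm xi z.2)).
  exact: measurableT_comp (measurable_pm1 xi) measurable_snd.
have iK : cintegrable leb2 K.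
  apply: cintegrableZ; apply: (cintegrable_boundedM (M := N)) => //; last first.
    exact: cmeas_comp (cmeas_fourier ig.1) (measurable_pm1 xi).
  split; first exact: (cmeas_Psi psi_schwartz (u := fun=> v) (v := id)).
  by under eq_integral do rewrite nc_Psi; exact: ip.2.
have iin (x : R2) : cintegrable leb2 (fun eta : R2 => K eta * conjc (cexp (dot x (pm xi eta)))).
  have mc : cmeas (fun eta : R2 => conjc (cexp (dot x (pm xi eta)))).
    apply: cmeasJ; apply: cmeas_cexp.
    apply: (@measurable_fun_dot _ _ R2 (fun=> x) (pm xi)); [exact: measurable_cst|exact: measurable_pm1].
  apply: (cintegrable_boundedM (M := 1) iK mc) => t.
  by rewrite ncJ nc_cexp.
have hG (x t : R2) : nc (G x t) <= nc (phi x) * nc (K t).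
  by rewrite /G; move: (K t) => k; rewrite !ncM ncJ !nc_cexp !mulr1.
have eW (x : R2) : kap%:C * wavelet psi g (shift2 v xi x) xi =
    cint leb2 (fun eta : R2 => K eta * conjc (cexp (dot x (pm xi eta)))).
  rewrite (wavelet_fourier psi_schwartz psi_supp ig) fourierE -cintJ; last first.
    exact: cintegrable_fourier (cintegrable_vfun psi_schwartz psi_supp ig xi).
  rewrite -cintZ; last first.
    apply: cintegrableJ.
    exact: cintegrable_fourier (cintegrable_vfun psi_schwartz psi_supp ig xi).
  apply: eq_cint => eta; rewrite /K /Psi /vfun !conjcM conjcK.
  have -> : dot eta (pm xi (shift2 v xi x)) = dot v eta + dot x (pm xi eta).
    by rewrite /dot /pm /shift2 /=; field; rewrite !gt_eqF.
  have ac (a b c d e : R[i]) : a * (b * c * (d * e)) = a * (b * d * c) * e by ring.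
  rewrite cexpD conjcM; exact: ac.
have e1 : kap%:C * fourier (fun x => phi x * wavelet psi g (shift2 v xi x) xi) tau =
    cint leb2 (fun x => cint leb2 (G x)).
  rewrite fourierE -cintZ; last exact: cintegrable_fourier.
  have ac (a b c d : R[i]) : a * (b * c * d) = b * d * (a * c) by ring.
  by apply: eq_cint => x; rewrite /G cintZ// -eW ac.
rewrite e1 (@cint_Fubini_le _ _ _ _ _ leb2 leb2 G _ _ mG (cmeas_nc iphi.1) (cmeas_nc iK.1)
  (fun=> nc_ge0 _) (fun=> nc_ge0 _) iphi.2 iK.2 hG).
rewrite /Vt (cint_affine2 (0, 0) (lt0r_neq0 x1) (lt0r_neq0 x2) (cintegrable_Vt_integrand v tau xi)).
have iA := cintegrable_affine2 (0, 0) (lt0r_neq0 x1) (lt0r_neq0 x2) (cintegrable_Vt_integrand v tau xi).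
rewrite -(cintZ _ iA); apply: eq_cint => eta; rewrite (pdiv_affine eta qx) -pm_affine.
have -> : cint leb2 (G^~ eta) = K eta * fourier phi (sub2 tau (pm xi eta)).
  rewrite [fourier phi _]fourierE -cintZ; last exact: cintegrable_fourier.
  apply: eq_cint => x; rewrite /G [dot x (sub2 _ _)]dotC dot_sub2 cexpB (dotC tau) (dotC (pm xi eta)).
  move: (K eta) (phi x) (cexp _) (conjc _) => a b c d; ring.
rewrite /K; move: (Psi _ _ _) (fourier g _) (fourier phi _) (_%:C) => a b c d; ring.
Qed.

End Products.

Section Reproducing.
Context {R : realType}.
Local Notation R2 := (measurableTypeR R * measurableTypeR R)%type.
Local Notation mR := (measurableTypeR R).

Lemma shift2_affine (v xi x : R * R) :
  shift2 v xi x = affine2 (v.1 / xi.1, v.2 / xi.2) (1, 1) x.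
Proof. by rewrite /shift2 /affine2/= !mul1r [X in (X, _)]addrC [X in (_, X)]addrC. Qed.

Lemma integral_pk_sub2 (tau : R * R) : (\int[leb2]_s (pk (sub2 tau s))%:E = (kap : R)%:E)%E.
Proof.
have n1 : (-1 : R) != 0 by rewrite oppr_eq0.
rewrite -integral_pk (integralR_affine2 tau (b := (-1, -1)) n1 n1 measurable_pk); last first.
  by move=> z; exact/ltW/pk_gt0.
rewrite mulrNN mulr1 normr1 mul1e; apply: eq_integral => s _.
by rewrite sub2_affine.
Qed.

Variables phi g : R * R -> R[i].
Hypothesis iphi : cintegrable leb2 (phi : R2 -> R[i]).
Hypothesis iphihat : cintegrable leb2 (fourier phi : R2 -> R[i]).
Hypothesis ig : cintegrable leb2 (g : R2 -> R[i]).
Variable psi : R * R -> R[i].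
Hypothesis psi_schwartz : schwartz psi.
Hypothesis psi_supp : supp (fourier psi) `<=` `[1 / 2, 2] `*` `[1 / 2, 2].

Lemma Vt_plancherel (M r : R) (x0 v xi : R * R) : (forall x, nc (phi x) <= M) ->
  (forall x, ~ box x0 r x -> phi x = 0) -> quad xi ->
  `|v.1| <= r * xi.1 -> `|v.2| <= r * xi.2 ->
  (\int[leb2]_t (nc (Vt phi g psi v t xi) ^+ 2)%:E <=
   (4 * kap ^+ 3 * M ^+ 2)%:E * Iwave psi g (box x0 (2 * r)) xi)%E.
Proof.
move=> hM h0 qx hv1 hv2; case: (qx) => x1 x2.
have k0 := @kap_gt0 R.
pose W x := wavelet psi g (shift2 v xi x) xi.
have [B B0 hB] := wavelet_shift_bound ig psi_schwartz psi_supp v xi.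
have mA : measurable_fun setT (shift2 v xi : R2 -> R2).
  rewrite (_ : shift2 v xi = affine2 (v.1 / xi.1, v.2 / xi.2) (1, 1)); first exact: measurable_affine2.
  by apply/funext => x; exact: shift2_affine.
have mW0 : cmeas (fun x : R2 => wavelet psi g x xi).
  exact: (cmeas_section1 (G := fun x xi : R2 => wavelet psi g x xi) xi (cmeas_wavelet (schwartz_cmeas psi_schwartz) ig.1)).
have mW : cmeas (W : R2 -> R[i]) by exact: cmeas_comp mW0 mA.
have iW : cintegrable leb2 (fun x : R2 => phi x * W x) by exact: cintegrable_boundedM iphi mW hB.
have mF := cmeas_nc2 (cmeas_fourier iW.1).
have k2 : 0 <= kap ^+ 2 :> R by exact: sqr_ge0.
have e (t : R2) : nc (Vt phi g psi v t xi) ^+ 2 = kap ^+ 2 * nc (fourier (fun x => phi x * W x) t) ^+ 2.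
  by rewrite Vt_fourier// ncM ncC (gtr0_norm k0) exprMn.
rewrite (eq_integral _ _ (fun t _ => congr1 EFin (e t))).
rewrite (intEZ leb2 k2 mF (fun t => sqr_ge0 _)).
apply: (@le_trans _ _ ((kap ^+ 2)%:E * ((4 * kap)%:E * \int[leb2]_x (nc (phi x * W x) ^+ 2)%:E))%E).
  by rewrite lee_wpmul2l ?lee_fin//; exact: plancherel_le.
rewrite muleA -EFinM (_ : 4 * kap ^+ 3 * M ^+ 2 = kap ^+ 2 * (4 * kap) * M ^+ 2); last by ring.
rewrite [in leRHS]EFinM -[leRHS]muleA lee_wpmul2l//.
  by rewrite lee_fin mulr_ge0// mulr_ge0// ltW.
pose k (x : R2) : R := nc (wavelet psi g x xi) ^+ 2 * \1_(box x0 (2 * r)) x.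
have mk : measurable_fun setT (k : R2 -> mR).
  exact: (measurable_funM (cmeas_nc2 mW0) (measurable_indic2 (measurable_box _ _))).
have kge0 x : 0 <= k x by apply: mulr_ge0; [exact: sqr_ge0|exact: indic_ge0].
have -> : Iwave psi g (box x0 (2 * r)) xi = (\int[leb2]_x (k (shift2 v xi x))%:E)%E.
  rewrite /Iwave -/k (integralR_affine2 (v.1 / xi.1, v.2 / xi.2) (b := (1, 1)) (oner_neq0 _) (oner_neq0 _) mk kge0).
  rewrite mulr1 normr1 mul1e; apply: eq_integral => x _.
  by rewrite shift2_affine.
rewrite -(intEZ leb2 (sqr_ge0 M) (measurableT_comp mk mA) (fun x => kge0 _)).
apply: le_intE.
- exact: cmeas_nc2 iW.1.
- exact: (measurable_funM (measurable_cst _) (measurableT_comp mk mA)).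
- by move=> x; exact: sqr_ge0.
move=> x; have [bx|nb] := asboolP (box x0 r x); last first.
  rewrite (h0 _ nb) mul0r nc0 expr0n/=; apply: mulr_ge0; [exact: sqr_ge0|exact: kge0].
have b2 : box x0 (2 * r) (shift2 v xi x).
  have q1 : `|v.1 / xi.1| <= r by rewrite normrM normfV (gtr0_norm x1) ler_pdivrMr.
  have q2 : `|v.2 / xi.2| <= r by rewrite normrM normfV (gtr0_norm x2) ler_pdivrMr.
  case: bx => b1 b2; split; rewrite /= opprD addrA (le_lt_trans (ler_normB _ _))//; lra.
have ek : k (shift2 v xi x) = nc (W x) ^+ 2 by rewrite /k (indic1 b2) mulr1.
rewrite [X in _ <= _ * X]ek ncM exprMn ler_wpM2r ?sqr_ge0//.
by rewrite ler_sqr ?nnegrE ?nc_ge0// (le_trans (nc_ge0 _) (hM x)).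
Qed.

Lemma Vt_window (v tau : R * R) : quad tau ->
  cint leb2 (fun xi : R2 => (wwin tau xi)%:C * Vt phi g psi v tau xi) =
  cint leb2 (fun s : R2 => fourier g s * fourier phi (sub2 tau s) *
    cint leb2 (pker psi v tau s : R2 -> R[i])).
Proof.
move=> qt; have [N N0 hN] := fourier_bound ig.
have [M M0 hM] := fourier_bound (schwartz_cintegrable psi_schwartz).
have [K K0 hK] := @integral_wwin R.
have iA := cintegrable_sub2 tau iphihat.
have mw : measurable_fun setT (fun xi : R2 => wwin tau xi : mR).
  exact: (@measurable_wwin _ _ R2 (fun=> tau) id).
pose G (xi s : R2) := (wwin tau xi)%:C *
  (fourier g s * fourier phi (sub2 tau s) * Psi psi v (pdiv s xi)).
have mG : cmeas (fun z : R2 * R2 => G z.1 z.2).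
  apply: cmeasM; first by apply: cmeas_re; exact: measurableT_comp mw measurable_fst.
  apply: (cmeas_comp (cmeas_Vt_integrand iphihat ig psi_schwartz v)
    (u := fun z : R2 * R2 => ((tau, z.1), z.2) : (R2 * R2) * R2)).
  by apply: measurable_fun_pair => //; apply: measurable_fun_pair.
pose u (xi : R2) : R := N * M * wwin tau xi.
have NM0 : 0 <= N * M by exact: mulr_ge0.
have mu' : measurable_fun setT (u : R2 -> mR) by exact: (measurable_funM (measurable_cst _) mw).
have u0 xi : 0 <= u xi by apply: mulr_ge0 => //; exact: wwin_ge0.
have iu : (\int[leb2]_x (u x)%:E < +oo)%E.
  rewrite (intEZ leb2 NM0 mw (wwin_ge0 tau)) lte_mul_pinfty//.
  exact: le_lt_trans (hK _ qt) (ltry _).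
have hG (xi s : R2) : nc (G xi s) <= u xi * nc (fourier phi (sub2 tau s)).
  have e := nc_Psi psi v (pdiv s xi).
  rewrite /G /u; move: (Psi _ _ _) e => z e; rewrite !ncM e ncC (ger0_norm (wwin_ge0 _ _)).
  have := hN s; have := hM (pdiv s xi).
  have := wwin_ge0 tau xi; have := nc_ge0 (fourier g s); have := nc_ge0 (fourier psi (pdiv s xi)).
  have := nc_ge0 (fourier phi (sub2 tau s)).
  move: (nc _) (nc _) (nc _) (wwin _ _) => a b c d a0 b0 c0 d0 h1 h2.
  rewrite (_ : d * (a * c * b) = a * b * (d * c)); last by ring.
  by rewrite -[leRHS]mulrA ler_wpM2r ?mulr_ge0 ?ler_pM.
rewrite [LHS](_ : _ = cint leb2 (fun xi => cint leb2 (G xi))); last first.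
  apply: eq_cint => xi.
  exact/esym/(cintZ _ (cintegrable_Vt_integrand iphihat ig psi_schwartz v tau xi)).
rewrite (@cint_Fubini_le _ _ _ _ _ leb2 leb2 G u _ mG mu' (cmeas_nc iA.1) u0
  (fun=> nc_ge0 _) iu iA.2 hG).
apply: eq_cint => s; rewrite -cintZ; last first.
  split; first exact: (@cmeas_pker _ _ psi_schwartz v _ R2 (fun=> tau) (fun=> s) id).
  apply: (@le_lt_trans _ _ (\int[leb2]_xi (M * wwin tau xi)%:E)%E).
    apply: le_intE.
    - exact: (cmeas_nc (@cmeas_pker _ _ psi_schwartz v _ R2 (fun=> tau) (fun=> s) id _ _ _)).
    - exact: (measurable_funM (measurable_cst _) mw).
    - by move=> x; exact: nc_ge0.
    - by move=> x; rewrite nc_pker mulrC ler_wpM2r ?wwin_ge0.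
  rewrite (intEZ leb2 M0 mw (wwin_ge0 tau)) lte_mul_pinfty//.
  exact: le_lt_trans (hK _ qt) (ltry _).
have ac (a b c : R[i]) : a * (b * c) = b * (a * c) by ring.
by apply: eq_cint => xi; rewrite /G /pker ac.
Qed.

Lemma remainder_decay (v : R * R) (a b : R) (N : nat) : 0 < a -> 0 < b ->
  (exists2 C, 0 <= C & forall z, nc (fourier phi z) <= C * pk z / jap z ^+ N) ->
  exists2 D, 0 <= D & forall tau, cone a b tau ->
    nc (avg psi v (1, 1) * cint leb2 (fun s : R2 => fourier g s * fourier phi (sub2 tau s)) -
        cint leb2 (fun xi : R2 => (wwin tau xi)%:C * Vt phi g psi v tau xi)) <= D / jap tau ^+ N.
Proof.
move=> a0 b0 [C C0 hC]; have [M M0 hM] := fourier_bound ig.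
have [P P0 hP] := cint_pker_bound psi_schwartz.
have r0 : 0 < 1 / 25 :> R by [].
have [K K0 hK] := jap_cone a0 b0 r0.
set c := avg psi v (1, 1).
pose E := M * (nc c + P) * (C * K ^+ N).
have E0 : 0 <= E.
  by apply: mulr_ge0; [apply: mulr_ge0 => //; apply: addr_ge0 => //; exact: nc_ge0|rewrite mulr_ge0// exprn_ge0// ltW].
exists (2 * (E * kap)); first by rewrite mulr_ge0// mulr_ge0// ltW// kap_gt0.
move=> tau ct; have qt : quad tau by case: ct.
have iA := cintegrable_sub2 tau iphihat.
have iB : cintegrable leb2 (fun s : R2 => fourier g s * fourier phi (sub2 tau s)).
  have -> : (fun s : R2 => fourier g s * fourier phi (sub2 tau s)) =
    fun s => fourier phi (sub2 tau s) * fourier g s by apply/funext => s; rewrite mulrC.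
  exact: cintegrable_boundedM iA (cmeas_fourier ig.1) hM.
pose p (s : R2) := cint leb2 (pker psi v tau s : R2 -> R[i]).
have mp : cmeas p.
  apply: (cmeas_cint1 leb2 (G := fun s xi : R2 => pker psi v tau s xi)).
  by apply: (cmeas_pker psi_schwartz v (t := fun=> tau) (u := fst) (w := snd)).
have iBp : cintegrable leb2 (fun s : R2 => fourier g s * fourier phi (sub2 tau s) * p s).
  by apply: (cintegrable_boundedM (M := P) iB mp) => s; exact: hP.
have -> : c * cint leb2 (fun s : R2 => fourier g s * fourier phi (sub2 tau s)) -
    cint leb2 (fun xi : R2 => (wwin tau xi)%:C * Vt phi g psi v tau xi) =
    cint leb2 (fun s : R2 => c * (fourier g s * fourier phi (sub2 tau s)) -
      fourier g s * fourier phi (sub2 tau s) * p s).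
  by rewrite (Vt_window v qt) (cintB (cintegrableZ c iB) iBp) (cintZ c iB).
have jt := exprn_gt0 N (jap_gt0 tau).
have Ej : 0 <= E / jap tau ^+ N by rewrite divr_ge0// ltW.
have mpk : measurable_fun setT (fun s : R2 => pk (sub2 tau s) : mR).
  apply: (measurableT_comp measurable_pk); exact: (@measurable_sub2 _ _ R2 (fun=> tau) id).
have iD := cintegrableD (cintegrableZ c iB) (cintegrableN iBp).
rewrite -lee_fin; apply: (le_trans (nc_cint leb2 iD.1)).
rewrite -mulrA EFinM lee_pmul2l ?lte_fin//.
apply: (@le_trans _ _ (\int[leb2]_s (E / jap tau ^+ N * pk (sub2 tau s))%:E)%E); last first.
  rewrite (intEZ leb2 Ej mpk (fun s => ltW (pk_gt0 _))) integral_pk_sub2 -EFinM lee_fin.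
  by rewrite mulrAC.
apply: le_intE.
- exact: cmeas_nc iD.1.
- exact: (measurable_funM (measurable_cst _) mpk).
- by move=> s; exact: nc_ge0.
move=> s.
have -> : c * (fourier g s * fourier phi (sub2 tau s)) - fourier g s * fourier phi (sub2 tau s) * p s =
  fourier g s * fourier phi (sub2 tau s) * (c - p s) by rewrite mulrC mulrBr.
have [h|h] := boolP ((`|tau.1 - s.1| <= tau.1 / 25) && (`|tau.2 - s.2| <= tau.2 / 25)).
  move/andP: h => [h1 h2]; rewrite /p (cint_pker_near psi_schwartz psi_supp v qt h1 h2) subrr mulr0 nc0.
  by rewrite mulr_ge0// ltW// pk_gt0.
have hz : jap tau <= K * jap (sub2 tau s).
  apply: (hK tau (sub2 tau s) ct); rewrite /sub2/=.
  by move: h; rewrite negb_and -!ltNge => /orP[h|h]; [left|right]; lra.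
have hp : nc (c - p s) <= nc c + P.
  by apply: (le_trans (ncD _ _)); rewrite ncN lerD// hP.
have jz := exprn_gt0 N (jap_gt0 (sub2 tau s)).
have hf : nc (fourier phi (sub2 tau s)) <= C * K ^+ N / jap tau ^+ N * pk (sub2 tau s).
  have hh : (jap (sub2 tau s) ^+ N)^-1 <= K ^+ N / jap tau ^+ N.
    rewrite ler_pdivlMr// mulrC ler_pdivrMr// -exprMn lerXn2r//.
    - by rewrite nnegrE ltW// jap_gt0.
    - by rewrite nnegrE ltW// mulr_gt0// jap_gt0.
  have ac (x y z w : R) : x * y * z * w = x * w * (y * z) by ring.
  apply: (le_trans (hC _)); rewrite ac; apply: ler_wpM2l => //.
  by apply: mulr_ge0 => //; exact/ltW/pk_gt0.
have ac (x y z w : R) : x * y * z * w = x * (y * z * w) by ring.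
rewrite !ncM /E ac [leLHS]mulrAC; apply: ler_pM => //; first by rewrite mulr_ge0 ?nc_ge0.
- exact: nc_ge0.
- by apply: ler_pM; [exact: nc_ge0|exact: nc_ge0|exact: hM|exact: hp].
Qed.

End Reproducing.

Section WindowEnergy.
Context {R : realType}.
Local Notation R2 := (measurableTypeR R * measurableTypeR R)%type.
Local Notation mR := (measurableTypeR R).

Definition far (T1 T2 : R) : set (R * R) := [set t | T1 < t.1 /\ T2 < t.2].

Lemma measurable_far T1 T2 : @measurable _ R2 (far T1 T2).
Proof.
rewrite (_ : far T1 T2 = [set z : R2 | T1 < z.1 :> R] `&` [set z : R2 | T2 < z.2 :> R]); last first.
  by apply/seteqP; split => z [].
by apply: measurableI; apply: measurable_lt => //; exact: measurable_cst.
Qed.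

(* The aperture: 21/10 * 21/10 * 11/10 < 5. *)
Lemma win_cone (rho T : R) (tau xi : R * R) : 0 < rho ->
  cone (10 / 11 * rho) (11 / 10 * rho) tau -> far T T tau -> win (pdiv xi tau) ->
  [/\ cone (1 / 5 * rho) (5 * rho) xi, jap tau <= (21 / 10) ^+ 2 * jap xi &
      far (10 / 21 * T) (10 / 21 * T) xi].
Proof.
move=> r0 [t1 t2 c1 c2] [f1 f2] /winP[]; rewrite /pdiv /=.
rewrite (ltr_pdivlMr _ _ t1) (ltr_pdivlMr _ _ t2) (ltr_pdivrMr _ _ t1) (ltr_pdivrMr _ _ t2).
move=> /andP[h1 h2] /andP[h3 h4].
have x1 : 0 < xi.1 by lra.
have x2 : 0 < xi.2 by lra.
have p1 : rho * tau.2 < rho * (21 / 10 * xi.2) by rewrite ltr_pM2l//; lra.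
have p2 : rho * (10 / 21 * xi.2) < rho * tau.2 by rewrite ltr_pM2l//; lra.
have p3 : 0 < rho * xi.2 by rewrite mulr_gt0.
split.
- split => //.
  + lra.
  + lra.
- have q1 : tau.1 ^+ 2 <= (21 / 10 * xi.1) ^+ 2 by apply: lerXn2r; rewrite ?nnegrE; lra.
  have q2 : tau.2 ^+ 2 <= (21 / 10 * xi.2) ^+ 2 by apply: lerXn2r; rewrite ?nnegrE; lra.
  by rewrite /jap; lra.
- by split => /=; lra.
Qed.

Variables phi g psi : R * R -> R[i].
Hypothesis iphi : cintegrable leb2 (phi : R2 -> R[i]).
Hypothesis iphihat : cintegrable leb2 (fourier phi : R2 -> R[i]).
Hypothesis ig : cintegrable leb2 (g : R2 -> R[i]).
Hypothesis psi_schwartz : schwartz psi.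
Hypothesis psi_supp : supp (fourier psi) `<=` `[1 / 2, 2] `*` `[1 / 2, 2].
Variables (M r T s rho : R) (x0 v : R * R).
Hypothesis phiM : forall x, nc (phi x) <= M.
Hypothesis phi0 : forall x, ~ box x0 r x -> phi x = 0.
Hypothesis s0 : 0 <= s.
Hypothesis rho0 : 0 < rho.
Hypothesis r0 : 0 < r.
Hypothesis hT1 : `|v.1| <= r * (10 / 21 * T).
Hypothesis hT2 : `|v.2| <= r * (10 / 21 * T).

Let Gam := cone (1 / 5 * rho) (5 * rho).
Let Xi := far (10 / 21 * T) (10 / 21 * T).
Let Gt := cone (10 / 11 * rho) (11 / 10 * rho) `&` far T T.

Definition Xt (tau : R * R) : R[i] :=
  cint leb2 (fun xi : R2 => (wwin tau xi)%:C * Vt phi g psi v tau xi).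

Lemma cmeas_Xt_integrand :
  cmeas (fun z : R2 * R2 => (wwin z.1 z.2)%:C * Vt phi g psi v z.1 z.2).
Proof.
apply: cmeasM; last exact: cmeas_Vt.
by apply: cmeas_re; exact: measurable_wwin measurable_fst measurable_snd.
Qed.

Lemma cmeas_Xt : cmeas (Xt : R2 -> R[i]).
Proof. exact: (cmeas_cint1 leb2 cmeas_Xt_integrand). Qed.

Let H (K : R) (tau xi : R2) : R := 4 * K * ((21 / 10) ^+ 2) `^ s *
  (Venergy s Gam xi * \1_Xi xi) * nc (Vt phi g psi v tau xi) ^+ 2.

Let measurable_H K : measurable_fun setT (fun z : R2 * R2 => H K z.1 z.2 : mR).
Proof.
apply: measurable_funM; last exact: cmeas_nc2 (cmeas_Vt iphihat ig psi_schwartz v).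
apply: measurable_funM; first exact: measurable_cst.
apply: (measurableT_comp (f := fun xi : R2 => Venergy s Gam xi * \1_Xi xi) _ measurable_snd).
apply: measurable_funM; first exact: measurable_Venergy (measurable_cone _ _).
exact: measurable_indic2 (measurable_far _ _).
Qed.

Let H_ge0 K tau xi : 0 <= K -> 0 <= H K tau xi.
Proof.
move=> K0; apply: mulr_ge0; last exact: sqr_ge0.
apply: mulr_ge0; first by rewrite mulr_ge0 ?powR_ge0// mulr_ge0.
by apply: mulr_ge0; [exact: Venergy_ge0|exact: indic_ge0].
Qed.

Let H_ge K tau xi : 0 <= K -> Gt tau ->
  4 * K * sobolev_weight s tau * (nc (Vt phi g psi v tau xi) ^+ 2 * wwin tau xi) <= H K tau xi.
Proof.
move=> K0 [ct ft].
have [qx|qx] := asboolP (quad xi); last first.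
  by rewrite /wwin wq_eq0// mul0r mulr0 mulr0; exact: H_ge0.
have [w|w] := asboolP (win (pdiv xi tau)); last first.
  by rewrite wwin_eq0// mulr0 mulr0; exact: H_ge0.
have [cx jx fx] := win_cone rho0 ct ft w.
have j0 : 0 <= (21 / 10) ^+ 2 :> R by exact: sqr_ge0.
have hs := sobolev_le_scale s0 j0 jx.
case: (qx) => x1 x2; have xx : 0 < xi.1 * xi.2 by rewrite mulr_gt0.
rewrite /H /wwin (indic1 w) (wqE qx) /Venergy (indic1 cx) (indic1 fx) !mulr1 (gtr0_norm xx).
have n0 := sqr_ge0 (nc (Vt phi g psi v tau xi)).
have i0 : 0 <= (xi.1 * xi.2)^-1 by rewrite invr_ge0 ltW.
move: n0 i0 hs; move: (nc _ ^+ 2) (_^-1) (sobolev_weight s tau) (sobolev_weight s xi) (_ `^ _) => n i a b p n0 i0 hs.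
rewrite (_ : 4 * K * a * (n * i) = 4 * K * (n * i) * a); last by ring.
rewrite (_ : 4 * K * p * (b * i) * n = 4 * K * (n * i) * (p * b)); last by ring.
by apply: ler_wpM2l => //; rewrite mulr_ge0 ?mulr_ge0.
Qed.

Lemma window_energy :
  (wavelet_energy s psi g (box x0 (2 * r)) Gam < +oo)%E ->
  (\int[leb2]_t (nc (Xt t) ^+ 2 * sobolev_weight s t * \1_Gt t)%:E < +oo)%E.
Proof.
have mb := measurable_box x0 (2 * r); have mpsi := schwartz_cmeas psi_schwartz.
have mGam : @measurable _ R2 Gam by exact: measurable_cone.
have mGt : @measurable _ R2 Gt by apply: measurableI; [exact: measurable_cone|exact: measurable_far].
rewrite (wavelet_energyE s mpsi ig.1 mb mGam) => hE.
have [K K0 hK] := @integral_wwin R.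
have mX := cmeas_Xt.
have hA : (\int[leb2]_t (nc (Xt t) ^+ 2 * sobolev_weight s t * \1_Gt t)%:E <=
           \int[leb2]_t \int[leb2]_x (H K t x)%:E)%E.
  apply: le_energy.
  - apply/measurable_EFinP; apply: (measurable_funM _ (measurable_indic2 mGt)).
    exact: (measurable_funM (cmeas_nc2 mX) (measurable_sobolev s)).
  - exact: (@measurable_int2 _ _ _ R2 R2 leb2 (H K) (measurable_H K) (fun t x => H_ge0 t x (ltW K0))).
  - by move=> t; rewrite lee_fin mulr_ge0 ?indic_ge0// mulr_ge0 ?sqr_ge0 ?sobolev_ge0.
  move=> t; have [Gtt|nG] := asboolP (Gt t); last first.
    by rewrite (indic0 nG) mulr0; apply: intE_ge0 => x; exact: H_ge0 (ltW K0).
  have qt : quad t by case: Gtt => -[].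
  rewrite (indic1 Gtt) mulr1.
  have mV : cmeas (fun x : R2 => Vt phi g psi v t x).
    exact: (cmeas_section2 (G := fun t x : R2 => Vt phi g psi v t x) t (cmeas_Vt iphihat ig psi_schwartz v)).
  have mw : measurable_fun setT (fun x : R2 => wwin t x : mR).
    exact: (@measurable_wwin _ _ R2 (fun=> t) id).
  have mI : cmeas (fun x : R2 => (wwin t x)%:C * Vt phi g psi v t x).
    by apply: cmeasM => //; exact: cmeas_re.
  have hI (x : R2) : nc ((wwin t x)%:C * Vt phi g psi v t x) <= nc (Vt phi g psi v t x) * wwin t x.
    by rewrite ncM ncC (ger0_norm (wwin_ge0 _ _)) mulrC.
  have cs := nc_cint_CauchySchwarz mI (cmeas_nc mV) mw (fun=> nc_ge0 _) (wwin_ge0 t) K0 (hK _ qt) hI.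
  have w0 := sobolev_ge0 s t.
  have mf : measurable_fun setT (fun x : R2 => nc (Vt phi g psi v t x) ^+ 2 * wwin t x : mR).
    exact: (measurable_funM (cmeas_nc2 mV) mw).
  have f0 (x : R2) : 0 <= nc (Vt phi g psi v t x) ^+ 2 * wwin t x.
    by apply: mulr_ge0; [exact: sqr_ge0|exact: wwin_ge0].
  have k0 : 0 <= 4 * K * sobolev_weight s t by rewrite mulr_ge0// mulr_ge0// ltW.
  apply: (@le_trans _ _ (\int[leb2]_x (4 * K * sobolev_weight s t * (nc (Vt phi g psi v t x) ^+ 2 * wwin t x))%:E)%E).
    rewrite (intEZ leb2 k0 mf f0) EFinM [in leRHS]EFinM muleAC.
    by rewrite lee_wpmul2r ?lee_fin.
  apply: le_intE.
  - exact: (measurable_funM (measurable_cst _) mf).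
  - exact: (measurable_section2 t (measurable_H K)).
  - by move=> x; exact: mulr_ge0.
  - by move=> x; exact: H_ge (ltW K0) Gtt.
apply: (le_lt_trans hA).
rewrite (@tonelliR _ _ _ _ _ leb2 leb2 (H K) (measurable_H K) (fun t x => H_ge0 t x (ltW K0))).
pose c : R := 4 * K * ((21 / 10) ^+ 2) `^ s * (4 * kap ^+ 3 * M ^+ 2).
have c0 : 0 <= c.
  apply: mulr_ge0; first by rewrite mulr_ge0 ?powR_ge0// mulr_ge0// ltW.
  by rewrite mulr_ge0 ?sqr_ge0// mulr_ge0// exprn_ge0// ltW// kap_gt0.
apply: (@le_lt_trans _ _ (\int[leb2]_x (c%:E * ((Venergy s Gam x)%:E * Iwave psi g (box x0 (2 * r)) x)))%E).
  apply: le_energy.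
  - have mHs : measurable_fun setT (fun z : R2 * R2 => H K z.2 z.1 : mR).
      exact: measurableT_comp (measurable_H K) (@measurable_swap _ _ _ _).
    exact: (@measurable_int2 _ _ _ R2 R2 leb2 (fun x t => H K t x) mHs (fun x t => H_ge0 t x (ltW K0))).
  - exact: (emeasurable_funM (measurable_cst _) (measurable_VI s mpsi ig.1 mb mGam)).
  - by move=> x; apply: intE_ge0 => t; exact: H_ge0 (ltW K0).
  move=> x; pose q : R := 4 * K * ((21 / 10) ^+ 2) `^ s * (Venergy s Gam x * \1_Xi x).
  have q0 : 0 <= q.
    apply: mulr_ge0; first by rewrite mulr_ge0 ?powR_ge0// mulr_ge0// ltW.
    by apply: mulr_ge0; [exact: Venergy_ge0|exact: indic_ge0].
  have rhs0 : (0 <= c%:E * ((Venergy s Gam x)%:E * Iwave psi g (box x0 (2 * r)) x))%E.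
    by apply: mule_ge0 => //; exact: VI_ge0.
  have mV : measurable_fun setT (fun t : R2 => nc (Vt phi g psi v t x) ^+ 2 : mR).
    apply: cmeas_nc2.
    exact: (cmeas_section1 (G := fun t x : R2 => Vt phi g psi v t x) x (cmeas_Vt iphihat ig psi_schwartz v)).
  rewrite (_ : (fun t => (H K t x)%:E) = fun t => (q * nc (Vt phi g psi v t x) ^+ 2)%:E)//.
  rewrite (intEZ leb2 q0 mV (fun=> sqr_ge0 _)).
  have [Gx|nG] := asboolP (Gam x); last first.
    by have -> : q = 0; [rewrite /q /Venergy (indic0 nG) mulr0 mul0r mulr0|rewrite mul0e].
  have [Xx|nX] := asboolP (Xi x); last first.
    by have -> : q = 0; [rewrite /q (indic0 nX) mulr0 mulr0|rewrite mul0e].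
  have qx : quad x by case: Gx.
  case: (Xx) => f1 f2.
  have hv1 : `|v.1| <= r * x.1 by apply: (le_trans hT1); rewrite ler_pM2l// ltW.
  have hv2 : `|v.2| <= r * x.2 by apply: (le_trans hT2); rewrite ler_pM2l// ltW.
  have hP := Vt_plancherel iphi iphihat ig psi_schwartz psi_supp phiM phi0 qx hv1 hv2.
  apply: (@le_trans _ _ (q%:E * ((4 * kap ^+ 3 * M ^+ 2)%:E * Iwave psi g (box x0 (2 * r)) x))%E).
    by apply: lee_wpmul2l => //; rewrite lee_fin.
  have e : q * (4 * kap ^+ 3 * M ^+ 2) = c * Venergy s Gam x.
    rewrite /q /c (indic1 Xx) mulr1; exact: mulrAC.
  by rewrite [leLHS]muleA [leRHS]muleA -!EFinM e.
have mVI := measurable_VI s mpsi ig.1 mb mGam.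
have VI0 (x : R2) : [set: R2] x -> (0 <= (Venergy s Gam x)%:E * Iwave psi g (box x0 (2 * r)) x)%E.
  by move=> _; exact: VI_ge0.
rewrite (ge0_integralZl_EFin leb2 measurableT VI0 mVI c0).
by rewrite lte_mul_pinfty.
Qed.

End WindowEnergy.

Section PartB.
Context {R : realType}.
Local Notation R2 := (measurableTypeR R * measurableTypeR R)%type.
Local Notation mR := (measurableTypeR R).

Lemma decay_weight (D j p y w : R) (m : nat) : 0 <= y -> 1 <= j -> 4 <= p * j ^+ 2 ->
  y <= D / j ^+ (m + 2) -> 0 <= w -> w <= j ^+ m -> y ^+ 2 * w <= D ^+ 2 * p.
Proof.
move=> y0 j1 hp hy w0 hw; have j0 : 0 < j by lra.
have jm := exprn_gt0 m j0; have j2 := exprn_gt0 2 j0; have jm2 := exprn_gt0 (m + 2) j0.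
have hy2 : y ^+ 2 <= D ^+ 2 * (j ^+ (m + 2)) ^- 2.
  rewrite -exprVn -exprMn lerXn2r// ?nnegrE//; exact: le_trans hy.
apply: (@le_trans _ _ (D ^+ 2 * (j ^+ (m + 2)) ^- 2 * j ^+ m)).
  by apply: ler_pM => //; exact: sqr_ge0.
rewrite -mulrA ler_wpM2l ?sqr_ge0// mulrC ler_pdivrMr ?exprn_gt0//.
have g1 : 1 <= j ^+ m by exact: exprn_ege1.
have g2 : 1 <= j ^+ 2 by exact: exprn_ege1.
rewrite exprD; move: hp g1 g2 jm j2; move: (j ^+ m) (j ^+ 2) => a b hp g1 g2 a0 b0.
have -> : p * (a * b) ^+ 2 = a * (a * b * (p * b)) by ring.
rewrite ler_peMr ?(ltW a0)// -[leLHS]mulr1 ler_pM//; last by lra.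
by rewrite -[leLHS]mulr1 ler_pM.
Qed.

Lemma energy_split (F X : R2 -> R[i]) (z : R[i]) (s T a b B D : R) (m : nat) :
  cmeas F -> cmeas X -> 0 < nc z -> 0 <= T -> 0 < a -> 0 < b -> 0 <= B -> 0 <= D ->
  (forall x, sobolev_weight s x <= jap x ^+ m) -> (forall t, nc (F t) <= B) ->
  (forall t, cone a b t -> nc (z * F t - X t) <= D / jap t ^+ (m + 2)) ->
  (\int[leb2]_t (nc (X t) ^+ 2 * sobolev_weight s t * \1_(cone a b `&` far T T) t)%:E < +oo)%E ->
  (\int[leb2]_t (nc (F t) ^+ 2 * sobolev_weight s t * \1_(cone a b) t)%:E < +oo)%E.
Proof.
move=> mF mX z0 T0 a0 b0 B0 D0 hm hB hD hA.
have mcone := @measurable_cone R a b.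
have mG : @measurable _ R2 (cone a b `&` far T T) by apply: measurableI => //; exact: measurable_far.
pose J : R := 1 + (T ^+ 2 + (T / a) ^+ 2 + ((b * T) ^+ 2 + T ^+ 2)).
have J1 : 1 <= J.
  by rewrite /J lerDl; do !apply: addr_ge0; exact: sqr_ge0.
have hJ t : cone a b t -> ~ far T T t -> jap t <= J.
  move=> [t1 t2 h1 h2] nf.
  have [k1|k1] := leP t.1 T.
    have k2 : t.2 <= T / a by rewrite ler_pdivlMr//; lra.
    rewrite /jap /J lerD2l -[leLHS]addr0 lerD ?addr_ge0 ?sqr_ge0//.
    by apply: lerD; rewrite lerXn2r// nnegrE ?divr_ge0 ?(ltW a0) ?(ltW t1) ?(ltW t2).
  have k2 : t.2 <= T by rewrite leNgt; apply/negP => k2; apply: nf.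
  have k3 : t.1 <= b * T by apply: (le_trans (ltW h2)); rewrite ler_pM2l.
  rewrite /jap /J lerD2l -[leLHS]add0r lerD ?addr_ge0 ?sqr_ge0//.
  by apply: lerD; rewrite lerXn2r// nnegrE ?mulr_ge0 ?(ltW b0) ?(ltW t1) ?(ltW t2).
pose C3 : R := 2 * (nc z) ^- 2 * D ^+ 2 + (B * J ^+ (m + 2)) ^+ 2.
pose C4 : R := 2 * (nc z) ^- 2.
have C40 : 0 <= C4 by rewrite mulr_ge0// invr_ge0 sqr_ge0.
have C30 : 0 <= C3 by rewrite addr_ge0 ?sqr_ge0// mulr_ge0// sqr_ge0.
have mw := measurable_sobolev s.
pose A (t : R2) : R := nc (X t) ^+ 2 * sobolev_weight s t * \1_(cone a b `&` far T T) t.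
have mA : measurable_fun setT (A : R2 -> mR).
  exact: (measurable_funM (measurable_funM (cmeas_nc2 mX) mw) (measurable_indic2 mG)).
have A0 t : 0 <= A t by rewrite /A mulr_ge0 ?indic_ge0// mulr_ge0 ?sqr_ge0 ?sobolev_ge0.
have p0 (t : R2) : 0 <= pk t :> R by exact/ltW/pk_gt0.
have m1 : measurable_fun setT (fun t : R2 => C3 * pk t : mR) := measurable_funM (measurable_cst _) measurable_pk.
have m2 : measurable_fun setT (fun t : R2 => C4 * A t : mR) := measurable_funM (measurable_cst _) mA.
apply: (@le_lt_trans _ _ (\int[leb2]_t (C3 * pk t + C4 * A t)%:E)%E); last first.
  rewrite (intED leb2 m1 m2 (fun t => mulr_ge0 C30 (p0 t)) (fun t => mulr_ge0 C40 (A0 t))).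
  rewrite (intEZ leb2 C30 measurable_pk p0) (intEZ leb2 C40 mA A0) integral_pk.
  by apply: lte_add_pinfty; [rewrite -EFinM ltry|apply: lte_mul_pinfty].
apply: le_intE.
- exact: (measurable_funM (measurable_funM (cmeas_nc2 mF) mw) (measurable_indic2 mcone)).
- exact: measurable_funD.
- by move=> t; rewrite mulr_ge0 ?indic_ge0// mulr_ge0 ?sqr_ge0 ?sobolev_ge0.
move=> t; have CA0 := mulr_ge0 C40 (A0 t); have Cp0 := mulr_ge0 C30 (p0 t).
have [ct|nct] := asboolP (cone a b t); last by rewrite (indic0 nct) mulr0; exact: addr_ge0.
rewrite (indic1 ct) mulr1.
have w0 := sobolev_ge0 s t; have n0 := nc_ge0 (F t); have j1 := jap_ge1 t; have hp := pk_ge t.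
have z2 : 0 <= 2 * (nc z) ^- 2 * D ^+ 2 by rewrite mulr_ge0// sqr_ge0.
have [ft|nft] := asboolP (far T T t); last first.
  have hF : nc (F t) <= B * J ^+ (m + 2) / jap t ^+ (m + 2).
    rewrite -mulrA; apply: (le_trans (hB t)); rewrite ler_peMr//.
    rewrite ler_pdivlMr ?exprn_gt0 ?jap_gt0// mul1r lerXn2r// ?nnegrE; last exact: hJ.
    + exact/ltW/jap_gt0.
    + by apply: le_trans J1.
  have := decay_weight n0 j1 hp hF w0 (hm t).
  have := mulr_ge0 z2 (p0 t); rewrite /C3 mulrDl; lra.
have nR := nc_ge0 (z * F t - X t).
have hR := decay_weight nR j1 hp (hD t ct) w0 (hm t).
have hs := ncD_sqr (z * F t - X t) (X t); rewrite subrK ncM exprMn in hs.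
have eA : A t = nc (X t) ^+ 2 * sobolev_weight s t by rewrite /A indic1 ?mulr1.
have zz : 0 < nc z ^+ 2 by rewrite exprn_gt0.
apply: (@le_trans _ _ (C4 * (nc (z * F t - X t) ^+ 2 * sobolev_weight s t) + C4 * A t)).
  rewrite eA /C4 -mulrDr -mulrDl mulrA ler_wpM2r//.
  rewrite -mulrA mulrCA [leRHS]mulrC ler_pdivlMr// mulrC; lra.
rewrite lerD2r; apply: (@le_trans _ _ (C4 * (D ^+ 2 * pk t))); first by rewrite ler_wpM2l.
rewrite mulrA; apply: ler_wpM2r => //; rewrite /C3 /C4 lerDl sqr_ge0//.
Qed.

Lemma microlocal_Hormander_of_wavelet_energy psi f (x0 xi0 : R * R) (s : R) U : schwartz psi -> (exists x, psi x != 0) ->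
  supp (fourier psi) `<=` `[1 / 2, 2] `*` `[1 / 2, 2] -> in_L2 f ->
  0 < xi0.1 -> 0 < xi0.2 -> 0 <= s -> meas_nbhs x0 U ->
  (wavelet_energy s psi f U (Gamma_psi xi0) < +oo)%E ->
  microlocal_Hormander s f x0 xi0.
Proof.
move=> hpsi hpsi0 hsupp fL x1 x2 s0 [/nbhs_boxP[r' r'0 hU] mU] hE.
pose r := r' / 4; have r0 : 0 < r by rewrite divr_gt0.
have r2 : 0 < 2 * r by rewrite mulr_gt0.
have r4 : r < 2 * (2 * r) by lra.
have r'2 : 2 * r < r' by rewrite /r; lra.
have [c1 c2] : (10 / 11 < 1 :> R) /\ (1 < 11 / 10 :> R) by lra.
have [phi [hcut phi0 hdecay]] := bump x0 r0.
have [mphi [M M0 hM] _ _] := cutoff_facts hcut.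
have [mf _] := in_L2P fL.
have mpsi := schwartz_cmeas hpsi.
have iphi : cintegrable leb2 (phi : R2 -> R[i]).
  have [m m0 hm] := box_finite x0 r.
  have mb := measurable_indic2 (measurable_box x0 r).
  apply: (@cintegrable_le _ _ R2 leb2 _ (fun x => M * \1_(box x0 r) x)) => //.
  - exact: (measurable_funM (measurable_cst _) mb).
  - move=> x; have [bx|nb] := asboolP (box x0 r x); first by rewrite (indic1 bx) mulr1.
    by rewrite (phi0 _ nb) nc0 (indic0 nb) mulr0.
  - by rewrite (intEZ leb2 M0 mb (indic_ge0 _)) hm -EFinM ltry.
have iphihat : cintegrable leb2 (fourier phi : R2 -> R[i]).
  have [C C0 hC] := hdecay 0; apply: (cintegrable_le_pk C0); first exact: cmeas_fourier.
  by move=> z; have := hC z; rewrite expr0 divr1.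
have hinv x : cint leb2 (fun t : R2 => fourier phi t * conjc (cexp (dot x t))) = kap%:C * phi x.
  have [[[sR sI] _] _] := hcut.
  exact: (fourier_inversion x iphi (sR [::]).1 (sI [::]).1 hM iphihat).
pose ib (x : R * R) : R := \1_(box x0 (2 * (2 * r))) x.
pose g (x : R * R) := (ib x)%:C * f x.
pose q (x : R * R) := g x - f x.
have mb2 : measurable_fun setT (ib : R2 -> mR) := measurable_indic2 (measurable_box _ _).
have mg : cmeas (g : R2 -> R[i]) by apply: cmeasM => //; exact: cmeas_re.
have hle x : nc (g x) <= 1 * nc (f x).
  rewrite /g ncM ncC ger0_norm ?indic_ge0//; apply: ler_wpM2r; first exact: nc_ge0.
  by rewrite /ib indicE; case: (_ \in _).
have gL := in_L2_le fL mg ler01 hle.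
have g0 x : ~ box x0 (2 * (2 * r)) x -> g x = 0 by move=> nb; rewrite /g /ib (indic0 nb) mul0r.
have g1 x : box x0 (2 * (2 * r)) x -> g x = f x by move=> nb; rewrite /g /ib (indic1 nb) mul1r.
have q0 x : box x0 (2 * (2 * r)) x -> q x = 0 by move=> /g1 e; rewrite /q e subrr.
have qL : in_L2 q.
  apply: (in_L2_le (M := 1) fL) => //; first exact: cmeasB.
  move=> x; have [bx|nb] := asboolP (box x0 (2 * (2 * r)) x).
    by rewrite q0// nc0 mul1r nc_ge0.
  by rewrite /q g0// sub0r ncN mul1r.
have ig : cintegrable leb2 (g : R2 -> R[i]) := cintegrable_local fL mg ler01 hle g0.
pose rho := xi0.1 / xi0.2.
have rho0 : 0 < rho by rewrite divr_gt0.
pose Gam := cone (1 / 5 * rho) (5 * rho).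
have mGam : @measurable _ R2 Gam by exact: measurable_cone.
have mB : @measurable _ R2 (box x0 (2 * r)) by exact: measurable_box.
have hEf : (wavelet_energy s psi f (box x0 (2 * r)) Gam < +oo)%E.
  move: hE; rewrite Gamma_psiE//; apply: le_lt_trans.
  apply: wavelet_energy_subset => //.
  by move=> y [h1 h2]; apply: hU; split; [exact: lt_trans h1 r'2|exact: lt_trans h2 r'2].
have hEq : (wavelet_energy s psi q (box x0 (2 * r)) Gam < +oo)%E.
  apply: wavelet_energy_loc => //.
  - by rewrite mulr_gt0//; lra.
  - by rewrite mulr_gt0//; lra.
have hEg : (wavelet_energy s psi g (box x0 (2 * r)) Gam < +oo)%E.
  apply: (@wavelet_energyD _ s psi g f q (box x0 (2 * r)) Gam) => //.
  - by move=> y; rewrite /q addrC subrK.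
  - by move=> xi [].
have [v hv] := avg_neq0 hpsi hsupp hpsi0.
set cc := avg psi v (1, 1) in hv.
pose T := (`|v.1| + `|v.2|) / (r * (10 / 21)).
have rr0 : 0 < r * (10 / 21) by rewrite mulr_gt0//; lra.
have T0 : 0 <= T by rewrite divr_ge0 ?addr_ge0 ?(ltW rr0).
have eT : r * (10 / 21 * T) = `|v.1| + `|v.2| by rewrite mulrA /T mulrC divfK// gt_eqF.
have hT1 : `|v.1| <= r * (10 / 21 * T) by rewrite eT lerDl.
have hT2 : `|v.2| <= r * (10 / 21 * T) by rewrite eT lerDr.
have hA := window_energy iphi iphihat ig hpsi hsupp hM phi0 s0 rho0 r0 hT1 hT2 hEg.
have [m hm] := @sobolev_le_jap R s s0.
have a0 : 0 < 10 / 11 * rho by rewrite mulr_gt0//; lra.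
have b0 : 0 < 11 / 10 * rho by rewrite mulr_gt0//; lra.
have [D D0 hD] := remainder_decay iphihat ig hpsi hsupp v a0 b0 (hdecay (m + 2)).
have ipg : cintegrable leb2 (fun x : R2 => phi x * g x).
  have -> : (fun x : R2 => phi x * g x) = fun x => g x * phi x.
    by apply/funext => x; rewrite mulrC.
  exact: cintegrable_boundedM ig mphi hM.
have [B B0 hB] := fourier_bound ipg.
have eF : (fun x : R * R => phi x * f x) = fun x => phi x * g x.
  apply/funext => x; have [bx|nb] := asboolP (box x0 r x); last by rewrite phi0// !mul0r.
  by rewrite g1//; case: bx => h1 h2; split; [exact: lt_trans h1 r4|exact: lt_trans h2 r4].
exists phi, (cone (10 / 11 * rho) (11 / 10 * rho)); split => //.
  exact: conical_cone (in_cone_ratio x1 x2 c1 c2).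
rewrite eF fourier_energyE.
have hz : 0 < nc (cc * kap%:C).
  rewrite lt_neqAle nc_ge0 andbT eq_sym; apply/eqP => /nc_eq0/eqP.
  rewrite mulf_eq0 (negbTE hv)/= => /eqP/(congr1 Re)/= h.
  by have := @kap_gt0 R; rewrite h ltxx.
have mX := cmeas_Xt iphihat ig hpsi v.
apply: (energy_split (cmeas_fourier ipg.1) mX hz T0 a0 b0 B0 D0 hm hB _ hA) => tau ct.
rewrite -mulrA (product_fourier iphi iphihat ig tau hM hinv).
exact: hD.
Qed.

End PartB.

Theorem theorem1 (R : realType) (psi : R * R -> R[i])
    (psi_schwartz : schwartz psi)
    (psi_neq0 : exists x : R * R, psi x != 0)
    (psi_supp : supp (fourier psi) `<=` `[1 / 2, 2] `*` `[1 / 2, 2])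
    (f : R * R -> R[i]) (f_L2 : in_L2 f)
    (x0 xi0 : R * R) (xi01_gt0 : 0 < xi0.1) (xi02_gt0 : 0 < xi0.2)
    (s : R) (s_ge0 : 0 <= s) :
  ((exists phi : R * R -> R[i], cutoff_at x0 phi /\
      (fourier_energy s (fun x => phi x * f x)%R (Gamma_psi xi0) < +oo)%E) ->
   microlocal_PU psi s f x0 xi0) /\
  ((exists U : set (R * R), meas_nbhs x0 U /\
      (wavelet_energy s psi f U (Gamma_psi xi0) < +oo)%E) ->
   microlocal_Hormander s f x0 xi0).
Proof.
split=> [[phi [hphi hE]]|[U [hU hE]]].
- exact: microlocal_PU_of_fourier_energy hE.
- exact: microlocal_Hormander_of_wavelet_energy hE.
Qed.
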